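(* Let $n\ge1$, let $\pi:\widetilde{\mathcal{N}}_1\to\mathcal{N}_1$ be the Springer resolution of the odd nilpotent cone of $\mathfrak{osp}(2n+1,2n)$, let $\mathcal{O}_1$ be the unique codimension $1$ orbit of $\mathrm{O}(V_0,\varphi)\times\mathrm{Sp}(V_1,\psi)$ in $\mathcal{N}_1$, and let $X\in\mathcal{N}_1$. The fiber $\pi^{-1}(X)$ is connected if and only if $X\notin\mathcal{O}_1$.
   Context: We work over $\mathbb{C}$. Let $V=V_0\oplus V_1$ be a $\mathbb{Z}/2\mathbb{Z}$-graded vector space with $\dim V_0=2n+1$, $\dim V_1=2n$, equipped with a bilinear form $B$ for which $V_0$ and $V_1$ are orthogonal, and whose restrictions $\varphi:V_0\to V_0^\vee$ and $\psi:V_1\to V_1^\vee$ are non-degenerate, respectively symmetric and alternating. For $u\in\mathrm{Hom}(V_0,V_1)$ let $u^*=\varphi^{-1}\circ u^t\circ\psi\in\mathrm{Hom}(V_1,V_0)$. The odd elements of $\mathfrak{osp}(2n+1,2n)$ are the endomorphisms $X=(u,u^* )$ of $V$ (acting as $u$ on $V_0$ and as $u^*$ on $V_1$), $u\in\mathrm{Hom}(V_0,V_1)$. The odd nilpotent cone $\mathcal{N}_1$ is the set of those $X=(u,u^* )$ that are nilpotent; the group $G_0\times G_1=\mathrm{O}(V_0,\varphi)\times \mathrm{Sp}(V_1,\psi)$ acts on it by conjugation with finitely many orbits. Let $B_0,B_1$ be Borel subgroups of $G_0,G_1$; $G_0/B_0$ (resp. $G_1/B_1$) is the variety of complete isotropic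 flags $(E_i)_{1\le i\le n}$ in $V_0$ (resp. $(F_j)_{1\le j\le n}$ in $V_1$), with $\dim E_i=i$, $\dim F_j=j$; set $E_0=F_0=0$. Put $$\widetilde{\mathcal{N}}_1=\{(u,(E_i),(F_j))\in \mathrm{Hom}(V_0,V_1)\times G_0/B_0\times G_1/B_1 : u(E_i)\subset F_{i-1},\ u^*(F_i)\subset E_i \text{ for all } 1\le i\le n\}$$ and let $\pi:\widetilde{\mathcal{N}}_1\to\mathcal{N}_1$ be the first projection; it is a resolution of singularities. Explicitly, orbits in $\mathcal{N}_1$ are classified by marked Young diagrams: diagrams whose boxes are labelled $0$ or $1$, alternating along each line (row), a line having parity $\epsilon$ (''even'' if $\epsilon=0$, ''odd'' if $\epsilon=1$) if its first label is $\epsilon$; the diagram of $X$ is the one in which, for all $k\ge1$ and $\epsilon\in\{0,1\}$, the number of lines of parity $\epsilon$ and length at least $k$ is $\dim(\ker X\cap \mathrm{Im}\,X^{k-1}\cap V_\epsilon)$. The orbit $\mathcal{O}_1$ has diagram consisting of one line $101\cdots101$ of length $4n-1$ and two lines $0$ of length $1$. *)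

(* Defs.v *)
From HB Require Import structures.
From mathcomp Require Import all_boot all_order all_algebra.
From mathcomp Require Import -(notations) mpoly.
From mathcomp Require Import complex.
From mathcomp Require Import all_classical all_reals topology.

Set Implicit Arguments.
Unset Strict Implicit.
Unset Printing Implicit Defensive.

Import GRing.Theory.

Local Open Scope classical_set_scope.
Local Open Scope ring_scope.

(* A bilinear form on W is given as the linear map b : W -> W^\vee it
   induces, so that the value of the form on (x, y) is b x y. *)
Notation bilform K W := 'Hom(W, 'Hom(W, K^o)).

Section Forms.
Context {K : fieldType}.
Implicit Types V W : vectType K.

Definition nondegenerate_bilform W (b : bilform K W) : Prop := lker b = 0%VS.
Definition symmetric_bilform W (b : bilform K W) : Prop :=
  forall x y, b x y = b y x.
Definition alternating_bilform W (b : bilform K W) : Prop :=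
  forall x, b x x = 0.

Definition isometries W (b : bilform K W) : set 'End(W) :=
  [set g | forall x y, b (g x) (g y) = b x y].

Definition precomp V W (u : 'Hom(V, W)) (f : 'Hom(W, K^o)) : 'Hom(V, K^o) :=
  (f \o u)%VF.

Fact precomp_is_linear V W (u : 'Hom(V, W)) : linear (precomp u).
Proof. by move=> a f g; rewrite /precomp comp_lfunDl comp_lfunZl. Qed.

HB.instance Definition _ V W (u : 'Hom(V, W)) :=
  GRing.isLinear.Build K 'Hom(W, K^o) 'Hom(V, K^o) _ (precomp u)
    (precomp_is_linear u).

Definition transpose V W (u : 'Hom(V, W)) :
  'Hom('Hom(W, K^o), 'Hom(V, K^o)) := linfun (precomp u).

End Forms.

Section OddPart.
Context {K : fieldType} {V0 V1 : vectType K}.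
Variables (phi : bilform K V0) (psi : bilform K V1).
Implicit Type u : 'Hom(V0, V1).

Definition adjoint u : 'Hom(V1, V0) := (phi^-1 \o transpose u \o psi)%VF.

Lemma adjointE u x y :
  nondegenerate_bilform phi -> phi (adjoint u y) x = psi y (u x).
Proof.
move=> phi_inj; rewrite /adjoint !comp_lfunE /= /transpose lfunE /=.
have -> : phi ((phi^-1)%VF (precomp u (psi y))) = precomp u (psi y).
  apply: limg_lfunVK; suff -> : limg phi = fullv by rewrite memvf.
  apply/eqP; rewrite eqEdim subvf /= limg_dim_eq ?phi_inj ?capv0 //.
  by rewrite !dimvf /= /dim /= muln1.
by rewrite comp_lfunE.
Qed.

Definition odd_fun u (v : V0 * V1) : V0 * V1 := (adjoint u v.2, u v.1).

Fact odd_fun_is_linear u : linear (odd_fun u).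
Proof. by move=> a v w; rewrite /odd_fun /= !linearP. Qed.

HB.instance Definition _ u :=
  GRing.isLinear.Build K (V0 * V1)%type (V0 * V1)%type _ (odd_fun u)
    (odd_fun_is_linear u).

(* The element X = (u, u^* ) of End(V_0 (+) V_1). *)
Definition odd_elt u : 'End((V0 * V1)%type) := linfun (odd_fun u).

Definition odd_elt_exp u k : 'End((V0 * V1)%type) :=
  iter k (comp_lfun (odd_elt u)) \1%VF.

(* Odd elements X = (u, u^* ) are identified with u throughout. *)
Definition odd_nilcone : set 'Hom(V0, V1) :=
  [set u | exists k, odd_elt_exp u k = 0].

(* Conjugation of (u, u^* ) by (g, h) has h u g^-1 as component V_0 -> V_1. *)
Definition conj_orbit u : set 'Hom(V0, V1) :=
  [set w | exists g h, [/\ isometries phi g, isometries psi h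
                         & w = (h \o u \o g^-1)%VF]].

Definition nilpotent_orbit (O : set 'Hom(V0, V1)) : Prop :=
  exists2 u, odd_nilcone u & O = conj_orbit u.

(* V_0 = ker (snd) and V_1 = ker (fst), inside V = V_0 x V_1. *)
Definition graded_part (eps : bool) : {vspace (V0 * V1)%type} :=
  if eps then lker (linfun (fst : V0 * V1 -> V0))
  else lker (linfun (snd : V0 * V1 -> V1)).

End OddPart.

(* A marked Young diagram is the list, up to permutation, of its lines; as the
   labels alternate, a line is determined by its length and its first label
   (true for 1).  X maps each box to its left neighbour, so that the first box
   of a line lies in ker X. *)
Definition marked_diagram := seq (nat * bool).

Definition num_lines (D : marked_diagram) (eps : bool) (k : nat) : nat :=
  count [pred l | (l.2 == eps) && (k <= l.1)%N] D.

Definition has_diagram (K : fieldType) (V0 V1 : vectType K)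
    (phi : bilform K V0) (psi : bilform K V1) (u : 'Hom(V0, V1))
    (D : marked_diagram) : Prop :=
  forall (k : nat) (eps : bool), (1 <= k)%N ->
    num_lines D eps k =
    \dim (lker (odd_elt phi psi u)
          :&: limg (odd_elt_exp phi psi u k.-1)
          :&: graded_part eps).

Definition diagram_O1 (n : nat) : marked_diagram :=
  [:: (4 * n - 1, true); (1, false); (1, false)]%N.

(* Complete isotropic flags (E_i)_{1 <= i <= n}; the index 0 gives E_0 = 0. *)
Record isotropic_flag (K : fieldType) (W : vectType K) (b : bilform K W)
    (n : nat) := IsotropicFlag {
  flag_space :> 'I_n.+1 -> {vspace W};
  flag_dim : forall i, \dim (flag_space i) = i;
  flag_incl : forall i j : 'I_n.+1,
    (i <= j)%N -> (flag_space i <= flag_space j)%VS;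
  flag_isotropic : forall i,
    {in flag_space i &, forall x y, b x y = 0} }.

Definition adapted_basis (K : fieldType) (W : vectType K) (b : bilform K W)
    (n : nat) (E : isotropic_flag b n) (e : {ffun 'I_n -> W}) : Prop :=
  forall i : 'I_n.+1, E i = (\sum_(j < n | (j < i)%N) <[e j]>)%VS.

Section ZariskiTopology.
Variables (K : fieldType) (W : vectType K).

Definition coordinates (w : W) (i : 'I_(\dim {:W})) : K :=
  coord (vbasis {:W}) i w.

Definition zariski_open (O : set W) : Prop :=
  exists S : set (mpoly (\dim {:W}) K),
    O = [set w | exists2 p, S p & meval (coordinates w) p != 0].

Lemma zariski_openT : zariski_open setT.
Proof.
exists [set 1]; apply/seteqP; split=> // w _.
by exists 1 => //=; rewrite rmorph1 oner_neq0.
Qed.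

Lemma zariski_openI : setI_closed zariski_open.
Proof.
move=> _ _ [S ->] [S' ->].
exists [set p | exists q q', [/\ S q, S' q' & p = q * q']].
apply/seteqP; split=> w /=.
- move=> [[p Sp pw] [q Sq qw]]; exists (p * q); first by exists p, q.
  by rewrite rmorphM /= mulf_neq0.
- move=> [p [q [q' [Sq Sq' ->]]]]; rewrite rmorphM /= mulf_eq0 negb_or.
  by move=> /andP[qw qw']; split; [exists q|exists q'].
Qed.

Lemma zariski_open_bigcup (I : Type) (O : I -> set W) :
  (forall i, zariski_open (O i)) -> zariski_open (\bigcup_i O i).
Proof.
move=> /choice[S OE]; exists (\bigcup_i S i).
apply/seteqP; split=> w /=.
- by move=> [i _]; rewrite OE /= => -[p Sp pw]; exists p => //; exists i.
- by move=> [p [i _ Sp] pw]; exists i => //; rewrite OE /=; exists p.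
Qed.

End ZariskiTopology.

Section SpringerResolution.
Context {K : fieldType} {V0 V1 : vectType K}.
Variables (phi : bilform K V0) (psi : bilform K V1) (n : nat).

Definition springer_ambient : Type :=
  ('Hom(V0, V1) * isotropic_flag phi n * isotropic_flag psi n)%type.

(* The Zariski topology of Hom(V_0, V_1) x G_0/B_0 x G_1/B_1.  Sending a tuple
   of vectors to the flag it spans makes the variety of bases of maximal
   isotropic subspaces a principal bundle (under upper triangular matrices)
   over the flag variety; hence a set is open iff its inverse image is open in
   the quasi-affine variety of triples (u, e, f) with e, f such bases. *)
Definition springer_open (U : set springer_ambient) : Prop :=
  exists2 O : set ('Hom(V0, V1) * {ffun 'I_n -> V0} * {ffun 'I_n -> V1})%type,
    zariski_open O &
    forall u E F e f, adapted_basis E e -> adapted_basis F f ->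
      U (u, E, F) <-> O (u, e, f).

Fact springer_openT : springer_open setT.
Proof. by exists setT => //; exact: zariski_openT. Qed.

Fact springer_openI : setI_closed springer_open.
Proof.
move=> U U' [O Oop UO] [O' Oop' UO']; exists (O `&` O').
  exact: zariski_openI.
move=> u E F e f Ee Ff; rewrite /setI /=.
by have := UO u _ _ _ _ Ee Ff; have := UO' u _ _ _ _ Ee Ff; tauto.
Qed.

Fact springer_open_bigcup (I : Type) (U : I -> set springer_ambient) :
  (forall i, springer_open (U i)) -> springer_open (\bigcup_i U i).
Proof.
move=> Uop.
have /choice[O UO] : forall i,
    exists O : set ('Hom(V0, V1) * {ffun 'I_n -> V0} * {ffun 'I_n -> V1})%type,
    zariski_open O /\ forall u E F e f,
      adapted_basis E e -> adapted_basis F f ->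
      U i (u, E, F) <-> O (u, e, f).
  by move=> i; have [O] := Uop i; exists O.
exists (\bigcup_i O i).
  by apply: zariski_open_bigcup => i; case: (UO i).
move=> u E F e f Ee Ff; split=> -[i _ Hi]; exists i => //.
- by have [_ /(_ u E F e f Ee Ff) [+ _]] := UO i; apply.
- by have [_ /(_ u E F e f Ee Ff) [_ +]] := UO i; apply.
Qed.

HB.instance Definition _ := gen_eqMixin springer_ambient.
HB.instance Definition _ := gen_choiceMixin springer_ambient.
HB.instance Definition _ := isOpenTopological.Build springer_ambient
  springer_openT springer_openI springer_open_bigcup.

Definition springer_variety : set springer_ambient :=
  [set t : springer_ambient | let: (u, E, F) := t in
     (forall i j : 'I_n.+1, i = j.+1 :> nat -> (u @: E i <= F j)%VS) /\
     (forall i : 'I_n.+1, (adjoint phi psi u @: F i <= E i)%VS)].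

Definition springer_map (t : springer_ambient) : 'Hom(V0, V1) := t.1.1.

Definition springer_fiber (u : 'Hom(V0, V1)) : set springer_ambient :=
  springer_variety `&` springer_map @^-1` [set u].

End SpringerResolution.

Arguments springer_variety {K V0 V1} phi psi n _ : rename.
Arguments springer_fiber {K V0 V1} phi psi n u _ : rename.

(* Main.v *)
(* A point of the fibre over X is the flag of a list v_1, ..., v_2n of vectors
   of V, alternately even and odd, spanning an isotropic subspace and such that
   X v_i lies in the span of v_1, ..., v_{i-1}.  If G is the span of the first
   vectors, the next one is an isotropic vector of the kernel of the operator
   induced by X on G^\perp / G.

   Two completions of G are joined by a chain of rational curves, by induction
   on the number of missing vectors.  Two candidates for the next vector that
   are orthogonal are exchanged along a line; two candidates that are not are
   exchanged by a curve of isometries commuting with X modulo G (transvections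
   in the odd case, products of two reflections in the even case).  The only
   obstruction is an even step at which the kernel is a non-degenerate plane,
   which has just two isotropic lines.  When it shows up after an odd step, it
   is avoided by moving that odd step too, possibly along a conic.

   Hence the fibre is connected unless ker u is a non-degenerate plane; then E_1
   takes two values, which cut the fibre into two clopen pieces.  Finally, if
   ker u is a non-degenerate plane, a cyclic vector y of N = u u^* can be chosen
   with psi(y, N^j y) = 0 for all j except j = 2n - 1, which gives a normal form
   for u: such u form the single orbit O_1. *)

Require Import Defs.
From HB Require Import structures.
From mathcomp Require Import all_boot all_order all_algebra.
From mathcomp Require Import -(notations) mpoly.
From mathcomp Require Import complex.
From mathcomp Require Import all_classical all_reals topology.
From mathcomp Require Import ring zify.

Set Implicit Arguments.
Unset Strict Implicit.
Unset Printing Implicit Defensive.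

Import GRing.Theory Num.Theory.

Local Open Scope classical_set_scope.
Local Open Scope ring_scope.

(** The list is ordered even, odd, even, odd, ... because u(E_i) in F_(i-1) and u^*(F_i) in E_i then
    say exactly that X maps each vector into the span of the earlier ones. Chains of curves settle
    connectedness because the field is infinite: two non-empty open subsets of a rational curve
    meet, even after finitely many parameters are removed, so a clopen part of the fibre contains
    all of a curve or nothing of it. The relation [conn] records the chains and keeps the linear
    algebra apart from the topology.

    The shape of the induction comes from a count: in G^\perp / G the kernel of the induced operator
    is one dimension larger in the parity of the next vector than in the other. An odd step has no
    obstruction of its own, odd vectors being isotropic, but the even step after it may meet a
    non-degenerate plane. Hence an odd step, unless it is the last, is treated together with the
    even step that follows, with induction hypotheses one step further (when no such plane occurs)
    and two steps further. The very first step is even, with no odd step before it to move, and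
    there the obstruction survives. *)

(** * Subspaces, orthogonals and non-degenerate forms *)

Section LinearAlgebra.
Context {K : fieldType}.
Implicit Types V W : vectType K.

Lemma exists_notin V (A B : {vspace V}) :
  (\dim B < \dim A)%N -> exists2 v, v \in A & v \notin B.
Proof.
move=> lt_BA; apply/subvPn; apply/negP => /dimvS.
by rewrite leqNgt lt_BA.
Qed.

Lemma dim_add_line V (A : {vspace V}) v :
  v \notin A -> \dim (A + <[v]>) = (\dim A).+1.
Proof.
move=> vA; rewrite dimv_disjoint_sum.
  rewrite dim_vline; have -> : v != 0; last by rewrite addn1.
  by apply: contraNneq vA => ->; rewrite mem0v.
apply/eqP; rewrite -subv0; apply/subvP => w; rewrite memv_cap => /andP[wA].
case/vlineP => c wE; rewrite memv0 wE; have [->|c0] := eqVneq c 0.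
  by rewrite scale0r.
case/negP: vA; rewrite -[v](scalerK c0) -wE; exact: memvZ.
Qed.

Lemma mem_add_line V (A : {vspace V}) v : v \in (A + <[v]>)%VS.
Proof. by rewrite (subvP (addvSr A _)) // memv_line. Qed.

Lemma memv_add_lineP V (A : {vspace V}) v w :
  reflect (exists c, v - c *: w \in A) (v \in (A + <[w]>)%VS).
Proof.
apply: (iffP idP) => [/memv_addP[a aA [_ /vlineP[c ->] ->]]|[c vA]].
  by exists c; rewrite addrK.
by rewrite -[v](subrK (c *: w)) memv_add // memvZ // memv_line.
Qed.

Lemma dim_add_line_le V (A : {vspace V}) v :
  (\dim (A + <[v]>) <= (\dim A).+1)%N.
Proof.
rewrite (leq_trans (dimv_add_leqif _ _)) // dim_vline.
by case: (v != 0); lia.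
Qed.

(** With [p] a projection of kernel [B], this is rank-nullity for [p \o f] on [A] and for [p] on
    f(A) + B: the two images coincide. *)
Lemma dim_preimage V W (f : 'Hom(V, W)) (A : {vspace V}) (B : {vspace W}) :
  (\dim (A :&: f @^-1: B) + \dim (f @: A + B) = \dim A + \dim B)%N.
Proof.
pose p : 'End(W) := (\1 - projv B)%VF.
have kerp : lker p = B.
  apply/vspaceP => w; rewrite memv_ker /p add_lfunE opp_lfunE id_lfunE subr_eq0.
  apply/eqP/idP => [->|wB]; first exact: memv_proj.
  by rewrite projv_id.
have h1 := limg_ker_dim (p \o f)%VF A.
have h2 := limg_ker_dim p (f @: A + B)%VS.
have e1 : lker (p \o f)%VF = (f @^-1: B)%VS.
  by apply/vspaceP => v; rewrite memv_ker comp_lfunE -memv_preim -kerp memv_ker.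
have e2 : (p @: (f @: A + B) = (p \o f) @: A)%VS.
  have /eqP pB0 : (p @: B == 0)%VS by rewrite -lkerE kerp.
  by rewrite limgD limg_comp pB0 addv0.
have e3 : ((f @: A + B) :&: lker p = B)%VS.
  by rewrite kerp; apply/capv_idPr; exact: addvSr.
move: h1 h2; rewrite e1 e2 e3 => <- <-; lia.
Qed.

Lemma formDl V (b : bilform K V) u v w : b (u + v) w = b u w + b v w.
Proof. by rewrite linearD add_lfunE. Qed.

Lemma formDr V (b : bilform K V) u v w : b w (u + v) = b w u + b w v.
Proof. exact: linearD. Qed.

Lemma formNl V (b : bilform K V) u w : b (- u) w = - b u w.
Proof. by rewrite linearN opp_lfunE. Qed.

Lemma formNr V (b : bilform K V) u w : b w (- u) = - b w u.
Proof. exact: linearN. Qed.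

Lemma formZl V (b : bilform K V) a u w : b (a *: u) w = a * b u w.
Proof. by rewrite linearZ scale_lfunE. Qed.

Lemma formZr V (b : bilform K V) a u w : b w (a *: u) = a * b w u.
Proof. exact: linearZ. Qed.

Lemma form0l V (b : bilform K V) w : b 0 w = 0.
Proof. by rewrite linear0 lfunE. Qed.

Lemma form0r V (b : bilform K V) w : b w 0 = 0.
Proof. exact: linear0. Qed.

Definition formE := (formDl, formDr, formNl, formNr, formZl, formZr).

Lemma nondegenerateP V (b : bilform K V) x :
  nondegenerate_bilform b -> (forall y, b x y = 0) -> x = 0.
Proof.
move=> bnd h; suff : x \in lker b by rewrite bnd memv0 => /eqP.
by rewrite memv_ker; apply/eqP/lfunP => y; rewrite h lfunE.
Qed.

Lemma alternating_skew V (b : bilform K V) :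
  alternating_bilform b -> forall x y, b y x = - b x y.
Proof.
move=> alt x y; have := alt (x + y); rewrite !formE !alt add0r addr0 => /eqP.
by rewrite addr_eq0 => /eqP.
Qed.

Definition rank1_fun V (b : bilform K V) (u a w : V) : V := b w u *: a.

Fact rank1_fun_is_linear V (b : bilform K V) u a : linear (rank1_fun b u a).
Proof. by move=> k v w; rewrite /rank1_fun !formE scalerDl scalerA. Qed.

HB.instance Definition _ V (b : bilform K V) u a :=
  GRing.isLinear.Build K V V _ (rank1_fun b u a) (rank1_fun_is_linear b u a).

Definition rank1 V (b : bilform K V) (u a : V) : 'End(V) :=
  linfun (rank1_fun b u a).

Lemma rank1E V (b : bilform K V) u a w : rank1 b u a w = b w u *: a.
Proof. by rewrite lfunE. Qed.

(** Encoded as the kernel of V -> V^\vee -> A^\vee, so that rank-nullity computes its dimension. *)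
Definition perp V (b : bilform K V) (A : {vspace V}) : {vspace V} :=
  lker (transpose (linfun (vsval : subvs_of A -> V)) \o b)%VF.

Lemma perpP V (b : bilform K V) (A : {vspace V}) v :
  reflect {in A, forall a, b v a = 0} (v \in perp b A).
Proof.
rewrite memv_ker; apply: (iffP eqP) => [h a aA|h].
  have /lfunP/(_ (Subvs aA)) := h.
  by rewrite comp_lfunE /transpose lfunE /= /precomp comp_lfunE !lfunE.
apply/lfunP => a; rewrite comp_lfunE /transpose lfunE /= /precomp comp_lfunE.
by rewrite !lfunE /= h ?subvsP.
Qed.

Lemma dim_perp V (b : bilform K V) (A : {vspace V}) :
  nondegenerate_bilform b -> (\dim (perp b A) + \dim A = \dim {:V})%N.
Proof.
move=> bnd.
set i : 'Hom(subvs_of A, V) := linfun vsval.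
have bfull : limg b = fullv.
  apply/eqP; rewrite eqEdim subvf /= limg_dim_eq ?bnd ?capv0 //.
  by rewrite !dimvf /= /dim /= muln1.
(* Restriction of functionals to [A] is onto: a functional on [A] extends through a projection onto
   [A]. *)
have tfull : limg (transpose i \o b) = fullv.
  rewrite limg_comp bfull; apply/eqP; rewrite eqEsubv subvf /=.
  apply/subvP => g _; apply/memv_imgP.
  exists (g \o linfun (vsproj A))%VF; first exact: memvf.
  rewrite /transpose lfunE /= /precomp; apply/lfunP => a.
  by rewrite !comp_lfunE !lfunE /= vsvalK.
have := limg_ker_dim (transpose i \o b)%VF fullv.
rewrite capfv tfull => <-; congr addn.
by rewrite !dimvf /= /dim /= muln1.
Qed.

End LinearAlgebra.

(** * Stable isotropic subspaces *)

(** The data (V, B, X) in a single space, with the parity as a boolean, so that most statements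
    about even and odd vectors are proved once for both. *)
Record odd_nilpotent (K : fieldType) (V : vectType K) (n : nat) :=
  OddNilpotent {
  part : bool -> {vspace V};
  form : bilform K V;
  op : 'End(V);
  part_cap : (part false :&: part true = 0)%VS;
  part_sum : (part false + part true = fullv)%VS;
  dim_part : forall e, \dim (part e) = (2 * n + ~~ e)%N;
  form_nondeg : nondegenerate_bilform form;
  form_cross : forall e v w,
    v \in part e -> w \in part (~~ e) -> form v w = 0;
  form_sign : forall e v w,
    v \in part e -> w \in part e -> form w v = (-1) ^+ e * form v w;
  form_alt : forall v, v \in part true -> form v v = 0;
  op_part : forall e v, v \in part e -> op v \in part (~~ e);
  op_adj : forall e v w, v \in part e -> w \in part (~~ e) ->
    form (op v) w = (-1) ^+ (~~ e) * form v (op w);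
  op_nil : forall v, exists k, iter k op v = 0 }.

Section IsotropicStates.
Context {K : fieldType} {V : vectType K} {n : nat}.
Variable D : odd_nilpotent V n.
Local Notation P := (part D).
Local Notation b := (form D).
Local Notation X := (op D).
Implicit Types (e : bool) (v w x y : V) (A B : {vspace V}).
Implicit Type G : bool -> {vspace V}.

Lemma form0C e v w : v \in P e -> w \in P e -> (b w v == 0) = (b v w == 0).
Proof.
by move=> vP wP; rewrite (form_sign vP wP) mulf_eq0 signr_eq0.
Qed.

Lemma op_adj0 e v w :
  v \in P e -> w \in P (~~ e) -> (b (X v) w == 0) = (b v (X w) == 0).
Proof.
by move=> vP wP; rewrite (op_adj vP wP) mulf_eq0 signr_eq0.
Qed.

Lemma dim_full : (\dim (P false) + \dim (P true) = \dim {:V})%N.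
Proof.
by rewrite -(part_sum D) dimv_disjoint_sum // part_cap.
Qed.

Lemma dim_partC e : (\dim (P e) + \dim (P (~~ e)) = \dim {:V})%N.
Proof. by case: e; rewrite -dim_full // addnC. Qed.

Lemma perp_part e : perp b (P (~~ e)) = P e.
Proof.
apply/esym/eqP; rewrite eqEdim; apply/andP; split.
  apply/subvP => v vP; apply/perpP => a; exact: form_cross.
have := dim_perp (P (~~ e)) (form_nondeg D); have := dim_partC e; lia.
Qed.

Lemma perp_add A B : perp b (A + B)%VS = (perp b A :&: perp b B)%VS.
Proof.
apply/vspaceP => v; rewrite memv_cap.
apply/perpP/andP => [h|[/perpP hA /perpP hB]].
  split; apply/perpP => a aA; apply: h.
    by rewrite (subvP (addvSl _ _)).
  by rewrite (subvP (addvSr _ _)).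
by move=> _ /memv_addP[a aA [c cB ->]]; rewrite linearD /= hA // hB // addr0.
Qed.

Definition pp e A : {vspace V} := (P e :&: perp b A)%VS.

Lemma pp_perp e A : pp e A = perp b (A + P (~~ e)).
Proof. by rewrite perp_add perp_part capvC. Qed.

Lemma dim_pp e A :
  (A <= P e)%VS -> (\dim (pp e A) + \dim A = \dim (P e))%N.
Proof.
move=> AP; have := dim_perp (A + P (~~ e))%VS (form_nondeg D).
rewrite -pp_perp dimv_disjoint_sum; first by have := dim_partC e; lia.
have PP0 : (P e :&: P (~~ e) = 0)%VS.
  by case: e {AP}; rewrite ?part_cap // capvC part_cap.
by apply/eqP; rewrite -subv0 -PP0 capvS.
Qed.

Lemma ppK e A : (A <= P e)%VS -> pp e (pp e A) = A.
Proof.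
move=> AP; apply/esym/eqP; rewrite eqEdim; apply/andP; split.
  apply/subvP => v vA; rewrite memv_cap (subvP AP) //=; apply/perpP => w.
  rewrite memv_cap => /andP[wP /perpP/(_ v vA)/eqP wv]; apply/eqP.
  by rewrite (form0C wP) // (subvP AP).
have := dim_pp AP; have := @dim_pp e (pp e A) (capvSl _ _); lia.
Qed.

(* A state records the span [G e] of the vectors of parity [e] among the first
   vectors of an adapted basis of a flag; [invariant] says that
   [G false + G true] is an isotropic subspace stable under the operator. *)
Definition invariant G := forall e,
  [/\ (G e <= P e)%VS, (G e <= perp b (G e))%VS & (X @: G e <= G (~~ e))%VS].

(* The part of parity [e] of the kernel of the operator induced on
   [G^\perp / G], pulled back to [G^\perp]. *)
Definition kk G e : {vspace V} := (pp e (G e) :&: X @^-1: G (~~ e))%VS.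

(** The admissible next vectors of parity [e]. For odd [v] the isotropy holds automatically. *)
Definition ok G e v := [/\ v \in kk G e, v \notin G e & b v v = 0].

Definition upd G e v : bool -> {vspace V} :=
  fun d => if d == e then (G e + <[v]>)%VS else G d.

(** The length is left free, so that partial lists are covered too; [state] keeps track of it. *)
Fixpoint ext G e (r : seq V) : Prop :=
  if r is v :: r' then ok G e v /\ ext (upd G e v) (~~ e) r' else True.

(* [m] vectors, the first one of parity [e], remain to be chosen. *)
Definition state G e m := [/\ invariant G,
  (\dim (G false) + \dim (G true) + m = 2 * n)%N
  & \dim (G false) = (\dim (G true) + e)%N].

Lemma kkP G e v : reflect
  [/\ v \in P e, v \in perp b (G e) & X v \in G (~~ e)] (v \in kk G e).
Proof.
rewrite !memv_cap -memv_preim.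
by apply: (iffP andP) => [[/andP[]]|[-> -> ->]].
Qed.

Lemma kk_part G e : (kk G e <= P e)%VS.
Proof. by rewrite /kk /pp -capvA capvSl. Qed.

Lemma updE G e v : upd G e v e = (G e + <[v]>)%VS.
Proof. by rewrite /upd eqxx. Qed.

Lemma updC G e v : upd G e v (~~ e) = G (~~ e).
Proof. by rewrite /upd; case: e. Qed.

Lemma upd_sub G e v d : (G d <= upd G e v d)%VS.
Proof. by rewrite /upd; case: eqP => [->|_]; rewrite ?addvSl. Qed.

Lemma isotropic_add e A v : (A <= P e)%VS -> (A <= perp b A)%VS ->
  v \in pp e A -> b v v = 0 -> (A + <[v]> <= perp b (A + <[v]>))%VS.
Proof.
move=> AP /subvP Ap; rewrite memv_cap => /andP[vP /perpP vA] vv.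
apply/subvP => _ /memv_addP[a aA [_ /vlineP[c ->] ->]].
apply/perpP => _ /memv_addP[a' a'A [_ /vlineP[c' ->] ->]].
have /perpP/(_ _ a'A) aa' := Ap _ aA.
have /eqP va : b a v == 0 by rewrite (form0C vP) ?vA ?(subvP AP).
by rewrite !formE aa' va vA // vv !mulr0 !addr0.
Qed.

Lemma isotropic_dim e A : (A <= P e)%VS -> (A <= perp b A)%VS ->
  (2 * \dim A <= \dim (P e))%N.
Proof.
move=> AP Ap; have := dim_pp AP.
have /dimvS : (A <= pp e A)%VS by rewrite subv_cap AP.
lia.
Qed.

Lemma invariant_upd G e v : invariant G -> ok G e v -> invariant (upd G e v).
Proof.
move=> invG [/kkP[vP /perpP vG Xv] _ vv] d.
have [d_e|d_ne] := eqVneq d e; last first.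
  have -> : d = ~~ e by move: d e d_ne {vP vG Xv} => [] [].
  have [GP Gp GX] := invG (~~ e); rewrite updC; split=> //.
  by rewrite negbK; apply: subv_trans (upd_sub _ _ _ _); rewrite -{2}[e]negbK.
have [GP /subvP Gp GX] := invG e; rewrite d_e updE updC; split.
- by rewrite subv_add GP -memvE.
- apply: (isotropic_add GP) => //; [exact/subvP|rewrite memv_cap vP].
  exact/perpP.
- by rewrite limgD limg_line subv_add GX -memvE.
Qed.

Lemma state_upd G e m v :
  state G e m.+1 -> ok G e v -> state (upd G e v) (~~ e) m.
Proof.
move=> [invG dG dGe] okv; split; first exact: invariant_upd.
  have [_ vG _] := okv; have := dim_add_line vG.
  by case: e okv vG dGe => _ _ _ dv; rewrite /upd /= dv; lia.
have [_ vG _] := okv; have := dim_add_line vG.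
by case: e okv vG dGe => _ _ dGe dv; rewrite /upd /= dv; lia.
Qed.

Lemma kk_sub G e : invariant G -> (G e <= kk G e)%VS.
Proof.
move=> invG; have [GP /subvP Gp GX] := invG e.
apply/subvP => v vG; apply/kkP; split; first exact: subvP vG.
- exact: Gp.
- by apply: (subvP GX); apply: memv_img.
Qed.

Lemma op_pp G e w :
  invariant G -> w \in pp e (G e) -> X w \in pp (~~ e) (G (~~ e)).
Proof.
move=> invG; rewrite !memv_cap => /andP[wP /perpP wG].
rewrite op_part //=; apply/perpP => a aG; apply/eqP.
have [GP _ GX] := invG (~~ e); rewrite (op_adj0 wP) ?(subvP GP) // wG //.
by rewrite -[e]negbK (subvP GX) // memv_img.
Qed.

(** The operator is its own adjoint up to sign, so the kernel it induces is the orthogonal of the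
    image it induces. *)
Lemma kk_pp G e :
  invariant G -> kk G (~~ e) = pp (~~ e) (X @: pp e (G e) + G (~~ e)).
Proof.
move=> invG; apply/vspaceP => v.
have [GP _ _] := invG e.
apply/kkP/idP => [[vP vG Xv]|].
  rewrite memv_cap vP perp_add memv_cap vG andbT; apply/perpP.
  move=> _ /memv_imgP[w + ->]; rewrite memv_cap => /andP[wP /perpP wG].
  move: Xv (op_part vP); rewrite negbK => Xv XvP; apply/eqP.
  by rewrite -(op_adj0 vP) ?negbK // (form0C wP XvP) wG.
rewrite memv_cap perp_add memv_cap => /andP[vP /andP[/perpP vX vG]].
split=> //; rewrite negbK -(ppK GP) memv_cap -{1}[e]negbK op_part //=.
apply/perpP => w w_pp; have [wP _] := memv_capP w_pp.
by apply/eqP; rewrite (op_adj0 vP) ?negbK // vX // memv_img.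
Qed.

(** By [kk_pp], the kernels of the two parities differ in dimension by as much as the two parts of
    G^\perp / G. In a [state] this makes the kernel of the parity of the next vector larger by one,
    modulo G. *)
Lemma dim_kk G e : invariant G ->
  (\dim (kk G e) + \dim (G e) + \dim (P (~~ e)) =
   \dim (kk G (~~ e)) + \dim (G (~~ e)) + \dim (P e))%N.
Proof.
move=> invG; have [GP _ _] := invG e; have [GP' _ _] := invG (~~ e).
have := dim_preimage X (pp e (G e)) (G (~~ e)); rewrite -/(kk G e).
have UP : (X @: pp e (G e) + G (~~ e) <= P (~~ e))%VS.
  rewrite subv_add GP' andbT; apply/subvP => _ /memv_imgP[w w_pp ->].
  by apply: op_part; move: w_pp; rewrite memv_cap => /andP[].
have := dim_pp UP; rewrite -kk_pp //; have := dim_pp GP; lia.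
Qed.

Lemma op_perp_kk G e w v :
  w \in pp (~~ e) (G (~~ e)) -> v \in kk G e -> b (X w) v = 0.
Proof.
rewrite memv_cap => /andP[wP /perpP wG] /kkP[vP _ Xv].
by apply/eqP; rewrite (op_adj0 wP) ?negbK // wG.
Qed.

(** By nilpotency w, X w, X^2 w, ... ends up in G. The last vector outside G lies in the induced
    kernel, and it is either w itself or an image. *)
Lemma kk_or_image G e w : invariant G ->
    w \in pp e (G e) -> w \notin G e ->
  (w \in kk G e) \/ exists d w', [/\ w' \in pp (~~ d) (G (~~ d)),
                                    X w' \in kk G d & X w' \notin G d].
Proof.
move=> invG; have [k] := op_nil D w.
elim: k e w => [|k IH] e w; first by move=> /= -> _; rewrite mem0v.
rewrite iterSr => wk w_pp wG; have [XwG|XwG] := boolP (X w \in G (~~ e)).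
  by left; rewrite memv_cap w_pp -memv_preim.
have Xw_pp := op_pp invG w_pp.
case: (IH _ _ wk Xw_pp XwG) => [Xw_kk|]; last by right.
by right; exists (~~ e), w; split=> //; rewrite negbK.
Qed.

End IsotropicStates.

(** * Existence of completions *)

Section AdaptedBases.
Context {K : numClosedFieldType} {V : vectType K} {n : nat}.
Variable D : odd_nilpotent V n.
Local Notation P := (part D).
Local Notation b := (form D).
Local Notation X := (op D).
Implicit Types (e : bool) (u v w x y z : V) (A B : {vspace V}) (r : seq V).
Implicit Type G : bool -> {vspace V}.

Lemma formC0 v w : v \in P false -> w \in P false -> b w v = b v w.
Proof. by move=> vP wP; rewrite (form_sign vP wP) mul1r. Qed.

Lemma formC1 v w : v \in P true -> w \in P true -> b w v = - b v w.
Proof. by move=> vP wP; rewrite (form_sign vP wP) mulN1r. Qed.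

Lemma isotropic_in_plane v w : v \in P false -> w \in P false ->
  b w w = 0 \/ exists s, b (v + s *: w) (v + s *: w) = 0.
Proof.
move=> vP wP; have [|ww] := eqVneq (b w w) 0; first by left.
(* A root of the quadratic polynomial b (v + s w) (v + s w) in [s], from a square root of its
   reduced discriminant. *)
right; pose s := (sqrtC (b v w ^+ 2 - b v v * b w w) - b v w) / b w w.
exists s; rewrite !formE (formC0 vP wP); apply: (mulIf ww); rewrite mul0r.
have sw : s * b w w = sqrtC (b v w ^+ 2 - b v v * b w w) - b v w.
  by rewrite mulfVK.
have -> : (b v v + s * b v w + (s * b v w + s * (s * b w w))) * b w w =
  (s * b w w + b v w) ^+ 2 - (b v w ^+ 2 - b v v * b w w) by ring.
by rewrite sw subrK sqrtCK subrr.
Qed.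

Lemma add_line_eq A v w :
  w \in (A + <[v]>)%VS -> w \notin A -> (A + <[w]> = A + <[v]>)%VS.
Proof.
case/memv_addP => a aA [_ /vlineP[c ->] ->] wA; apply/eqP.
rewrite eqEdim subv_add addvSl -memvE memv_add ?memvZ ?memv_line //=.
by rewrite (dim_add_line wA) dim_add_line_le.
Qed.

(** An odd candidate exists by the count of [dim_kk]. In the even case, a non-zero odd kernel makes
    the even one at least a plane, which contains an isotropic line; otherwise [kk_or_image] yields
    an even kernel vector that is an image, and image and kernel are orthogonal. *)
Lemma exists_ok G e m : state D G e m.+1 -> exists v, ok D G e v.
Proof.
move=> [invG dG dGe]; have dK := dim_kk true invG.
rewrite /= !dim_part /= in dK.
have dK0 := dimvS (kk_sub false invG); have dK1 := dimvS (kk_sub true invG).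
case: e dG dGe => dG dGe.
  have [|v vK vG] := @exists_notin _ _ (kk D G true) (G true); first lia.
  by exists v; split=> //; case/kkP: vK => vP _ _; rewrite form_alt.
have plane : (\dim (kk D G false) >= \dim (G false) + 2)%N ->
    exists v, ok D G false v.
  move=> dK2.
  have [|w wK wG] := @exists_notin _ _ (kk D G false) (G false); first lia.
  have dGw := dim_add_line wG.
  have [|v vK vG] := @exists_notin _ _ (kk D G false) (G false + <[w]>)%VS.
    lia.
  have [vP _ _] := kkP _ _ _ _ vK; have [wP _ _] := kkP _ _ _ _ wK.
  have [ww|[s ss]] := isotropic_in_plane vP wP; first by exists w.
  exists (v + s *: w); split=> //; first by rewrite memvD // memvZ.
  apply: contra vG => vG.
  by rewrite -[v](addrK (s *: w)) memv_add // memvN memvZ // memv_line.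
have [GP _ _] := invG true; have dpp := dim_pp GP; rewrite dim_part in dpp.
have [|w w_pp wG] := @exists_notin _ _ (pp D true (G true)) (G true).
  by move: dpp => /=; lia.
have odd_case v : v \in kk D G true -> v \notin G true ->
    exists v, ok D G false v.
  move=> vK vG; apply: plane; have := dim_add_line vG.
  have /dimvS : (G true + <[v]> <= kk D G true)%VS.
    by rewrite subv_add kk_sub // -memvE.
  lia.
have [wK|[[] [w' [w'_pp XwK XwG]]]] := kk_or_image invG w_pp wG.
- exact: odd_case wG.
- exact: odd_case XwG.
- by exists (X w'); split=> //; exact: op_perp_kk XwK.
Qed.

Lemma exists_ext G e m : state D G e m -> exists2 r, ext D G e r & size r = m.
Proof.
elim: m G e => [|m IH] G e stG; first by exists [::].
have [v okv] := exists_ok stG; have [r rG <-] := IH _ _ (state_upd stG okv).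
by exists (v :: r).
Qed.

Lemma ok_part G e v : ok D G e v -> v \in P e.
Proof. by case=> /kkP[]. Qed.

Lemma upd_eq G e v w :
  (G e + <[v]> = G e + <[w]>)%VS -> upd G e v = upd G e w.
Proof. by move=> vw; apply: funext => d; rewrite /upd vw. Qed.

Lemma span2 A x y (a c a' c' : K) : a * c' - c * a' != 0 ->
  (A + <[a *: x + c *: y]> + <[a' *: x + c' *: y]> = A + <[x]> + <[y]>)%VS.
Proof.
move=> det; apply/eqP; rewrite -!addvA eqEsubv.
have sub u v (a1 c1 a2 c2 : K) :
    (A + (<[a1 *: u + c1 *: v]> + <[a2 *: u + c2 *: v]>) <=
     A + (<[u]> + <[v]>))%VS.
  rewrite addvS // subv_add -!memvE.
  by rewrite !memv_add // memvZ // memv_line.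
rewrite sub /=; set u := a *: x + _; set v := a' *: x + _.
have xE : x = (c' / (a * c' - c * a')) *: u - (c / (a * c' - c * a')) *: v.
  rewrite /u /v !scalerDr !scalerA opprD addrACA -!scalerBl.
  rewrite [X in X *: x](_ : _ = 1) ?[X in X *: y](_ : _ = 0); try by field.
  by rewrite scale1r scale0r addr0.
have yE : y = (a / (a * c' - c * a')) *: v - (a' / (a * c' - c * a')) *: u.
  rewrite /u /v !scalerDr !scalerA opprD addrACA -!scalerBl.
  rewrite [X in X *: y](_ : _ = 1) ?[X in X *: x](_ : _ = 0); try by field.
  by rewrite scale1r scale0r add0r.
rewrite {1}xE {1}yE -!scaleNr [(a / _) *: v + _]addrC; exact: sub.
Qed.

Lemma dim_span2 A x y : x \notin A -> y \notin (A + <[x]>)%VS ->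
  \dim (A + <[x]> + <[y]>) = (\dim A).+2.
Proof. by move=> xA yA; rewrite !dim_add_line. Qed.

Lemma span2_free A x y : (\dim A).+2 = \dim (A + <[x]> + <[y]>) ->
  x \notin A /\ y \notin (A + <[x]>)%VS.
Proof.
move=> dA; split; apply/negP => h.
  have /dimvS : (A + <[x]> + <[y]> <= A + <[y]>)%VS.
    by rewrite !subv_add addvSl addvSr -memvE (subvP (addvSl _ _)).
  by have := dim_add_line_le A y; rewrite -dA; lia.
have /dimvS : (A + <[x]> + <[y]> <= A + <[x]>)%VS.
  by rewrite subv_add subvv -memvE.
by have := dim_add_line_le A x; rewrite -dA; lia.
Qed.

End AdaptedBases.

(** * Rational curves *)

Section Curves.
Context {K : fieldType}.
Implicit Types V W : vectType K.

(** Polynomiality is tested on linear functionals: no basis is chosen, and linear maps preserve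
    it. *)
Definition polyfun V (f : K -> V) : Prop :=
  forall l : 'Hom(V, K^o), exists p : {poly K}, forall t, l (f t) = p.[t].

Lemma eq_polyfun V (f g : K -> V) : f =1 g -> polyfun f -> polyfun g.
Proof. by move=> fg hf l; have [p pE] := hf l; exists p => t; rewrite -fg. Qed.

Lemma polyfun_const V (v : V) : polyfun (fun=> v).
Proof. by move=> l; exists (l v)%:P => t; rewrite hornerC. Qed.

Lemma polyfunD V (f g : K -> V) :
  polyfun f -> polyfun g -> polyfun (fun t => f t + g t).
Proof.
move=> hf hg l; have [p pE] := hf l; have [q qE] := hg l.
by exists (p + q) => t; rewrite linearD /= pE qE hornerD.
Qed.

Lemma polyfunZ V (p : {poly K}) (f : K -> V) :
  polyfun f -> polyfun (fun t => p.[t] *: f t).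
Proof.
move=> hf l; have [q qE] := hf l.
by exists (p * q) => t; rewrite linearZ /= qE hornerM.
Qed.

Lemma polyfun_line V (v w : V) : polyfun (fun t => (1 - t) *: v + t *: w).
Proof.
apply: (@eq_polyfun _ (fun t => (1 - 'X).[t] *: v + ('X).[t] *: w)).
  by move=> t; rewrite !(hornerD, hornerN, hornerX, hornerC).
by apply: polyfunD; apply/polyfunZ/polyfun_const.
Qed.

Lemma polyfun_conic V (v w z : V) : polyfun (fun t =>
  (1 - t) ^+ 2 *: v + (t * (1 - t)) *: w + t ^+ 2 *: z).
Proof.
apply: (@eq_polyfun _ (fun t => ((1 - 'X) ^+ 2).[t] *: v +
    ('X * (1 - 'X)).[t] *: w + ('X ^+ 2).[t] *: z)).
  move=> t.
  by rewrite !(hornerM, horner_exp, hornerD, hornerN, hornerX, hornerC).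
by apply: polyfunD; [apply: polyfunD|]; apply/polyfunZ/polyfun_const.
Qed.

Lemma polyfun_comp V W (g : 'Hom(V, W)) (f : K -> V) :
  polyfun f -> polyfun (fun t => g (f t)).
Proof.
move=> hf l; have [p pE] := hf (l \o g)%VF.
by exists p => t; rewrite -pE comp_lfunE.
Qed.

Definition polycurve V (g : K -> seq V) : Prop :=
  (forall t, size (g t) = size (g 0)) /\
  (forall i, polyfun (fun t => nth 0 (g t) i)).

Lemma polycurve_const V (r : seq V) : polycurve (fun=> r).
Proof. by split=> // i; apply: polyfun_const. Qed.

Lemma polycurve_cons V (f : K -> V) (g : K -> seq V) :
  polyfun f -> polycurve g -> polycurve (fun t => f t :: g t).
Proof.
move=> hf [sg hg]; split=> [t|[|i]] /=; first by rewrite sg.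
- exact: hf.
- exact: hg.
Qed.

Lemma polycurve_map V (g : K -> V -> V) (r : seq V) :
  (forall v, polyfun (g^~ v)) -> polycurve (fun t => map (g t) r).
Proof.
move=> hg; elim: r => [|v r IH] /=; first exact: polycurve_const.
exact: polycurve_cons (hg v) IH.
Qed.

End Curves.

Section Connections.
Context {K : numClosedFieldType} {V : vectType K} {n : nat}.
Variable D : odd_nilpotent V n.
Local Notation P := (part D).
Local Notation b := (form D).
Local Notation X := (op D).
Implicit Types (e : bool) (u v w x y z : V) (A B : {vspace V}) (r : seq V).
Implicit Type G : bool -> {vspace V}.

(* The polynomial [d] of [conn_curve] excludes finitely many parameters, at which
   the curve may leave the set of adapted lists. *)
Inductive conn : (bool -> {vspace V}) -> bool -> seq V -> seq V -> Prop :=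
| conn_refl G e r : conn G e r r
| conn_sym G e r r' : conn G e r r' -> conn G e r' r
| conn_trans G e r r' r'' :
    conn G e r r' -> conn G e r' r'' -> conn G e r r''
| conn_cons G e v r r' : ok D G e v -> conn (upd G e v) (~~ e) r r' ->
    conn G e (v :: r) (v :: r')
| conn_flag G e v w r : ok D G e v -> ok D G e w ->
    (G e + <[v]> = G e + <[w]>)%VS -> ext D (upd G e v) (~~ e) r ->
    conn G e (v :: r) (w :: r)
| conn_curve G e (g : K -> seq V) (d : {poly K}) :
    d.[0] != 0 -> d.[1] != 0 -> polycurve g ->
    (forall t, d.[t] != 0 -> ext D G e (g t)) -> conn G e (g 0) (g 1).

Definition connected_ext G e m := forall r r', size r = m -> size r' = m ->
  ext D G e r -> ext D G e r' -> conn G e r r'.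

Lemma connected_same G e m v w r r' :
  connected_ext (upd G e v) (~~ e) m -> w \in (G e + <[v]>)%VS ->
  size r = m -> size r' = m -> ext D G e (v :: r) -> ext D G e (w :: r') ->
  conn G e (v :: r) (w :: r').
Proof.
move=> cv wv sr sr' [okv rv] [okw rw].
have vw : (G e + <[v]> = G e + <[w]>)%VS.
  by case: (okw) => _ wG _; rewrite (add_line_eq wv).
apply: (@conn_trans _ _ _ (v :: r')).
  by apply: conn_cons => //; apply: cv => //; rewrite (upd_eq vw).
by apply: conn_flag => //; rewrite (upd_eq vw).
Qed.

(** Determinant of (1 - t) v + t v0 and v - v0 with respect to v and v0. It never vanishes, so
    curves along such a line exclude no parameter. *)
Lemma det_line (t : K) : (1 - t) * -1 - t * 1 != 0.
Proof.
by have -> : (1 - t) * -1 - t * 1 = -1 by [ring]; rewrite oppr_eq0 oner_neq0.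
Qed.

Lemma upd3 G e x z y : upd (upd (upd G e x) (~~ e) z) e y =
  fun d => if d == e then (G e + <[x]> + <[y]>)%VS else (G d + <[z]>)%VS.
Proof. by apply: funext => d; rewrite /upd; case: e d => [] []. Qed.

Lemma upd2E G e x z : upd (upd G e x) (~~ e) z e = (G e + <[x]>)%VS.
Proof. by rewrite /upd; case: e. Qed.

Lemma upd4 G y x y1 x1 :
  upd (upd (upd (upd G true y) false x) true y1) false x1 =
  fun d => if d then (G true + <[y]> + <[y1]>)%VS
           else (G false + <[x]> + <[x1]>)%VS.
Proof. by apply: funext => -[]. Qed.

(** Criterion behind the curves below: since [y] and [y1] are both in the kernel at [G], the third
    step only asks that they be orthogonal, whatever the middle vector. *)
Lemma ext3 G e y x y1 r : invariant D G -> ok D G e y ->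
    x \in pp D (~~ e) (G (~~ e)) -> x \notin G (~~ e) -> b x x = 0 ->
    X x \in (G e + <[y]>)%VS ->
    y1 \in kk D G e -> y1 \notin (G e + <[y]>)%VS -> b y1 y1 = 0 ->
    b y y1 = 0 ->
    ext D (upd (upd (upd G e y) (~~ e) x) e y1) (~~ e) r ->
  ext D G e [:: y, x, y1 & r].
Proof.
move=> invG oky x_pp xG xx Xx y1K y1G y1y1 yy1 rG.
have [yK _ _] := oky; have [yP y_perp Xy] := kkP _ _ _ _ yK.
have [y1P y1_perp Xy1] := kkP _ _ _ _ y1K.
move: x_pp; rewrite memv_cap => /andP[xP x_perp].
split=> //; split; [|split]; last by rewrite negbK.
  split=> //; last by rewrite updC.
  by apply/kkP; split; rewrite ?updC // negbK updE.
rewrite negbK; split; rewrite ?upd2E //; apply/kkP; split=> //; rewrite ?upd2E.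
  rewrite perp_add memv_cap y1_perp; apply/perpP => _ /vlineP[c ->].
  by apply/eqP; rewrite formZr mulf_eq0 (form0C yP y1P) yy1 eqxx orbT.
by do 2!apply: (subvP (upd_sub _ _ _ _)).
Qed.

(* A flag whose next three steps are spanned by v, z, v0, with z and v0 mapped
   into the previous steps, lies on a line along which v moves to v0. *)
Lemma conn_swap G e v v0 z r : invariant D G ->
    ok D G e v -> ok D G e v0 -> b v v0 = 0 -> v0 \notin (G e + <[v]>)%VS ->
    ok D G (~~ e) z ->
    ext D (upd (upd (upd G e v) (~~ e) z) e (v - v0)) (~~ e) r ->
  [/\ ext D G e [:: v, z, v - v0 & r], ext D G e [:: v0, z, v - v0 & r]
    & conn G e [:: v, z, v - v0 & r] [:: v0, z, v - v0 & r]].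
Proof.
move=> invG okv okv0 vv0 v0v [zK zG zz] rG.
have [vK vG vv] := okv; have [v0K v0G v00] := okv0.
have [vP _ _] := kkP _ _ _ _ vK; have [v0P _ _] := kkP _ _ _ _ v0K.
have v0v0 : b v0 v = 0 by apply/eqP; rewrite (form0C vP v0P) vv0.
pose f (t : K) : V := (1 - t) *: v + t *: v0.
have f0 : f 0 = v by rewrite /f subr0 scale1r scale0r addr0.
have f1 : f 1 = v0 by rewrite /f subrr scale1r scale0r add0r.
(* The plane of [f t] and [v - v0] modulo [G e] does not depend on t, so the tail [r] stays
   admissible along the curve. *)
have spanE t : (G e + <[f t]> + <[v - v0]> = G e + <[v]> + <[v0]>)%VS.
  by rewrite -(span2 (G e) v v0 (det_line t)) scale1r scaleN1r.
have free t : f t \notin G e /\ v - v0 \notin (G e + <[f t]>)%VS.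
  by apply: span2_free; rewrite spanE dim_span2.
have extf t : ext D G e [:: f t, z, v - v0 & r].
  have [zP z_perp Xz] := kkP _ _ _ _ zK; have [fG vfG] := free t.
  apply: ext3 => //.
  - split=> //; first by rewrite memvD ?memvZ.
    by rewrite !formE vv v00 vv0 v0v0 !mulr0 !addr0.
  - by rewrite memv_cap zP.
  - by rewrite (subvP (addvSl _ _)) // -[e]negbK.
  - exact: memvB.
  - by rewrite !formE vv v00 vv0 v0v0 !(subr0, oppr0, addr0).
  - by rewrite !formE vv v00 vv0 v0v0 !(subr0, oppr0, addr0, mulr0).
  - by move: rG; rewrite !upd3 spanE -(spanE 0) f0.
have := extf 0; have := extf 1; rewrite f0 f1; split=> //.
pose g t := [:: f t, z, v - v0 & r].
suff : conn G e (g 0) (g 1) by rewrite /g f0 f1.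
apply: (@conn_curve _ _ _ 1); rewrite ?hornerC ?oner_neq0 //.
  by apply: polycurve_cons; [exact: polyfun_line|exact: polycurve_const].
by move=> t _; apply: extf.
Qed.

(** Counterpart of [conn_swap] for an even vector that becomes admissible only after its own image:
    the pair (X x, x) moves as a whole along the line to (X x0, x0), and the differences take the
    third and fourth places. *)
Lemma conn_pair G x x0 r : invariant D G ->
    x \in pp D false (G false) -> x0 \in pp D false (G false) ->
    b x x = 0 -> b x0 x0 = 0 -> b x x0 = 0 ->
    X x \in kk D G true -> X x0 \in kk D G true -> b (X x) (X x0) = 0 ->
    X x \notin G true -> X x0 \notin (G true + <[X x]>)%VS ->
    ext D (upd (upd (upd (upd G true (X x)) false x) true (X x - X x0))
             false (x - x0)) true r ->
  let s := [:: X x - X x0, x - x0 & r] in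
  [/\ ext D G true [:: X x, x & s], ext D G true [:: X x0, x0 & s]
    & conn G true [:: X x, x & s] [:: X x0, x0 & s]].
Proof.
move=> invG x_pp x0_pp xx x00 xx0 XxK Xx0K XX XxG Xx0G rG.
have [_ _ GX] := invG false.
have GXm w : w \in G false -> X w \in G true.
  by move=> wG; rewrite (subvP GX) ?memv_img.
have [xP _] := memv_capP x_pp; have [x0P _] := memv_capP x0_pp.
have [XxP _ XXx] := kkP _ _ _ _ XxK; have [Xx0P _ XXx0] := kkP _ _ _ _ Xx0K.
have xG : x \notin G false by apply: contra XxG; exact: GXm.
have x0G : x0 \notin (G false + <[x]>)%VS.
  apply: contra Xx0G => /memv_addP[g gG [_ /vlineP[c ->] ->]].
  by rewrite linearD linearZ memv_add ?GXm ?memvZ ?memv_line.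
have x0x : b x0 x = 0 by rewrite (formC0 xP x0P).
have XX' : b (X x0) (X x) = 0 by rewrite (formC1 XxP Xx0P) XX oppr0.
pose f (t : K) : V := (1 - t) *: x + t *: x0.
have f0 : f 0 = x by rewrite /f subr0 scale1r scale0r addr0.
have f1 : f 1 = x0 by rewrite /f subrr scale1r scale0r add0r.
have XfE t : X (f t) = (1 - t) *: X x + t *: X x0.
  by rewrite /f linearD !linearZ.
have spanE t : (G false + <[f t]> + <[x - x0]> = G false + <[x]> + <[x0]>)%VS.
  by rewrite -(span2 (G false) x x0 (det_line t)) scale1r scaleN1r.
have XspanE t : (G true + <[X (f t)]> + <[X x - X x0]> =
                 G true + <[X x]> + <[X x0]>)%VS.
  by rewrite XfE -(span2 (G true) (X x) (X x0) (det_line t)) scale1r scaleN1r.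
have free t : f t \notin G false /\ x - x0 \notin (G false + <[f t]>)%VS.
  by apply: span2_free; rewrite spanE dim_span2.
have Xfree t : X (f t) \notin G true /\
    X x - X x0 \notin (G true + <[X (f t)]>)%VS.
  by apply: span2_free; rewrite XspanE dim_span2.
have extf t : ext D G true [:: X (f t), f t, X x - X x0, x - x0 & r].
  have [fG fxG] := free t; have [XfG XfxG] := Xfree t.
  have form_f : b (f t) (f t) = 0.
    by rewrite !formE xx x00 xx0 x0x !mulr0 !addr0.
  apply: ext3 => //.
  - split=> //; first by rewrite XfE memvD ?memvZ.
    by rewrite XfE form_alt // memvD ?memvZ.
  - by rewrite memvD ?memvZ.
  - exact: mem_add_line.
  - exact: memvB.
  - by rewrite form_alt // memvB.
  - rewrite XfE !formE XX XX' (form_alt XxP) (form_alt Xx0P).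
    by rewrite !(subr0, oppr0, addr0, mulr0).
  have H0 : upd (upd (upd G true (X (f t))) false (f t)) true (X x - X x0)
              false = (G false + <[f t]>)%VS by [].
  split; last first.
    by move: rG; rewrite !upd4 !XspanE !spanE -(spanE 0) -(XspanE 0) f0.
  split; rewrite ?H0 //; last first.
    by rewrite !formE xx x00 xx0 x0x !(subr0, oppr0, addr0).
  apply/kkP; split; rewrite ?H0; first exact: memvB.
    have [_ xp] := memv_capP x_pp; have [_ x0p] := memv_capP x0_pp.
    rewrite perp_add memv_cap memvB //=; apply/perpP => _ /vlineP[c ->].
    by rewrite !formE xx x00 xx0 x0x !(mulr0, subr0, oppr0, addr0).
  by rewrite linearB; exact: mem_add_line.
have := extf 0; have := extf 1; rewrite f0 f1; split=> //.
pose g t := [:: X (f t), f t, X x - X x0, x - x0 & r].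
suff : conn G true (g 0) (g 1) by rewrite /g f0 f1.
apply: (@conn_curve _ _ _ 1); rewrite ?hornerC ?oner_neq0 //.
  apply: polycurve_cons; first exact/polyfun_comp/polyfun_line.
  by apply: polycurve_cons; [exact: polyfun_line|exact: polycurve_const].
by move=> t _; apply: extf.
Qed.

End Connections.

(** * Similitudes commuting with the operator modulo G *)

Section Similitudes.
Context {K : numClosedFieldType} {V : vectType K} {n : nat}.
Variable D : odd_nilpotent V n.
Local Notation P := (part D).
Local Notation b := (form D).
Local Notation X := (op D).
Implicit Types (e : bool) (u v w x y z : V) (A B : {vspace V}) (r : seq V).
Implicit Type G : bool -> {vspace V}.

Lemma form_nondeg_part e v :
  v \in P e -> {in P e, forall w, b v w = 0} -> v = 0.
Proof.
move=> vP h; have : v \in pp D e (P e) by rewrite memv_cap vP; apply/perpP.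
have /eqP := dim_pp (subvv (P e)); rewrite -{2}[\dim (P e)]add0n eqn_add2r.
by rewrite dimv_eq0 => /eqP ->; rewrite memv0 => /eqP.
Qed.

(** Similitudes rather than isometries, so that reflections can be used without denominators. As [g]
    commutes with the operator only modulo [G], the induction runs over subspaces H containing [G]:
    the error lies in [G] = g(G), hence in g(H). *)
Lemma ext_map G (g : 'End(V)) (c : K) e r : c != 0 ->
    (forall d v, v \in P d -> g v \in P d) ->
    (forall d v w, v \in P d -> w \in P d -> b (g v) (g w) = c * b v w) ->
    (forall d, (g @: G d <= G d)%VS) ->
    (forall d v, v \in pp D d (G d) -> X (g v) - g (X v) \in G (~~ d)) ->
  invariant D G -> ext D G e r -> ext D G e (map g r).
Proof.
move=> c0 gP gb gG gX invG.
have ginj d v : v \in P d -> g v = 0 -> v = 0.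
  move=> vP gv; apply: (form_nondeg_part vP) => w wP.
  by apply: (mulfI c0); rewrite -(gb d) // gv form0l mulr0.
have gGE d : (g @: G d)%VS = G d.
  apply/eqP; rewrite eqEdim gG limg_dim_eq ?leqnn //; apply/eqP.
  have [GP _ _] := invG d; rewrite -subv0; apply/subvP => v.
  rewrite memv_cap memv_ker memv0 => /andP[vG /eqP gv].
  by rewrite (ginj d v) // (subvP GP).
suff main H : (forall d, (G d <= H d)%VS) -> (forall d, (H d <= P d)%VS) ->
    ext D H e r -> ext D (fun d => g @: H d)%VS e (map g r).
  move=> rG; have -> : G = fun d => (g @: G d)%VS by apply: funext.
  by apply: main => // d; case: (invG d).
elim: r e H => //= v r IH e H GH HP [[/kkP[vP /perpP vH Xv] vNH vv] rH].
split; first split.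
- apply/kkP; split; first exact: gP.
    apply/perpP => _ /memv_imgP[a aH ->].
    by rewrite (gb e) ?vH ?mulr0 // (subvP (HP e)).
  rewrite -(subrK (g (X v)) (X (g v))) memvD ?memv_img //.
  rewrite (subvP (limgS g (GH _))) // gGE gX // memv_cap vP.
  by apply/perpP => a aG; rewrite vH // (subvP (GH e)).
- apply: contra vNH => /memv_imgP[a aH gva].
  have aP : a \in P e by rewrite (subvP (HP e)).
  suff /eqP : v - a = 0 by rewrite subr_eq0 => /eqP ->.
  by apply: (ginj e); rewrite ?memvB // linearB /= gva subrr.
- by rewrite (gb e) // vv mulr0.
have -> : upd (fun d => (g @: H d)%VS) e (g v) =
          fun d => (g @: upd H e v d)%VS.
  apply: funext => d; rewrite /upd.
  by case: eqP => // _; rewrite limgD limg_line.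
apply: IH => // d; first exact: subv_trans (GH d) (upd_sub _ _ _ _).
by rewrite /upd; case: eqP => // ->; rewrite subv_add HP -memvE.
Qed.

Lemma ext_scale G e c r : c != 0 -> invariant D G -> ext D G e r ->
  ext D G e (map (fun w => c *: w) r).
Proof.
move=> c0 invG rG.
have -> : map (fun w => c *: w) r = map (c *: \1)%VF r.
  by apply: eq_map => w; rewrite scale_lfunE id_lfunE.
have cE w : (c *: \1)%VF w = c *: w by rewrite scale_lfunE id_lfunE.
apply: (@ext_map _ _ (c ^+ 2)) => //.
- by rewrite expf_eq0.
- by move=> d v vP; rewrite cE memvZ.
- by move=> d v w _ _; rewrite !cE !formE expr2 mulrA.
- by move=> d; apply/subvP => _ /memv_imgP[w wG ->]; rewrite cE memvZ.
- by move=> d v _; rewrite !cE linearZ subrr mem0v.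
Qed.

(* The reflection along [a] multiplied by [b a a], hence defined for all a. *)
Definition reflection (a : V) : 'End(V) :=
  (b a a *: \1 - 2 *: rank1 b a a)%VF.

Lemma reflectionE a w : reflection a w = b a a *: w - (2 * b w a) *: a.
Proof.
by rewrite !(add_lfunE, opp_lfunE, scale_lfunE, id_lfunE, rank1E) scalerA.
Qed.

Lemma reflectionK a w : reflection a (reflection a w) = b a a ^+ 2 *: w.
Proof.
rewrite !reflectionE !formE scalerBr !scalerA -addrA -opprD -scalerDl.
by rewrite [X in X *: a](_ : _ = 0) ?scale0r ?subr0 ?expr2 //; ring.
Qed.

(** For the reflection s along [a], X s v - s X v = 2 b(X v, a) a - 2 b(v, a) X a. The first term
    vanishes because image and kernel are orthogonal, and the second lies in [G]. *)
Lemma ext_reflection G e a r : invariant D G -> a \in kk D G false ->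
  b a a != 0 -> ext D G e r -> ext D G e (map (reflection a) r).
Proof.
move=> invG aK a0; have [aP /perpP aG Xa] := kkP _ _ _ _ aK.
have cross v : v \in P true -> b v a = 0 by move=> vP; apply: (form_cross vP).
apply: (@ext_map _ _ (b a a ^+ 2)) => //.
- by rewrite expf_eq0.
- move=> [] v vP; rewrite reflectionE.
    by rewrite (cross v) // mulr0 scale0r subr0 memvZ.
  by rewrite memvB ?memvZ.
- move=> [] v w vP wP; rewrite !reflectionE !formE; last first.
    by rewrite (formC0 aP wP); ring.
  have aw0 : b a w = 0 by apply: (form_cross aP).
  by rewrite (cross v) // (cross w) // aw0; ring.
- move=> d; apply/subvP => _ /memv_imgP[w wG ->]; rewrite reflectionE.
  have -> : b w a = 0.
    have [GP _ _] := invG d; have wP := subvP GP _ wG.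
    case: d wP {GP} wG => wP wG; first exact: cross.
    by apply/eqP; rewrite (form0C aP wP) aG.
  by rewrite mulr0 scale0r subr0 memvZ.
move=> d v v_pp; rewrite !reflectionE linearB !linearZ /=.
rewrite opprD addrACA subrr add0r.
have -> : b (X v) a = 0.
  case: d v_pp => v_pp; first exact: (op_perp_kk (e := false) v_pp aK).
  by move: v_pp; rewrite memv_cap => /andP[/op_part vP _]; exact: cross.
rewrite mulr0 scale0r subr0.
case: d v_pp => v_pp; last by rewrite memvZ // memvN.
have -> : b v a = 0 by move: v_pp; rewrite memv_cap => /andP[/cross].
by rewrite mulr0 scale0r mem0v.
Qed.

(** The commutator with the operator is computed as for reflections; [a] being isotropic, the map is
    an isometry for every [s]. *)
Lemma ext_transvection G e s a r : invariant D G -> a \in kk D G true ->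
  ext D G e r -> ext D G e (map (\1 + s *: rank1 b a a)%VF r).
Proof.
move=> invG aK; have [aP /perpP aG Xa] := kkP _ _ _ _ aK.
have cross v : v \in P false -> b v a = 0 by move=> vP; apply: (form_cross vP).
have tE w : (\1 + s *: rank1 b a a)%VF w = w + (s * b w a) *: a.
  by rewrite !(add_lfunE, scale_lfunE, id_lfunE, rank1E) scalerA.
apply: (@ext_map _ _ 1) => //.
- exact: oner_neq0.
- move=> [] v vP; rewrite tE; first by rewrite memvD ?memvZ.
  by rewrite cross // mulr0 scale0r addr0.
- move=> [] v w vP wP; rewrite !tE !formE; last first.
    by rewrite (cross v) // (cross w) //; ring.
  by rewrite (formC1 aP wP) (form_alt aP); ring.
- move=> d; apply/subvP => _ /memv_imgP[w wG ->]; rewrite tE.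
  have -> : b w a = 0.
    have [GP _ _] := invG d; have wP := subvP GP _ wG.
    case: d wP {GP} wG => wP wG; last exact: cross.
    by apply/eqP; rewrite (form0C aP wP) aG.
  by rewrite mulr0 scale0r addr0.
move=> d v v_pp; rewrite !tE linearD linearZ /= opprD addrACA subrr add0r.
have -> : b (X v) a = 0.
  case: d v_pp => v_pp; last exact: (op_perp_kk (e := true) v_pp aK).
  by move: v_pp; rewrite memv_cap => /andP[/op_part vP _]; exact: cross.
rewrite mulr0 scale0r subr0.
case: d v_pp => v_pp; first by rewrite memvZ.
have -> : b v a = 0 by move: v_pp; rewrite memv_cap => /andP[/cross].
by rewrite mulr0 scale0r mem0v.
Qed.

(* The transvections along [y0 - y] move [y] to [y0] and fix even vectors. *)
Lemma conn_transvection G y y0 r : invariant D G ->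
  ok D G true y -> ok D G true y0 -> b y y0 != 0 -> ext D G true (y :: r) ->
  exists g : 'End(V), [/\ {in P false, forall x, g x = x},
    ext D G true (y0 :: map g r) & conn D G true (y :: r) (y0 :: map g r)].
Proof.
move=> invG [yK _ _] [y0K _ _] yy0 rG.
pose a := y0 - y; have aK : a \in kk D G true by rewrite memvB.
have [aP _ _] := kkP _ _ _ _ aK; have [yP _ _] := kkP _ _ _ _ yK.
(* Since b y a = b y y0, the coefficient of [a] in g 1 y is 1, and y + a = y0. *)
pose g (t : K) : 'End(V) := (\1 + (t / b y y0) *: rank1 b a a)%VF.
have gE t w : g t w = w + (t / b y y0 * b w a) *: a.
  by rewrite !(add_lfunE, scale_lfunE, id_lfunE, rank1E) scalerA.
have g0 : map (g 0) (y :: r) = y :: r.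
  apply: map_id_in => w _; by rewrite gE !mul0r scale0r addr0.
have g1 : g 1 y = y0.
  rewrite gE /a !formE (form_alt yP) oppr0 addr0 div1r mulVf // scale1r.
  by rewrite addrC subrK.
exists (g 1); split.
- move=> x xP; have -> : g 1 x = x; last by [].
  by rewrite gE (form_cross xP aP) mulr0 scale0r addr0.
- by rewrite -[X in X :: _]g1 -map_cons; apply: ext_transvection.
rewrite -[X in conn _ _ _ X _]g0 -[X in X :: map (g 1) _]g1 -map_cons.
apply: (@conn_curve _ _ _ _ _ _ (fun t => map (g t) (y :: r)) 1).
- by rewrite hornerC oner_neq0.
- by rewrite hornerC oner_neq0.
- apply: polycurve_map => v.
  apply: (@eq_polyfun _ _ (fun t => v + ((b v a / b y y0) *: 'X).[t] *: a)).
    by move=> t; rewrite gE !hornerE; congr (_ + _ *: _); ring.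
  by apply: polyfunD; [|apply: polyfunZ]; apply: polyfun_const.
- by move=> t _; apply: ext_transvection.
Qed.

(* With [s_w] the reflection along [w], the isometries [s_(v t) s_a], where [v]
   runs from [a] to [x - x0], start at the identity and end at one that maps [x]
   to [x0]; they commute with the operator modulo [G]. *)
Lemma conn_reflection G x x0 a r : invariant D G ->
    ok D G false x -> ok D G false x0 -> b x x0 != 0 ->
    a \in kk D G false -> b a x = 0 -> b a x0 = 0 -> b a a != 0 ->
    ext D G false (x :: r) ->
  exists r', [/\ size r' = size r, ext D G false (x0 :: r')
    & conn D G false (x :: r) (x0 :: r')].
Proof.
move=> invG okx okx0 xx0 aK ax ax0 aa rG.
have [xK _ xx] := okx; have [x0K _ x00] := okx0.
have [aP _ _] := kkP _ _ _ _ aK; have [xP _ _] := kkP _ _ _ _ xK.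
have [x0P _ _] := kkP _ _ _ _ x0K.
pose v (t : K) : V := (1 - t) *: a + t *: (x - x0).
have vK t : v t \in kk D G false by rewrite memvD ?memvZ ?memvB.
(* The square length of [v t]: there is no cross term because [a] is orthogonal to x and x0. It
   equals b a a at 0 and -2 b x x0 at 1, both non-zero. *)
pose d : {poly K} := b a a *: (1 - 'X) ^+ 2 - (2 * b x x0) *: 'X ^+ 2.
have dE t : b (v t) (v t) = d.[t].
  rewrite /v /d !(hornerD, hornerN, hornerZ, horner_exp, hornerX, hornerC).
  rewrite !formE (formC0 aP xP) (formC0 aP x0P) ax ax0.
  rewrite (formC0 xP x0P) xx x00. ring.
(* The reflections are not normalised; the scalar makes [h 0] the identity. *)
pose h (t : K) : 'End(V) :=
  ((b a a)^-2 *: (reflection (v t) \o reflection a))%VF.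
have hE t w : h t w = (b a a)^-2 *: reflection (v t) (reflection a w).
  by rewrite scale_lfunE comp_lfunE.
pose c : K := - 2 * b x x0 / b a a.
have c0 : c != 0.
  by rewrite !mulf_neq0 ?invr_eq0 // oppr_eq0 pnatr_eq0.
have h0 : map (h 0) (x :: r) = x :: r.
  apply: map_id_in => w _; rewrite hE /v subr0 scale1r scale0r addr0.
  by rewrite reflectionK scalerA mulVf ?scale1r // expf_eq0.
have h1 : h 1 x = c *: x0.
  rewrite hE /v subrr scale1r scale0r add0r.
  have -> : reflection a x = b a a *: x.
    by rewrite reflectionE (formC0 aP xP) ax mulr0 scale0r subr0.
  have -> : reflection (x - x0) (b a a *: x) = (- 2 * b x x0 * b a a) *: x0.
    rewrite linearZ /= reflectionE.
    have -> : b (x - x0) (x - x0) = - 2 * b x x0.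
      by rewrite !formE (formC0 xP x0P) xx x00; ring.
    have -> : 2 * b x (x - x0) = - 2 * b x x0 by rewrite !formE xx; ring.
    rewrite [(- 2 * _) *: (x - _)]scalerBr opprB [X in _ *: X]addrC subrK.
    by rewrite scalerA; congr (_ *: _); ring.
  by rewrite scalerA; congr (_ *: _); rewrite /c; field.
pose r1 := map (h 1) r.
have ext_h t s : d.[t] != 0 -> ext D G false s -> ext D G false (map (h t) s).
  move=> dt sG.
  have -> : map (h t) s = map (fun w => (b a a)^-2 *: w)
      (map (reflection (v t)) (map (reflection a) s)).
    by rewrite -!map_comp; apply: eq_map => w /=; rewrite hE.
  apply: ext_scale => //; first by rewrite invr_eq0 expf_eq0.
  by apply: ext_reflection; rewrite ?dE //; apply: ext_reflection.
have [okcx r1G] : ext D G false (c *: x0 :: r1).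
  rewrite -h1 -map_cons; apply: ext_h => //.
  rewrite /d !(hornerD, hornerN, hornerZ, horner_exp, hornerX, hornerC).
  rewrite subrr expr0n mulr0 sub0r oppr_eq0 expr1n mulr1.
  by rewrite mulf_neq0 ?pnatr_eq0.
(* The curve ends at a multiple of x0, which spans the same step; [conn_flag] does the rescaling. *)
have updc : (G false + <[c *: x0]> = G false + <[x0]>)%VS.
  by apply: add_line_eq; [rewrite memvZ ?mem_add_line | case: okcx].
exists r1; split; first by rewrite size_map.
  by split=> //; rewrite -(upd_eq updc).
apply: (@conn_trans _ _ _ _ _ _ _ (c *: x0 :: r1)); last exact: conn_flag.
rewrite -[X in conn _ _ _ X _]h0 -h1 -map_cons.
apply: (@conn_curve _ _ _ _ _ _ (fun t => map (h t) (x :: r)) d).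
- by rewrite -dE /v subr0 scale1r scale0r addr0.
- rewrite /d !(hornerD, hornerN, hornerZ, horner_exp, hornerX, hornerC).
  rewrite subrr expr0n mulr0 sub0r oppr_eq0 expr1n mulr1.
  by rewrite mulf_neq0 ?pnatr_eq0.
- apply: polycurve_map => w; set w' := reflection a w.
  pose p : {poly K} := b w' a *: (1 - 'X) + b w' (x - x0) *: 'X.
  apply: (@eq_polyfun _ _ (fun t => ((b a a)^-2)%:P.[t] *:
      (d.[t] *: w' + (- 2 *: p).[t] *: v t))).
    move=> t; rewrite hE reflectionE dE hornerC -scaleNr.
    congr (_ *: (_ + _ *: _)).
    rewrite /p /v !(hornerD, hornerN, hornerZ, hornerX, hornerC) !formE; ring.
  apply/polyfunZ/polyfunD; first exact/polyfunZ/polyfun_const.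
  exact/polyfunZ/polyfun_line.
- by move=> t dt; apply: ext_h.
Qed.
End Similitudes.

(** * Completions of a partial flag *)

Section ConnectedExtensions.
Context {K : numClosedFieldType} {V : vectType K} {n : nat}.
Variable D : odd_nilpotent V n.
Local Notation P := (part D).
Local Notation b := (form D).
Local Notation X := (op D).
Implicit Types (e : bool) (u v w x y z : V) (A B : {vspace V}) (r : seq V).
Implicit Type G : bool -> {vspace V}.

(* The kernel of the induced operator in the even part of [G^\perp / G] is a
   non-degenerate plane. *)
Definition bad G := exists v v0, [/\ ok D G false v, ok D G false v0,
  b v v0 != 0 & kk D G false = (G false + <[v]> + <[v0]>)%VS].

Lemma ok_sub_kk G e v : invariant D G -> ok D G e v ->
  (G e + <[v]> <= kk D G e)%VS.
Proof. by move=> invG [vK _ _]; rewrite subv_add kk_sub // -memvE. Qed.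

Lemma isotropic_pair G e v v0 : invariant D G ->
    v \in pp D e (G e) -> b v v = 0 ->
    v0 \in pp D e (G e) -> b v0 v0 = 0 -> b v v0 = 0 ->
  (G e + <[v]> + <[v0]> <= perp b (G e + <[v]> + <[v0]>))%VS.
Proof.
move=> invG v_pp vv v0_pp v00 vv0; have [v0P v0p] := memv_capP v0_pp.
have [vP _] := memv_capP v_pp; have [GP Gp _] := invG e.
have h := isotropic_add GP Gp v_pp vv.
apply: (@isotropic_add _ _ _ D e) => //; first by rewrite subv_add GP -memvE.
rewrite memv_cap v0P perp_add memv_cap v0p; apply/perpP => _ /vlineP[c ->].
by apply/eqP; rewrite formZr mulf_eq0 (form0C vP v0P) vv0 eqxx orbT.
Qed.

Lemma room_pair G e v v0 : invariant D G ->
    v \in pp D e (G e) -> v \notin G e -> b v v = 0 ->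
    v0 \in pp D e (G e) -> b v0 v0 = 0 -> b v v0 = 0 ->
    v0 \notin (G e + <[v]>)%VS -> (2 * (\dim (G e) + 2) <= 2 * n + ~~ e)%N.
Proof.
move=> invG v_pp vG vv v0_pp v00 vv0 v0G.
have [vP _] := memv_capP v_pp; have [v0P _] := memv_capP v0_pp.
have [GP _ _] := invG e.
have AP : (G e + <[v]> + <[v0]> <= P e)%VS by rewrite !subv_add GP -!memvE vP.
have := isotropic_dim AP (isotropic_pair invG v_pp vv v0_pp v00 vv0).
by rewrite dim_span2 // dim_part addn2.
Qed.

(** Two independent orthogonal candidates enlarge [G e] to an isotropic space of dimension two more,
    at most half of the part of parity [e]. So at least three vectors are missing, as many as
    [conn_swap] moves. *)
Lemma room_ok G e m v v0 : state D G e m.+1 -> ok D G e v -> ok D G e v0 ->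
    b v v0 = 0 -> v0 \notin (G e + <[v]>)%VS -> (2 <= m)%N.
Proof.
move=> [invG dG dGe] [vK vG vv] [v0K _ v00] vv0 v0G.
have [v_pp _] := memv_capP vK; have [v0_pp _] := memv_capP v0K.
have := room_pair invG v_pp vG vv v0_pp v00 vv0 v0G.
by move: dG dGe; clear; case: e => /=; lia.
Qed.

(** The tails after v and after v0 are connected by hypothesis to one that starts with z and v - v0;
    [conn_swap] then exchanges the heads. *)
Lemma conn_perp G e m v v0 z r r' : state D G e m.+1 ->
    ok D G e v -> ok D G e v0 -> b v v0 = 0 -> v0 \notin (G e + <[v]>)%VS ->
    ok D G (~~ e) z ->
    connected_ext D (upd G e v) (~~ e) m ->
    connected_ext D (upd G e v0) (~~ e) m ->
    size r = m -> size r' = m -> ext D G e (v :: r) -> ext D G e (v0 :: r') ->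
  conn D G e (v :: r) (v0 :: r').
Proof.
move=> stG okv okv0 vv0 v0v okz cv cv0 sr sr' [_ rG] [_ r'G].
have [invG _ _] := stG; have [vK vG vv] := okv; have [v0K _ v00] := okv0.
case: m => [|[|m]] in stG cv cv0 sr sr' *;
  try by have := room_ok stG okv okv0 vv0 v0v.
have [[_ [okz' [vd_ok _]]] _ _] :=
  conn_swap (r := [::]) invG okv okv0 vv0 v0v okz I.
have st2 := state_upd (state_upd stG okv) okz'; rewrite negbK in st2 vd_ok.
have [s sG ss] := exists_ext (state_upd st2 vd_ok).
have [e1 e2 c] := conn_swap invG okv okv0 vv0 v0v okz sG.
apply: (@conn_trans _ _ _ _ _ _ _ [:: v, z, v - v0 & s]).
  by apply: conn_cons => //; apply: cv => //; [rewrite /= ss|case: e1].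
apply: conn_trans c _; apply: conn_cons => //.
by apply: cv0 => //; [rewrite /= ss|case: e2].
Qed.

(** Removes from [a] its components along the hyperbolic plane of x and x0. *)
Lemma exists_third A B x x0 a : (A <= P false)%VS -> x \in A -> x0 \in A ->
    a \in A -> a \notin (B + <[x]> + <[x0]>)%VS ->
    b x x = 0 -> b x0 x0 = 0 -> b x x0 != 0 ->
  exists a', [/\ a' \in A, b a' x = 0, b a' x0 = 0
               & a' \notin (B + <[x]> + <[x0]>)%VS].
Proof.
move=> AP xA x0A aA aB xx x00 xx0.
have xP := subvP AP _ xA; have x0P := subvP AP _ x0A.
pose c := b a x0 / b x x0; pose c0 := b a x / b x x0.
exists (a - c *: x - c0 *: x0); split.
- by rewrite !memvB ?memvZ.
- by rewrite !formE xx (formC0 xP x0P) /c0; field.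
- by rewrite !formE x00 /c; field.
apply: contra aB => h.
rewrite -[a](subrK (c *: x)) -[a - _](subrK (c0 *: x0)).
rewrite memvD //; last by rewrite (subvP (addvSl _ _)) // memvZ ?mem_add_line.
by rewrite memvD // memvZ // mem_add_line.
Qed.

Lemma notin_exchange A v w :
  w \notin A -> v \notin (A + <[w]>)%VS -> w \notin (A + <[v]>)%VS.
Proof.
move=> wA vAw; have d2 := dim_span2 wA vAw.
rewrite -addvA [(<[w]> + _)%VS]addvC addvA in d2.
by case: (span2_free (esym d2)).
Qed.

(** Two independent even kernel vectors force a non-zero odd kernel by [dim_kk]. The vector [z] will
    be the middle vector of [conn_swap]. *)
Lemma odd_candidates G v v0 : invariant D G ->
    (\dim (G false) = \dim (G true))%N ->
    v \in kk D G false -> v0 \in kk D G false -> v \notin G false ->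
    v0 \notin (G false + <[v]>)%VS -> exists z, ok D G true z.
Proof.
move=> invG dG vK v0K vG v0G; have := dim_kk true invG.
have /dimvS : (G false + <[v]> + <[v0]> <= kk D G false)%VS.
  by rewrite !subv_add kk_sub // -!memvE vK.
rewrite dim_span2 // !dim_part /= => d1 d2.
have [|z zK zG] := @exists_notin _ _ (kk D G true) (G true); first lia.
by exists z; split=> //; case/kkP: zK => zP _ _; rewrite form_alt.
Qed.

(** When v and v0 are not orthogonal, the kernel contains a vector [a] orthogonal to both and
    outside their span, since it is not reduced to their plane. If [a] is isotropic it is an
    intermediate first vector; if not, [conn_reflection] applies. *)
Lemma connected_even G m : state D G false m.+1 -> ~ bad G ->
    (forall v, ok D G false v -> connected_ext D (upd G false v) true m) ->
  connected_ext D G false m.+1.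
Proof.
move=> stG nbad IH [|v r] [|v0 r'] //= [sr] [sr'] rG r'G.
have [invG dG dGe] := stG; rewrite addn0 in dGe.
have [okv _] := rG; have [okv0 _] := r'G.
have [v0v|v0v] := boolP (v0 \in (G false + <[v]>)%VS).
  exact: (connected_same (IH _ okv)) v0v _ _ _ _.
have [vK vG vv] := okv; have [v0K v0G v00] := okv0.
have [z okz] := odd_candidates invG dGe vK v0K vG v0v.
have [vv0|vv0] := eqVneq (b v v0) 0.
  by apply: (conn_perp stG okv okv0 vv0 v0v okz); rewrite //; apply: IH.
have KP := kk_part D G false.
have [a0 a0K a0G] : exists2 a, a \in kk D G false &
    a \notin (G false + <[v]> + <[v0]>)%VS.
  apply/subvPn/negP => sub; apply: nbad; exists v, v0; split=> //.
  by apply/eqP; rewrite eqEsubv sub !subv_add kk_sub // -!memvE vK.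
have [a [aK av av0 aG]] := exists_third KP vK v0K a0K a0G vv v00 vv0.
have vP := ok_part okv; have v0P := ok_part okv0.
have aP := subvP KP _ aK.
have va : b v a = 0 by rewrite (formC0 aP vP).
have av_notin : a \notin (G false + <[v]>)%VS.
  by apply: contra aG => h; rewrite (subvP (addvSl _ _)).
have [aa|aa] := eqVneq (b a a) 0; last first.
  have [r1 [sr1 r1G c1]] := conn_reflection invG okv okv0 vv0 aK av av0 aa rG.
  apply: conn_trans c1 _; apply: conn_cons => //.
  by apply: (IH v0) => //; [rewrite sr1|case: r1G|case: r'G].
have oka : ok D G false a.
  by split=> //; apply: contra av_notin => h; rewrite (subvP (addvSl _ _)).
have [s sG ss] := exists_ext (state_upd stG oka).
have asG : ext D G false (a :: s) by split.
apply: (@conn_trans _ _ _ _ _ _ _ (a :: s)).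
  by apply: (conn_perp stG okv oka va av_notin okz); rewrite //; apply: IH.
apply: (conn_perp stG oka okv0 av0 _ okz) => //; try exact: IH.
apply/negP => /memv_addP[g gG [_ /vlineP[c ->] v0E]].
case/eqP: vv0; rewrite v0E !formE va mulr0 addr0.
by case/kkP: vK => _ /perpP vp _; exact: vp.
Qed.

End ConnectedExtensions.

(** * The odd step, together with the even step that follows *)

Section OddStep.
Context {K : numClosedFieldType} {V : vectType K} {n : nat}.
Variable D : odd_nilpotent V n.
Local Notation P := (part D).
Local Notation b := (form D).
Local Notation X := (op D).
Implicit Types (e : bool) (u v w x y z : V) (A B : {vspace V}) (r : seq V).
Implicit Type G : bool -> {vspace V}.

Lemma ok_upd G e v z :
  ok D G (~~ e) z -> ok D (upd G e v) (~~ e) z.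
Proof.
case=> /kkP[zP zp Xz] zG zz; split; rewrite ?updC //.
by apply/kkP; split; rewrite ?updC // (subvP (upd_sub _ _ _ _)).
Qed.

Lemma ok_odd G y : y \in kk D G true -> y \notin G true -> ok D G true y.
Proof.
by move=> yK yG; split=> //; case/kkP: yK => yP _ _; rewrite form_alt.
Qed.

(** With a single vector missing there is no room for two independent orthogonal candidates, so
    transvections suffice. *)
Lemma connected_odd_last G : state D G true 1 -> connected_ext D G true 1.
Proof.
move=> stG [|y [|? ?]] [|y0 [|? ?]] //= _ _ [oky _] [oky0 _].
have [invG _ _] := stG.
have [y0y|y0y] := boolP (y0 \in (G true + <[y]>)%VS).
  by apply: conn_flag => //; case: oky0 => _ y0G _; rewrite (add_line_eq y0y).
have [yy0|yy0] := eqVneq (b y y0) 0.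
  by have := room_ok stG oky oky0 yy0 y0y.
have yG : ext D G true [:: y] by [].
by have [g [_ _ c]] := conn_transvection invG oky oky0 yy0 yG.
Qed.

Context {G : bool -> {vspace V}} {m : nat}.
(** Two induction hypotheses: after one more vector the next step is even and may be obstructed;
    after two it is odd and never is. *)
Hypothesis stG : state D G true m.+2.
Hypothesis IHA : forall y, ok D G true y -> ~ bad D (upd G true y) ->
  connected_ext D (upd G true y) false m.+1.
Hypothesis IHB : forall y x, ok D G true y -> ok D (upd G true y) false x ->
  connected_ext D (upd (upd G true y) false x) true m.

Let invG : invariant D G. Proof. by case: stG. Qed.

Lemma conn_tail y x r r' : size r = m -> size r' = m ->
    ext D G true [:: y, x & r] -> ext D G true [:: y, x & r'] ->
  conn D G true [:: y, x & r] [:: y, x & r'].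
Proof.
move=> sr sr' [oky [okx rG]] [_ [_ r'G]].
by do 2!apply: conn_cons => //; apply: IHB.
Qed.

Lemma conn_tail_flag y y0 x x0 r r' : size r = m -> size r' = m ->
    y0 \in (G true + <[y]>)%VS -> x0 \in (G false + <[x]>)%VS ->
    ext D G true [:: y, x & r] -> ext D G true [:: y0, x0 & r'] ->
  conn D G true [:: y, x & r] [:: y0, x0 & r'].
Proof.
move=> sr sr' y0y x0x rG [oky0 [okx0 r'G]]; have [oky [okx _]] := rG.
have yy0 : (G true + <[y0]> = G true + <[y]>)%VS.
  by apply: add_line_eq => //; case: oky0.
have eqU := upd_eq yy0.
have okx0' : ok D (upd G true y) false x0 by rewrite -eqU.
have xx0 : (upd G true y false + <[x0]> = upd G true y false + <[x]>)%VS.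
  by apply: add_line_eq => //; case: okx0'.
have eqU' := upd_eq xx0.
apply: (@conn_trans _ _ _ _ _ _ _ [:: y, x & r']).
  apply: conn_tail => //; do 2!split=> //.
  by rewrite /= -eqU' -eqU.
apply: (@conn_trans _ _ _ _ _ _ _ [:: y, x0 & r']).
  apply: conn_cons => //; apply: conn_flag => //.
  by rewrite -eqU' -eqU.
by apply: conn_flag => //; split=> //; rewrite -eqU.
Qed.

(** An even vector already in the kernel at [G] can follow any odd vector. The odd vector then moves
    while [xs] stays: transvections fix even vectors, and [conn_swap] keeps its middle vector. *)
Lemma conn_star xs y y0 r r' : ok D G false xs ->
    size r = m -> size r' = m ->
    ext D G true [:: y, xs & r] -> ext D G true [:: y0, xs & r'] ->
  conn D G true [:: y, xs & r] [:: y0, xs & r'].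
Proof.
move=> okxs sr sr' rG r'G; have [oky _] := rG; have [oky0 _] := r'G.
have [y0y|y0y] := boolP (y0 \in (G true + <[y]>)%VS).
  by apply: conn_tail_flag => //; exact: mem_add_line.
have [yy0|yy0] := eqVneq (b y y0) 0; last first.
  have [g [gP [_ [okx gG]]]] := conn_transvection invG oky oky0 yy0 rG.
  rewrite /= gP ?(ok_part okxs) // in okx gG *.
  move=> c; apply: conn_trans c _; apply: conn_tail => //.
  by rewrite size_map.
have := room_ok stG oky oky0 yy0 y0y; case mE: m => [|m1] // _.
have [[_ [_ [okd _]]] _ _] :=
  conn_swap (e := true) (r := [::]) invG oky oky0 yy0 y0y okxs I.
have okxs' := ok_upd (e := true) y okxs.
have st2 := state_upd (state_upd stG oky) okxs'; rewrite mE in st2.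
have [s sG ss] := exists_ext (state_upd st2 okd).
have [e1 e2 c] := conn_swap (e := true) invG oky oky0 yy0 y0y okxs sG.
apply: (@conn_trans _ _ _ _ _ _ _ [:: y, xs, y - y0 & s]).
  by apply: conn_tail => //=; rewrite ss mE.
by apply: conn_trans c _; apply: conn_tail => //=; rewrite ss mE.
Qed.

Lemma dim_odd : (2 * \dim (G false) + m.+1 = 2 * n /\
  \dim (G false) = (\dim (G true)).+1)%N.
Proof. by case: stG => _ /= dG dGe; lia. Qed.

Lemma bad_dim H : bad D H -> \dim (kk D H false) = (\dim (H false)).+2.
Proof.
case=> v [v0 [[vK vH vv] _ vv0 ->]]; apply: dim_span2 => //.
apply/negP => /memv_addP[g gG [_ /vlineP[c ->] v0E]]; case/eqP: vv0.
have [_ /perpP vp _] := kkP _ _ _ _ vK.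
by rewrite v0E !formE vv vp // mulr0 addr0.
Qed.

Lemma kk_upd_odd y x : ok D G true y -> x \in pp D false (G false) ->
  X x \in (G true + <[y]>)%VS -> x \in kk D (upd G true y) false.
Proof. by move=> oky /memv_capP[xP xp] Xx; apply/kkP. Qed.

(** Otherwise the kernel after [y] would be the plane of [k] and [a] modulo G, which is totally
    isotropic. *)
Lemma not_bad_isotropic y a k : ok D G true y ->
    k \in kk D G false -> k \notin G false ->
    a \in pp D false (G false) -> b a a = 0 -> b k k = 0 -> b a k = 0 ->
    a \notin (G false + <[k]>)%VS -> X a \in (G true + <[y]>)%VS ->
  ~ bad D (upd G true y).
Proof.
move=> oky kK kG a_pp aa bkk ak aG XaG badU; have dK := bad_dim badU.
case: badU => v [v0 [[vK _ _] [v0K _ _] vv0 _]].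
have [k_pp _] := memv_capP kK; have [kP _ Xk] := kkP _ _ _ _ kK.
have [aP ap] := memv_capP a_pp.
have invU := invariant_upd invG oky.
have aU := kk_upd_odd oky a_pp XaG.
have kU := kk_upd_odd oky k_pp (subvP (addvSl _ _) _ Xk).
have KE2 : kk D (upd G true y) false = (G false + <[k]> + <[a]>)%VS.
  apply/eqP; rewrite eq_sym eqEdim dK dim_span2 // leqnn andbT.
  by rewrite !subv_add -!memvE kU aU !andbT; exact: (kk_sub false invU).
have ka : b k a = 0 by rewrite (formC0 aP kP).
have iso := isotropic_pair invG k_pp bkk a_pp aa ka.
rewrite KE2 in vK v0K.
by case/eqP: vv0; have /perpP := subvP iso _ vK; apply.
Qed.

(** * Odd step when the even kernel is a line *)

Section LineKernel.
Context {k : V}.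
Hypothesis kkE : kk D G false = (G false + <[k]>)%VS.
Hypothesis kG : k \notin G false.

Let k_pp : k \in pp D false (G false).
Proof.
have : k \in kk D G false by rewrite kkE mem_add_line.
by case/memv_capP.
Qed.

Let Xk : X k \in G true.
Proof.
have : k \in kk D G false by rewrite kkE mem_add_line.
by case/kkP.
Qed.

Lemma op_even w : w \in G false -> X w \in G true.
Proof. by have [_ _ GX] := invG false => wG; rewrite (subvP GX) ?memv_img. Qed.

Lemma dim_kk_odd : \dim (kk D G true) = (\dim (G true)).+2.
Proof.
have [_ dG] := dim_odd; have := dim_kk true invG.
by rewrite /= kkE dim_add_line // !dim_part /=; lia.
Qed.

(* [x] spans a step following the step spanned by [X x]. *)
Definition lift x := [/\ x \in pp D false (G false), X x \in kk D G true
  & X x \notin G true].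

Lemma lift_notin x : lift x -> x \notin G false.
Proof. by case=> _ _; apply: contra; exact: op_even. Qed.

Lemma lift_notin_kk x : lift x -> x \notin (G false + <[k]>)%VS.
Proof.
case=> _ _; apply: contra => /memv_addP[g gG [_ /vlineP[c ->] ->]].
by rewrite linearD linearZ memvD ?memvZ // op_even.
Qed.

Lemma kk_odd_span x y : lift x -> y \in kk D G true ->
  y \notin (G true + <[X x]>)%VS -> kk D G true = (G true + <[X x]> + <[y]>)%VS.
Proof.
case=> _ XxK XxG yK yG; apply/eqP.
rewrite eq_sym eqEdim !subv_add kk_sub // -!memvE XxK yK dim_span2 //.
by rewrite dim_kk_odd /=.
Qed.

(** Modulo G the odd kernel is a plane containing X x, which as an image is orthogonal to the whole
    kernel; an alternating form on a plane with a non-zero radical vanishes. *)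
Lemma kk_odd_isotropic x y1 y2 : lift x ->
  y1 \in kk D G true -> y2 \in kk D G true -> b y1 y2 = 0.
Proof.
move=> lx y1K y2K; have [x_pp XxK XxG] := lx.
have [|y yK yG] := @exists_notin _ _ (kk D G true) (G true + <[X x]>)%VS.
  by rewrite dim_kk_odd dim_add_line.
have [Xx_pp _] := memv_capP XxK; have [y_pp _] := memv_capP yK.
have [XxP _] := memv_capP Xx_pp; have [yP _] := memv_capP y_pp.
have iso := isotropic_pair invG Xx_pp (form_alt XxP) y_pp (form_alt yP)
  (op_perp_kk (e := true) x_pp yK).
move: y1K y2K; rewrite (kk_odd_span lx yK yG) => y1K y2K.
by have /perpP := subvP iso _ y1K; exact.
Qed.

(** Being isotropic, the odd kernel lies in its own orthogonal, which is the image of the induced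
    operator. *)
Lemma exists_lift x y : lift x -> y \in kk D G true ->
  exists2 x', x' \in pp D false (G false) & X x' - y \in G true.
Proof.
move=> lx yK.
have yU : y \in (X @: pp D false (G false) + G true)%VS.
  have [GP' _ _] := invG true; have [GP _ _] := invG false.
  rewrite -(@ppK _ _ _ D true (X @: _ + _)); last first.
    rewrite subv_add GP' andbT; apply/subvP => _ /memv_imgP[w w_pp ->].
    by apply: (op_part (e := false)); case/memv_capP: w_pp.
  rewrite -(@kk_pp _ _ _ D G false) // memv_cap (subvP (kk_part _ _ _) _ yK).
  by apply/perpP => y' y'K; exact: kk_odd_isotropic lx yK y'K.
case/memv_addP: yU => _ /memv_imgP[w w_pp ->] [g gG ->].
by exists w; rewrite // opprD addNKr memvN.
Qed.

Lemma conn_lift x x0 r r0 : lift x -> lift x0 ->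
    b x x = 0 -> b x0 x0 = 0 -> b x x0 = 0 ->
    X x0 \notin (G true + <[X x]>)%VS -> size r = m -> size r0 = m ->
    ext D G true [:: X x, x & r] -> ext D G true [:: X x0, x0 & r0] ->
  conn D G true [:: X x, x & r] [:: X x0, x0 & r0].
Proof.
move=> lx lx0 xx x00 xx0 Xx0x sr sr0 rG r0G.
have [x_pp XxK XxG] := lx; have [x0_pp Xx0K Xx0G] := lx0.
have XX := kk_odd_isotropic lx XxK Xx0K.
have x0x : x0 \notin (G false + <[x]>)%VS.
  apply: contra Xx0x => /memv_addP[g gG [_ /vlineP[c ->] ->]].
  by rewrite linearD linearZ memv_add ?op_even ?memvZ ?memv_line.
(* An even isotropic space of dimension [\dim (G false) + 2] forces [m >= 2], so that the four
   vectors of [conn_pair] fit. *)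
have := room_pair invG x_pp (lift_notin lx) xx x0_pp x00 xx0 x0x.
have [dG _] := dim_odd.
case mE: m => [|[|m1]] /=; try by move: dG; rewrite mE /=; clear; lia.
have [[ok1 [ok2 [ok3 [ok4 _]]]] _ _] :=
  conn_pair (r := [::]) invG x_pp x0_pp xx x00 xx0 XxK Xx0K XX XxG Xx0x I.
have st2 := state_upd (state_upd stG ok1) ok2; rewrite mE in st2.
have [s sG ss] := exists_ext (state_upd (state_upd st2 ok3) ok4) => _.
have [e1 e2 c] := conn_pair invG x_pp x0_pp xx x00 xx0 XxK Xx0K XX XxG Xx0x sG.
have ss' : size [:: X x - X x0, x - x0 & s] = m by rewrite /= ss mE.
apply: conn_trans (conn_tail sr ss' rG e1) _.
by apply: conn_trans c _; apply: conn_tail.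
Qed.

(** Even part of the kernel of the square of the induced operator. It contains [k] and every
    lift. *)
Let Q : {vspace V} := (pp D false (G false) :&: X @^-1: kk D G true)%VS.

(** The operator maps [Q] modulo G onto the plane of the odd kernel, with the line of [k] as kernel:
    1 + 2 = 3. *)
Lemma dim_Q x : lift x -> \dim Q = (\dim (G false)).+3.
Proof.
move=> lx; have := dim_preimage X (pp D false (G false)) (kk D G true).
have := dim_preimage X (pp D false (G false)) (G true).
have -> : (X @: pp D false (G false) + kk D G true =
           X @: pp D false (G false) + G true)%VS.
  apply/eqP; rewrite eqEsubv !subv_add !addvSl /=; apply/andP; split; last first.
    by rewrite (subv_trans (kk_sub _ invG)) ?addvSr.
  apply/subvP => y yK; have [w w_pp Xwy] := exists_lift lx yK.
  by rewrite -[y](subKr (X w)) memv_add ?memv_img // memvN.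
rewrite -/Q -[(_ :&: _)%VS]/(kk D G false) kkE dim_add_line // dim_kk_odd; lia.
Qed.

Lemma Q_memP w : reflect (w \in pp D false (G false) /\ X w \in kk D G true)
  (w \in Q).
Proof.
by apply: (iffP memv_capP) => -[w_pp]; rewrite -memv_preim.
Qed.

Lemma Q_span w x x0 a : lift w -> x \in Q -> x0 \in Q -> a \in Q ->
    x \notin G false -> x0 \notin (G false + <[x]>)%VS ->
    a \notin (G false + <[x]> + <[x0]>)%VS ->
  Q = (G false + <[x]> + <[x0]> + <[a]>)%VS.
Proof.
move=> lw xQ x0Q aQ xG x0G aG; apply/eqP.
rewrite eq_sym eqEdim (dim_Q lw) !dim_add_line // leqnn andbT.
rewrite !subv_add -!memvE xQ x0Q aQ !andbT; apply/subvP => g gG.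
have [GP Gp _] := invG false; apply/Q_memP; split.
  by rewrite memv_cap (subvP GP) // (subvP Gp).
by rewrite (subvP (kk_sub _ invG)) // op_even.
Qed.

Lemma lift_Q x : lift x -> x \in Q.
Proof. by case=> x_pp XxK _; apply/Q_memP. Qed.

Lemma k_Q : k \in Q.
Proof. by apply/Q_memP; split=> //; rewrite (subvP (kk_sub _ invG)). Qed.

Lemma Q_even x : x \in Q -> x \in P false.
Proof. by case/memv_capP => /memv_capP[]. Qed.

Lemma op_notin_line x a : x \in Q -> a \in Q ->
  a \notin (G false + <[x]> + <[k]>)%VS -> X a \notin (G true + <[X x]>)%VS.
Proof.
move=> /Q_memP[x_pp _] /Q_memP[a_pp _]; apply: contra.
case/memv_addP => g gG [_ /vlineP[c ->] XaE].
have : a - c *: x \in kk D G false.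
  rewrite memv_cap; apply/andP; split; first by rewrite memvB ?memvZ.
  by rewrite -memv_preim linearB linearZ /= XaE addrK.
rewrite kkE => /memv_addP[g' g'G [w wk aE]].
rewrite -[a](subrK (c *: x)) aE addrAC memv_add // memv_add // memvZ //.
exact: memv_line.
Qed.

(* The square of the operator preserves the orthogonal of Q; since Q / G is
   non-degenerate and contains the kernel of that square in the even part of
   [G^\perp / G], this orthogonal vanishes modulo G. *)
Lemma conic_room w x x0 a : lift w -> x \in Q -> x0 \in Q -> a \in Q ->
    x \notin G false -> x0 \notin (G false + <[x]>)%VS ->
    a \notin (G false + <[x]> + <[x0]>)%VS ->
    b x x = 0 -> b x0 x0 = 0 -> b x x0 != 0 -> b a x = 0 -> b a x0 = 0 ->
    b a a != 0 ->
  m = 1%N.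
Proof.
move=> lw xQ x0Q aQ xG x0G aG xx x00 xx0 ax ax0 aa.
have [GP _ _] := invG false; have QE := Q_span lw xQ x0Q aQ xG x0G aG.
have xP := Q_even xQ; have x0P := Q_even x0Q; have aP := Q_even aQ.
set B := (G false + <[x]> + <[x0]> + <[a]>)%VS in QE.
have BP : (B <= P false)%VS by rewrite !subv_add GP -!memvE xP x0P aP.
(* As dim B = dim [G false] + 3, the inclusion gives 2 n - 2 <= 2 dim [G false]. With 2 dim
   [G false] + m + 1 = 2 n this means m <= 1, and m is odd. *)
suff S_sub : (pp D false B <= G false)%VS.
  have := dimvS S_sub; have := dim_pp BP; rewrite !dim_add_line // dim_part /=.
  have [dG _] := dim_odd; clear -dG stG; lia.
apply/subvP => v; have [j] := op_nil D v; elim/ltn_ind: j v => j IH v vj vB.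
have [vP vp] := memv_capP vB.
have v_pp : v \in pp D false (G false).
  rewrite memv_cap vP; apply/perpP => g gG; move/perpP: vp; apply.
  by do 3!apply: (subvP (addvSl _ _)).
have XXG : X (X v) \in G false.
  case: j IH vj => [|[|j]] IH vj; first by rewrite [v]vj !linear0 mem0v.
    by rewrite [X v]vj linear0 mem0v.
  apply: (IH j) => //; first by rewrite -!iterSr.
  have Xv_pp := op_pp invG v_pp; have XXv_pp := op_pp invG Xv_pp.
  have [XXP /perpP XXp] := memv_capP XXv_pp.
  rewrite memv_cap XXP; apply/perpP => w1; rewrite -QE => /Q_memP[w1_pp Xw1K].
  have [w1P _] := memv_capP w1_pp; have [XvP _] := memv_capP Xv_pp.
  have [Xw1P _ XXw1] := kkP _ _ _ _ Xw1K.
  apply/eqP; rewrite (op_adj0 XvP) // (op_adj0 vP) //.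
  by have [_ /perpP h] := memv_capP v_pp; rewrite h.
have : v \in Q.
  apply/Q_memP; split=> //; have [XvP Xvp] := memv_capP (op_pp invG v_pp).
  by apply/kkP; split.
have vx : b v x = 0.
  by move/perpP: vp; apply; do 2!apply: (subvP (addvSl _ _)); exact: mem_add_line.
have vx0 : b v x0 = 0.
  by move/perpP: vp; apply; apply: (subvP (addvSl _ _)); exact: mem_add_line.
have va : b v a = 0 by move/perpP: vp; apply; exact: mem_add_line.
rewrite QE => /memv_addP[_ /memv_addP[_ /memv_addP[g gG
  [_ /vlineP[cx ->] ->]] [_ /vlineP[c0 ->] ->]] [_ /vlineP[ca ->] vE]].
have g0 z : z \in Q -> b g z = 0.
  case/Q_memP => /memv_capP[zP /perpP zp] _.
  by apply/eqP; rewrite (form0C zP) ?zp // (subvP GP).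
move: vx vx0 va; rewrite vE !formE !g0 // xx x00 ax ax0 (formC0 xP x0P).
rewrite (formC0 aP xP) (formC0 aP x0P) ax ax0 !(mulr0, addr0, add0r).
move=> /eqP; rewrite mulf_eq0 (negPf xx0) orbF => /eqP ->.
move=> /eqP; rewrite mulf_eq0 (negPf xx0) orbF => /eqP ->.
move=> /eqP; rewrite mulf_eq0 (negPf aa) orbF => /eqP ->.
by rewrite !scale0r !addr0.
Qed.

(** The conic through x and z whose tangents there meet at a. For a orthogonal to the isotropic
    vectors x and z, it is isotropic as soon as b a a + 2 b x z = 0. *)
Definition conic x a z (t : K) : V :=
  (1 - t) ^+ 2 *: x + (t * (1 - t)) *: a + t ^+ 2 *: z.

Lemma conic0 x a z : conic x a z 0 = x.
Proof. by rewrite /conic subr0 expr1n mul0r expr0n !scale0r scale1r !addr0. Qed.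

Lemma conic1 x a z : conic x a z 1 = z.
Proof.
by rewrite /conic subrr mulr0 expr0n !scale0r expr1n scale1r !add0r.
Qed.

Lemma op_conic x a z t : X (conic x a z t) = conic (X x) (X a) (X z) t.
Proof. by rewrite /conic !linearD !linearZ. Qed.

Lemma conic_isotropic x a z t :
    x \in P false -> a \in P false -> z \in P false ->
    b x x = 0 -> b z z = 0 -> b a x = 0 -> b a z = 0 ->
    b a a + 2 * b x z = 0 ->
  b (conic x a z t) (conic x a z t) = 0.
Proof.
move=> xP aP zP xx zz ax az qE; rewrite /conic !formE xx zz ax az.
rewrite (formC0 aP xP) (formC0 aP zP) (formC0 xP zP) ax az.
rewrite !(mulr0, addr0, add0r) -[RHS](mulr0 ((t * (1 - t)) ^+ 2)) -qE; ring.
Qed.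

(** As X z lies in G, the image of the moving point is (1 - t) f t modulo G. Taking [f t] itself for
    the odd step keeps that step non-zero up to t = 1, where the even vector reaches the kernel. *)
Lemma conn_conic_kernel x a z : lift x -> a \in Q -> z \in kk D G false ->
    X a \notin (G true + <[X x]>)%VS ->
    b x x = 0 -> b z z = 0 -> b a x = 0 -> b a z = 0 ->
    b a a + 2 * b x z = 0 -> b x z != 0 ->
  let y := X x - X a in
  [/\ ext D G true [:: X x; x; y], ext D G true [:: X a; z; y]
    & conn D G true [:: X x; x; y] [:: X a; z; y]].
Proof.
move=> lx aQ zK Xax xx zz ax az qE xz y.
have [x_pp XxK XxG] := lx; have [a_pp XaK] := Q_memP _ aQ.
have [zP zp Xz] := kkP _ _ _ _ zK.
have [xP xp] := memv_capP x_pp; have [aP ap] := memv_capP a_pp.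
pose f (t : K) : V := (1 - t) *: X x + t *: X a.
have spanE t : (G true + <[f t]> + <[y]> = G true + <[X x]> + <[X a]>)%VS.
  by rewrite -(span2 (G true) (X x) (X a) (det_line t)) scale1r scaleN1r.
have free t : f t \notin G true /\ y \notin (G true + <[f t]>)%VS.
  by apply: span2_free; rewrite spanE dim_span2.
have fK t : f t \in kk D G true by rewrite memvD ?memvZ.
have yK : y \in kk D G true by rewrite memvB.
pose g t := [:: f t; conic x a z t; y].
have extg t : ext D G true (g t).
  have [fG yG] := free t; apply: ext3 => //.
  - exact: ok_odd.
  - by rewrite memv_cap !memvD ?memvZ.
  - apply/negP => cG.
    have cz : b (conic x a z t) z = 0.
      have [GP _ _] := invG false.
      by apply/eqP; rewrite (form0C zP) ?(subvP GP) //; move/perpP: zp => ->.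
    move/eqP: cz; rewrite !formE az zz !mulr0 !addr0 mulf_eq0 (negPf xz) orbF.
    rewrite expf_eq0 /= subr_eq0 => /eqP t1; case/eqP: xz.
    by move/perpP: xp; apply; rewrite -(conic1 x a z) t1.
  - exact: conic_isotropic.
  - have -> : X (conic x a z t) = t ^+ 2 *: X z + (1 - t) *: f t.
      rewrite op_conic /conic /f [(1 - t) *: (_ + _)]scalerDr !scalerA -expr2.
      by rewrite [(1 - t) * t]mulrC addrC.
    by rewrite memv_add ?memvZ ?memv_line.
  - by rewrite form_alt // (subvP (kk_part _ _ _) _ yK).
  - exact: kk_odd_isotropic lx _ _.
have f0 : f 0 = X x by rewrite /f subr0 scale1r scale0r addr0.
have f1 : f 1 = X a by rewrite /f subrr scale1r scale0r add0r.
have := extg 0; have := extg 1; rewrite /g f0 f1 conic0 conic1; split=> //.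
suff : conn D G true (g 0) (g 1) by rewrite /g f0 f1 conic0 conic1.
apply: (@conn_curve _ _ _ _ _ _ _ 1); rewrite ?hornerC ?oner_neq0 //.
apply: polycurve_cons; first exact: polyfun_line.
by apply: polycurve_cons; [exact: polyfun_conic|exact: polycurve_const].
Qed.

(** The odd step is now the image of the moving point and may degenerate for some t. The list is
    admissible when this image stays outside G + <y>, which the polynomial [d] detects. *)
Lemma conn_conic x a z y : lift x -> lift z -> a \in Q ->
    b x x = 0 -> b z z = 0 -> b a x = 0 -> b a z = 0 ->
    b a a + 2 * b x z = 0 ->
    y \in kk D G true -> y \notin (G true + <[X x]>)%VS ->
    y \notin (G true + <[X z]>)%VS ->
  [/\ ext D G true [:: X x; x; y], ext D G true [:: X z; z; y]
    & conn D G true [:: X x; x; y] [:: X z; z; y]].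
Proof.
move=> lx lz aQ xx zz ax az qE yK yx yz.
have [x_pp XxK XxG] := lx; have [a_pp XaK] := Q_memP _ aQ.
have [z_pp XzK XzG] := lz.
have [xP _] := memv_capP x_pp; have [aP _] := memv_capP a_pp.
have [zP _] := memv_capP z_pp.
have [GP _ _] := invG true; have [yP _ _] := kkP _ _ _ _ yK.
have [XxP _ _] := kkP _ _ _ _ XxK.
set B := (G true + <[y]>)%VS.
have BP : (B <= P true)%VS by rewrite subv_add GP -memvE.
have XxB : X x \notin B by apply: notin_exchange.
(* [s] is orthogonal to G and y but not to X x; hence not to X z either, as X x lies in the span of
   G, X z and y. *)
have [s sB Xxs] : exists2 s, s \in pp D true B & b (X x) s != 0.
  apply: contrapT => h; case/negP: XxB; rewrite -(ppK BP) memv_cap XxP.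
  apply/perpP => s sB; apply: contrapT => /eqP Xxs; apply: h; by exists s.
have [sP /perpP sB0] := memv_capP sB.
have Bs w : w \in B -> b w s = 0.
  by move=> wB; apply/eqP; rewrite (form0C sP) ?sB0 // (subvP BP).
have Xzs : b (X z) s != 0.
  apply: contraNneq Xxs => Xzs0; move: XxK; rewrite (kk_odd_span lz yK yz).
  case/memv_addP => _ /memv_addP[g gG [_ /vlineP[c ->] ->]] [_ /vlineP[d ->] ->].
  by rewrite !formE Xzs0 !Bs ?mem_add_line ?(subvP (addvSl _ _)) // !mulr0 !addr0.
pose d : {poly K} := b (X x) s *: (1 - 'X) ^+ 2 + b (X a) s *: ('X * (1 - 'X)) +
  b (X z) s *: 'X ^+ 2.
have dE t : d.[t] = b (X (conic x a z t)) s.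
  rewrite op_conic /d /conic !formE.
  rewrite !(hornerD, hornerZ, hornerM, horner_exp, hornerN, hornerX, hornerC).
  by ring.
pose g t := [:: X (conic x a z t); conic x a z t; y].
have cK t : X (conic x a z t) \in kk D G true.
  by rewrite op_conic !memvD ?memvZ.
have extg t : d.[t] != 0 -> ext D G true (g t).
  rewrite dE => ds.
  have XcB : X (conic x a z t) \notin B by apply: contra ds => /Bs ->.
  have yG : y \notin G true by apply: contra yx => yG; rewrite (subvP (addvSl _ _)).
  have XcG : X (conic x a z t) \notin G true.
    by apply: contra XcB => h; rewrite (subvP (addvSl _ _)).
  apply: ext3 => //.
  - exact: ok_odd.
  - by rewrite !memvD ?memvZ.
  - by apply: contra XcG; exact: op_even.
  - exact: conic_isotropic.
  - exact: mem_add_line.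
  - exact: notin_exchange.
  - by rewrite form_alt.
  - exact: kk_odd_isotropic lx _ _.
have g0 : g 0 = [:: X x; x; y] by rewrite /g conic0.
have g1 : g 1 = [:: X z; z; y] by rewrite /g conic1.
have d0 : d.[0] != 0 by rewrite dE conic0.
have d1 : d.[1] != 0 by rewrite dE conic1.
rewrite -g0 -g1; split; [exact: extg|exact: extg|].
apply: (@conn_curve _ _ _ _ _ _ _ d) => //.
apply: polycurve_cons; first exact/polyfun_comp/polyfun_conic.
by apply: polycurve_cons; [exact: polyfun_conic|exact: polycurve_const].
Qed.

Lemma lift_ok x : lift x -> b x x = 0 ->
  ok D G true (X x) /\ ok D (upd G true (X x)) false x.
Proof.
move=> lx xx; have [x_pp XxK XxG] := lx; split; first exact: ok_odd.
have [xP xp] := memv_capP x_pp.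
split; rewrite /upd //=; last exact: lift_notin lx.
by apply/kkP; split; rewrite //= mem_add_line.
Qed.

Lemma exists_ext_lift x : lift x -> b x x = 0 ->
  exists2 r, ext D G true [:: X x, x & r] & size r = m.
Proof.
move=> lx xx; have [ok1 ok2] := lift_ok lx xx.
by have [r rG sr] := exists_ext (state_upd (state_upd stG ok1) ok2); exists r.
Qed.

Lemma exists_third_Q x x0 : lift x -> x0 \in Q ->
    b x x = 0 -> b x0 x0 = 0 -> b x x0 != 0 ->
  exists a, [/\ a \in Q, b a x = 0, b a x0 = 0
              & a \notin (G false + <[x]> + <[x0]>)%VS].
Proof.
move=> lx x0Q xx x00 xx0.
have [|a0 a0Q a0G] :=
    @exists_notin _ _ Q (G false + <[x]> + <[x0]>)%VS.
  rewrite (dim_Q lx) ltnS (leq_trans (dim_add_line_le _ _)) // ltnS.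
  exact: dim_add_line_le.
have QP : (Q <= P false)%VS by apply/subvP => w; exact: Q_even.
exact: exists_third QP (lift_Q lx) x0Q a0Q a0G xx x00 xx0.
Qed.

Lemma kk_even_isotropic w : b k k != 0 -> w \in kk D G false -> b w w = 0 ->
  w \in G false.
Proof.
move=> bkk wK ww; move: wK ww; rewrite kkE => /memv_addP[g gG [_ /vlineP[c ->] ->]].
have [GP Gp _] := invG false.
have [kP /perpP kp] := memv_capP k_pp.
have gg : b g g = 0 by have /perpP := subvP Gp _ gG; apply.
have gk : b g k = 0 by apply/eqP; rewrite (form0C kP) ?kp // (subvP GP).
rewrite !formE gg gk kp // !(mulr0, add0r) => /eqP.
rewrite mulrA mulf_eq0 (negPf bkk) orbF -expr2 expf_eq0 /= => /eqP ->.
by rewrite scale0r addr0.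
Qed.

(** If X x0 is a multiple of X x modulo G, a combination of x and x0 is an isotropic kernel vector,
    hence lies in G because [k] is anisotropic: both lists begin with the same partial flag. *)
Lemma conn_lift_perp x x0 r r0 : b k k != 0 -> lift x -> lift x0 ->
    b x x = 0 -> b x0 x0 = 0 -> b x x0 = 0 -> size r = m -> size r0 = m ->
    ext D G true [:: X x, x & r] -> ext D G true [:: X x0, x0 & r0] ->
  conn D G true [:: X x, x & r] [:: X x0, x0 & r0].
Proof.
move=> bkk lx lx0 xx x00 xx0 sr sr0 rG r0G.
have [Xx0x|Xx0x] := boolP (X x0 \in (G true + <[X x]>)%VS); last first.
  exact: conn_lift.
apply: conn_tail_flag => //.
have [x_pp _ _] := lx; have [x0_pp _ _] := lx0.
have [xP _] := memv_capP x_pp; have [x0P _] := memv_capP x0_pp.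
case/memv_addP: Xx0x => g gG [_ /vlineP[c ->] Xx0E].
have wK : x0 - c *: x \in kk D G false.
  rewrite memv_cap; apply/andP; split; first by rewrite memvB ?memvZ.
  by rewrite -memv_preim linearB linearZ /= Xx0E addrK.
rewrite -[x0](subrK (c *: x)) memv_add ?memvZ ?memv_line //.
apply: kk_even_isotropic => //.
by rewrite !formE (formC0 xP x0P) x00 xx xx0 !(mulr0, oppr0, addr0).
Qed.

(** A plane is not the union of two lines. *)
Lemma exists_off_lines x z : lift x -> lift z -> exists y,
  [/\ y \in kk D G true, y \notin (G true + <[X x]>)%VS
    & y \notin (G true + <[X z]>)%VS].
Proof.
move=> lx lz; have [_ _ XxG] := lx; have [_ _ XzG] := lz.
have [|y yK yx] := @exists_notin _ _ (kk D G true) (G true + <[X x]>)%VS.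
  by rewrite dim_kk_odd dim_add_line.
have [|w wK wz] := @exists_notin _ _ (kk D G true) (G true + <[X z]>)%VS.
  by rewrite dim_kk_odd dim_add_line.
have [yz|yz] := boolP (y \in (G true + <[X z]>)%VS); last by exists y.
have [wx|wx] := boolP (w \in (G true + <[X x]>)%VS); last by exists w.
exists (y + w); split; first exact: memvD.
  by apply: contra yx => h; rewrite -[y](addrK w) memvB.
by apply: contra wz => h; rewrite -[w](addKr y) addrC memvB.
Qed.

(** For non-orthogonal x and x0, take [a] in [Q] orthogonal to both. If [a] is isotropic, it is an
    intermediate lift. If not, [conic_room] leaves just three missing vectors, and x moves to a
    multiple of x0 along a conic. *)
Lemma conn_lift_nonisotropic x x0 r r0 : b k k != 0 -> lift x -> lift x0 ->
    b x x = 0 -> b x0 x0 = 0 -> size r = m -> size r0 = m ->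
    ext D G true [:: X x, x & r] -> ext D G true [:: X x0, x0 & r0] ->
  conn D G true [:: X x, x & r] [:: X x0, x0 & r0].
Proof.
move=> bkk lx lx0 xx x00 sr sr0 rG r0G.
have [xx0|xx0] := eqVneq (b x x0) 0; first exact: conn_lift_perp.
have xQ := lift_Q lx; have x0Q := lift_Q lx0.
have [a [aQ ax ax0 aG]] := exists_third_Q lx x0Q xx x00 xx0.
have aP := Q_even aQ; have xP := Q_even xQ; have x0P := Q_even x0Q.
have [a_pp XaK] := Q_memP _ aQ.
have [aa|aa] := eqVneq (b a a) 0.
  have la : lift a.
    split=> //; apply: contra aG => XaG.
    do 2!apply: (subvP (addvSl _ _)); apply: kk_even_isotropic => //.
    by rewrite memv_cap a_pp -memv_preim.
  have [s sG ss] := exists_ext_lift la aa.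
  apply: (@conn_trans _ _ _ _ _ _ _ [:: X a, a & s]).
    by apply: conn_lift_perp => //; rewrite (formC0 aP xP).
  exact: conn_lift_perp.
have xG := lift_notin lx.
have x0x : x0 \notin (G false + <[x]>)%VS.
  apply/negP => /memv_addP[g gG [_ /vlineP[c ->] x0E]]; case/eqP: xx0.
  have [_ /perpP xp] : x \in P false /\ x \in perp b (G false).
    by have [x_pp _ _] := lx; case/memv_capP: x_pp.
  by rewrite x0E !formE xx xp // mulr0 addr0.
have m1 := conic_room lx xQ x0Q aQ xG x0x aG xx x00 xx0 ax ax0 aa.
(* Chosen so that b a a + 2 b x (c x0) = 0, the condition for the conic to be isotropic. *)
pose c : K := - (b a a / (2 * b x x0)).
have c0 : c != 0 by rewrite oppr_eq0 mulf_neq0 ?invr_eq0 ?mulf_neq0 ?pnatr_eq0.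
have [x0_pp Xx0K Xx0G] := lx0.
have lz : lift (c *: x0).
  split; [exact: memvZ|by rewrite linearZ memvZ|].
  by rewrite linearZ; apply: contra Xx0G => h; rewrite -[X x0](scalerK c0) memvZ.
have [y [yK yx yz]] := exists_off_lines lx lz.
have [e1 e2 cc] : [/\ ext D G true [:: X x; x; y],
    ext D G true [:: X (c *: x0); c *: x0; y] &
    conn D G true [:: X x; x; y] [:: X (c *: x0); c *: x0; y]].
  apply: (@conn_conic x a (c *: x0) y) => //.
  - by rewrite !formE x00 !mulr0.
  - by rewrite formE ax0 mulr0.
  - by rewrite formE /c; field; rewrite xx0.
apply: (@conn_trans _ _ _ _ _ _ _ [:: X x; x; y]).
  by apply: conn_tail.
apply: conn_trans cc _; apply: conn_tail_flag => //.
  rewrite linearZ /= -[X in X \in _](scalerK c0) memvZ //; exact: mem_add_line.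
rewrite -[X in X \in _](scalerK c0) memvZ //; exact: mem_add_line.
Qed.

(** The same alternative on [a] as between two lifts, but the target [k] has its image in G, so the
    odd vector placed before it is X a. *)
Lemma conn_to_kernel x r : b k k = 0 -> lift x -> b x x = 0 -> b x k != 0 ->
    size r = m -> ext D G true [:: X x, x & r] ->
  exists y r', [/\ size r' = m, ext D G true [:: y, k & r']
    & conn D G true [:: X x, x & r] [:: y, k & r']].
Proof.
move=> bkk lx xx xk sr rG.
have [a [aQ ax ak aG]] := exists_third_Q lx k_Q xx bkk xk.
have Xax := op_notin_line (lift_Q lx) aQ aG.
have xQ := lift_Q lx; have aP := Q_even aQ; have xP := Q_even xQ.
have [a_pp XaK] := Q_memP _ aQ; have [x_pp XxK XxG] := lx.
have okk : ok D G false k by split=> //; rewrite kkE mem_add_line.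
have XaG : X a \notin G true.
  by apply: contra Xax => h; rewrite (subvP (addvSl _ _)).
have [aa|aa] := eqVneq (b a a) 0.
  have la : lift a by [].
  have [s sG ss] := exists_ext_lift la aa.
  have [okXa oka] := lift_ok la aa.
  have okk' := ok_upd (e := true) (X a) okk.
  have [s' s'G ss'] := exists_ext (state_upd (state_upd stG okXa) okk').
  exists (X a), s'; split=> //.
  apply: (@conn_trans _ _ _ _ _ _ _ [:: X a, a & s]).
    by apply: conn_lift => //; rewrite (formC0 aP xP).
  (* After X a the kernel contains the totally isotropic plane of [k] and [a], so the next even step
     is not obstructed. *)
  apply: conn_cons => //; apply: IHA => //=; rewrite ?ss ?ss' //; last by case: sG.
  apply: (@not_bad_isotropic _ a k) => //.
  - by case: okk.
  - exact: lift_notin_kk.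
  - exact: mem_add_line.
have kx : k \notin (G false + <[x]>)%VS.
  apply/negP => /memv_addP[g gG [_ /vlineP[c ->] kE]]; case/eqP: xk.
  have [_ /perpP xp] := memv_capP x_pp.
  by rewrite kE !formE xx xp // mulr0 addr0.
have m1 := conic_room lx xQ k_Q aQ (lift_notin lx) kx aG xx bkk xk ax ak aa.
pose c : K := - (b a a / (2 * b x k)).
have c0 : c != 0 by rewrite oppr_eq0 mulf_neq0 ?invr_eq0 ?mulf_neq0 ?pnatr_eq0.
have [e1 e2 cc] : [/\ ext D G true [:: X x; x; X x - X a],
    ext D G true [:: X a; c *: k; X x - X a] &
    conn D G true [:: X x; x; X x - X a] [:: X a; c *: k; X x - X a]].
  apply: (@conn_conic_kernel x a (c *: k)) => //.
  - by rewrite memvZ // kkE mem_add_line.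
  - by rewrite !formE bkk !mulr0.
  - by rewrite formE ak mulr0.
  - by rewrite formE /c; field; rewrite xk.
  - by rewrite formE mulf_neq0.
have okk' := ok_upd (e := true) (X a) okk.
have okXa : ok D G true (X a) by case: e2.
have [s sG ss] := exists_ext (state_upd (state_upd stG okXa) okk').
exists (X a), s; split=> //.
apply: (@conn_trans _ _ _ _ _ _ _ [:: X x; x; X x - X a]).
  by apply: conn_tail.
apply: conn_trans cc _; apply: conn_tail_flag => //.
  exact: mem_add_line.
rewrite -[X in X \in _](scalerK c0) memvZ //; exact: mem_add_line.
Qed.

End LineKernel.

(** As x enters the kernel only after y, its image spans the line of y modulo G and can replace
    y. *)
Lemma lift_head y x r : ext D G true [:: y, x & r] -> x \notin kk D G false ->
  [/\ lift x, ext D G true [:: X x, x & r]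
    & conn D G true [:: y, x & r] [:: X x, x & r]].
Proof.
move=> yG xK; have [oky [okx rG]] := yG; have [xU xG xx] := okx.
have [xP xp Xx] := kkP _ _ _ _ xU.
have x_pp : x \in pp D false (G false) by rewrite memv_cap xP.
have XxG : X x \notin G true.
  by apply: contra xK => XxG; rewrite memv_cap x_pp -memv_preim.
have lx : lift x by split=> //; rewrite (subvP (ok_sub_kk invG oky)).
have [okXx _] := lift_ok lx xx.
have XxE : (G true + <[y]> = G true + <[X x]>)%VS by rewrite (add_line_eq Xx).
split=> //; last by apply: conn_flag => //; split.
by split=> //; rewrite -(upd_eq XxE).
Qed.

Lemma hyperbolic_radical x x0 z : b x x = 0 -> b x0 x0 = 0 -> b x x0 != 0 ->
    x \in pp D false (G false) -> x0 \in pp D false (G false) ->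
    z \in (G false + <[x]> + <[x0]>)%VS -> b z x = 0 -> b z x0 = 0 ->
  z \in G false.
Proof.
move=> xx x00 xx0 /memv_capP[xP /perpP xp] /memv_capP[x0P /perpP x0p].
have [GP _ _] := invG false.
case/memv_addP => _ /memv_addP[g gG [_ /vlineP[c ->] ->]] [_ /vlineP[d ->] ->].
have gx : b g x = 0 by apply/eqP; rewrite (form0C xP) ?xp // (subvP GP).
have gx0 : b g x0 = 0 by apply/eqP; rewrite (form0C x0P) ?x0p // (subvP GP).
rewrite !formE gx gx0 xx x00 (formC0 xP x0P) !(mulr0, add0r, addr0).
move/eqP; rewrite mulf_eq0 (negPf xx0) orbF => /eqP ->.
move/eqP; rewrite mulf_eq0 (negPf xx0) orbF => /eqP ->.
by rewrite !scale0r !addr0.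
Qed.

(* Choosing the odd vector [y] in the image of the induced operator enlarges the
   kernel of the next step, which is then not a plane. *)
Lemma exists_not_bad x x0 : ok D G false x -> ok D G false x0 ->
    b x x0 != 0 -> kk D G false = (G false + <[x]> + <[x0]>)%VS ->
  exists2 y, ok D G true y & ~ bad D (upd G true y).
Proof.
move=> [xK xG xx] [x0K _ x00] xx0 KE.
have [x_pp _] := memv_capP xK; have [x0_pp _] := memv_capP x0K.
have [xP _] := memv_capP x_pp; have [x0P _] := memv_capP x0_pp.
have [GP _ _] := invG false; have [dG _] := dim_odd.
have radical := hyperbolic_radical xx x00 xx0 x_pp x0_pp.
have x0x : x0 \notin (G false + <[x]>)%VS.
  apply/negP => /memv_addP[g gG [_ /vlineP[c ->] x0E]]; case/eqP: xx0.
  have [_ /perpP xp] := memv_capP x_pp.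
  by rewrite x0E !formE xx xp // mulr0 addr0.
set B := (G false + <[x]> + <[x0]>)%VS in KE.
have BP : (B <= P false)%VS by rewrite !subv_add GP -!memvE xP x0P.
(* 2 dim [G false] + m + 1 = 2 n makes m odd, hence positive; this leaves a vector outside G
   orthogonal to the plane. *)
have [|w wB wG] := @exists_notin _ _ (pp D false B) (G false).
  have := dim_pp BP; rewrite dim_span2 // dim_part /=; clear -dG; lia.
have [wP /perpP wp] := memv_capP wB.
have w_pp : w \in pp D false (G false).
  rewrite memv_cap wP; apply/perpP => g gG; apply: wp.
  by do 2!apply: (subvP (addvSl _ _)).
(* An even vector found here would lie in the kernel plane and be orthogonal to it, hence be in G;
   only an odd image remains. *)
have [wK|[d [w' [w'_pp XwK XwG]]]] := kk_or_image invG w_pp wG.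
  case/negP: wG; rewrite KE in wK; apply: radical => //; apply: wp.
    by apply: (subvP (addvSl _ _)); exact: mem_add_line.
  exact: mem_add_line.
case: d w'_pp XwK XwG => w'_pp XwK XwG; last first.
  case/negP: XwG; apply: radical; first by rewrite -/B -KE.
    exact: op_perp_kk xK.
  exact: op_perp_kk x0K.
have okXw := ok_odd XwK XwG; exists (X w') => // /bad_dim.
have w'K : w' \notin kk D G false.
  by apply: contra XwG => /kkP[_ _].
have : (B + <[w']> <= kk D (upd G true (X w')) false)%VS.
  have mem z : z \in kk D G false -> z \in kk D (upd G true (X w')) false.
    case/kkP => zP zp Xz; apply/kkP; split=> //.
    exact: (subvP (upd_sub _ _ _ _)).
  rewrite subv_add -KE -memvE; apply/andP; split; first by apply/subvP.
  by apply: kk_upd_odd => //; exact: mem_add_line.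
move/dimvS; rewrite dim_add_line -?KE // KE dim_span2 // => d1 d2.
by move: d1; rewrite d2 /upd /= ltnn.
Qed.

(** Brings the even step to a fixed isotropic kernel vector, after which [conn_star] takes over.
    This is immediate unless the step after y is obstructed; then y has to move as well. *)
Lemma conn_to_star xs y x r : ok D G false xs -> size r = m ->
    ext D G true [:: y, x & r] ->
  exists y' r', [/\ size r' = m, ext D G true [:: y', xs & r']
    & conn D G true [:: y, x & r] [:: y', xs & r']].
Proof.
move=> okxs sr yG; have [oky [okx rG]] := yG.
have star z : ok D G true z ->
    exists2 s, ext D G true [:: z, xs & s] & size s = m.
  move=> okz; have okxs' := ok_upd (e := true) z okxs.
  have [s sG ss] := exists_ext (state_upd (state_upd stG okz) okxs').
  by exists s.
have [s sG ss] := star _ oky.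
have [badU|nbad] := pselect (bad D (upd G true y)); last first.
  exists y, s; split=> //; apply: conn_cons => //.
  by apply: IHA => //=; [rewrite sr|rewrite ss|case: sG].
have [xxs|xxs] := boolP (x \in (G false + <[xs]>)%VS).
  exists y, s; split=> //; apply: conn_sym.
  by apply: conn_tail_flag => //; exact: mem_add_line.
have [xsK xsG xsxs] := okxs; have [xU xG xx] := okx.
have [xP xp Xx] := kkP _ _ _ _ xU.
have x_pp : x \in pp D false (G false) by rewrite memv_cap xP.
have xsP := ok_part okxs.
have xxs0 : b x xs != 0.
  by apply/eqP => h; apply: (not_bad_isotropic oky xsK xsG x_pp).
have dU := bad_dim badU; have invU := invariant_upd invG oky.
have dX := dim_span2 xsG xxs.
(* If x is new after y, the kernel at G is strictly smaller than the plane met after y, so it is the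
   line of [xs]; otherwise it is that whole plane, and [exists_not_bad] provides a better odd
   vector. *)
have [xK|xK] := boolP (x \in kk D G false); last first.
  have sub : (kk D G false <= kk D (upd G true y) false)%VS.
    apply/subvP => z /kkP[zP zp Xz]; apply/kkP; split=> //.
    exact: (subvP (upd_sub _ _ _ _)).
  have kkE : kk D G false = (G false + <[xs]>)%VS.
    apply/eqP; rewrite eq_sym eqEdim subv_add kk_sub // -memvE xsK.
    rewrite dim_add_line // -ltnS.
    suff : (\dim (kk D G false) < \dim (kk D (upd G true y) false))%N.
      by rewrite dU.
    rewrite ltn_neqAle dimvS // andbT; apply: contra xK => /eqP dE.
    suff -> : kk D G false = kk D (upd G true y) false by [].
    by apply/eqP; rewrite eqEdim sub dE leqnn.
  have [lx XxG c] := lift_head yG xK.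
  have [y' [r' [sr' y'G c']]] := conn_to_kernel kkE xsG xsxs lx xx xxs0 sr XxG.
  by exists y', r'; split=> //; apply: conn_trans c c'.
have okx' : ok D G false x by [].
have kkE : kk D G false = (G false + <[xs]> + <[x]>)%VS.
  apply/eqP; rewrite eq_sym eqEdim !subv_add kk_sub // -!memvE xsK xK dX /=.
  have sub : (kk D G false <= kk D (upd G true y) false)%VS.
    apply/subvP => z /kkP[zP zp Xz]; apply/kkP; split=> //.
    exact: (subvP (upd_sub _ _ _ _)).
  by rewrite (leq_trans (dimvS sub)) // dU.
have xsx : b xs x != 0 by rewrite (formC0 xP xsP).
have [y' oky' nbad] := exists_not_bad okxs okx' xsx kkE.
have [s' s'G ss'] := star _ oky'.
have okx'' := ok_upd (e := true) y' okx'.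
have [t tG st] := exists_ext (state_upd (state_upd stG oky') okx'').
exists y', s'; split=> //.
apply: (@conn_trans _ _ _ _ _ _ _ [:: y', x & t]).
  by apply: conn_star.
apply: conn_cons => //.
by apply: IHA => //=; [rewrite st|rewrite ss'|case: s'G].
Qed.

(** Three cases for the even kernel modulo G: it has an isotropic line, it is zero, or it is an
    anisotropic line. A plane always has an isotropic vector, so there is no other case. *)
Lemma connected_odd : connected_ext D G true m.+2.
Proof.
move=> [|y [|x r]] [|y0 [|x0 r0]] //= [sr] [sr0] yG y0G.
have [[xs okxs]|nxs] := pselect (exists xs, ok D G false xs).
  have [y1 [r1 [sr1 y1G c1]]] := conn_to_star okxs sr yG.
  have [y2 [r2 [sr2 y2G c2]]] := conn_to_star okxs sr0 y0G.
  apply: conn_trans c1 (conn_trans _ (conn_sym c2)).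
  exact: conn_star.
have [oky [okx rG]] := yG; have [oky0 [okx0 r0G]] := y0G.
have aniso v : v \in kk D G false -> v \notin G false -> b v v != 0.
  by move=> vK vG; apply/eqP => vv; apply: nxs; exists v.
have [/eqP kkG|] := boolP (kk D G false == G false).
  have dK : \dim (kk D G true) = (\dim (G true)).+1.
    have [_ dG] := dim_odd; have := dim_kk true invG.
    by rewrite /= kkG !dim_part /=; lia.
  have [yK yG1 _] := oky; have [y0K _ _] := oky0.
  have kkE : kk D G true = (G true + <[y]>)%VS.
    apply/eqP; rewrite eq_sym eqEdim subv_add kk_sub // -memvE yK.
    by rewrite dK dim_add_line /=.
  apply: (@connected_same _ _ _ _ _ _ m.+1) => //=; rewrite ?sr ?sr0 -?kkE //.
  (* Two candidates after y have proportional images modulo G; as the even kernel is zero they are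
     themselves proportional modulo G, hence orthogonal. *)
  apply: IHA => // -[v [v0 [[vK vG vv] [v0K _ _] vv0 _]]].
  case/eqP: vv0.
  have [vP vp /memv_addP[g gG [_ /vlineP[c ->] XvE]]] := kkP _ _ _ _ vK.
  have [v0P v0p /memv_addP[g0 g0G [_ /vlineP[c0 ->] Xv0E]]] := kkP _ _ _ _ v0K.
  have cn0 : c != 0.
    apply: contraNneq vG => c_0; rewrite c_0 scale0r addr0 in XvE.
    by rewrite -[v \in _]/(v \in G false) -kkG; apply/kkP; rewrite XvE.
  have : v0 - (c0 / c) *: v \in G false.
    rewrite -kkG memv_cap; apply/andP; split.
      rewrite memvB ?memvZ //; by rewrite memv_cap ?vP ?v0P.
    rewrite -memv_preim linearB linearZ /= XvE Xv0E scalerDr scalerA divfK //.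
    by rewrite opprD addrACA subrr addr0 memvB ?memvZ.
  move/perpP: vp => /[apply].
  by rewrite !formE vv mulr0 oppr0 addr0.
rewrite eq_sym eqEsubv kk_sub //= => /subvPn[k kK kG].
have kkE : kk D G false = (G false + <[k]>)%VS.
  apply/eqP; rewrite eqEsubv subv_add kk_sub // -memvE kK !andbT.
  apply/negPn/negP => /subvPn[w wK wG].
  have [kP _ _] := kkP _ _ _ _ kK; have [wP _ _] := kkP _ _ _ _ wK.
  have [kk0|[s ss]] := isotropic_in_plane wP kP.
    by move: (aniso _ kK kG); rewrite kk0 eqxx.
  suff : b (w + s *: k) (w + s *: k) != 0 by rewrite ss eqxx.
  apply: aniso; first by rewrite memvD ?memvZ.
  apply: contra wG => h.
  by rewrite -[w](addrK (s *: k)) memv_add // memvN memvZ // memv_line.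
have kk0 := aniso _ kK kG.
have notK z w : ok D (upd G true z) false w -> w \notin kk D G false.
  case=> _ wG ww; apply: contra wG => wK.
  exact: (kk_even_isotropic kkE kk0 wK ww).
have [lx XxG c] := lift_head yG (notK _ _ okx).
have [lx0 Xx0G c0] := lift_head y0G (notK _ _ okx0).
apply: conn_trans c (conn_trans _ (conn_sym c0)).
apply: (conn_lift_nonisotropic kkE) => //; first by case: okx.
by case: okx0.
Qed.

End OddStep.

(** Strong induction on the number of missing vectors, because an odd step uses the statement for
    one and for two vectors fewer. *)
Theorem connected_extensions (K : numClosedFieldType) (V : vectType K) (n : nat)
    (D : odd_nilpotent V n) (G : bool -> {vspace V}) (e : bool) (m : nat) :
  state D G e m -> (e = false -> ~ bad D G) -> connected_ext D G e m.
Proof.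
elim/ltn_ind: m G e => -[|m] IH G [] stG nbad.
- by move=> [|? ?] [|? ?] // _ _ _ _; apply: conn_refl.
- by move=> [|? ?] [|? ?] // _ _ _ _; apply: conn_refl.
- case: m => [|m] in IH stG *; first exact: connected_odd_last.
  apply: connected_odd => // [y oky nb|y x oky okx].
    by apply: IH => //; exact: (state_upd stG oky).
  by apply: IH => //; exact: (state_upd (state_upd stG oky) okx).
- apply: connected_even; [exact: stG|exact: nbad|] => v okv.
  by apply: IH => //; exact: (state_upd stG okv).
Qed.

(** * Flags in the fibre *)

Section OddElement.
Context {K : numClosedFieldType} {V0 V1 : vectType K}.
Variables (phi : bilform K V0) (psi : bilform K V1).
Local Notation V := (V0 * V1)%type.

Definition pfst : 'Hom(V, V0) := linfun (fst : V -> V0).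
Definition psnd : 'Hom(V, V1) := linfun (snd : V -> V1).

Lemma pfstE v : pfst v = v.1. Proof. by rewrite lfunE. Qed.
Lemma psndE v : psnd v = v.2. Proof. by rewrite lfunE. Qed.

Definition sum_form : bilform K V :=
  ((transpose pfst \o phi \o pfst) + (transpose psnd \o psi \o psnd))%VF.

Lemma sum_formE v w : sum_form v w = phi v.1 w.1 + psi v.2 w.2.
Proof.
rewrite /sum_form !(add_lfunE, comp_lfunE) /transpose.
by rewrite !lfunE /= !lfunE.
Qed.

Lemma mem_graded0 v : (v \in @graded_part K V0 V1 false) = (v.2 == 0).
Proof. by rewrite /graded_part memv_ker lfunE. Qed.

Lemma mem_graded1 v : (v \in @graded_part K V0 V1 true) = (v.1 == 0).
Proof. by rewrite /graded_part memv_ker lfunE. Qed.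

Lemma dim_prod : \dim {:V} = (\dim {:V0} + \dim {:V1})%N.
Proof. by rewrite !dimvf. Qed.

Lemma dim_graded0 : \dim (@graded_part K V0 V1 false) = \dim {:V0}.
Proof.
have := limg_ker_dim psnd fullv; rewrite capfv dim_prod.
have -> : limg psnd = fullv.
  apply/eqP; rewrite eqEsubv subvf; apply/subvP => w _.
  by apply/memv_imgP; exists (0, w); rewrite ?memvf // psndE.
exact: addIn.
Qed.

Lemma dim_graded1 : \dim (@graded_part K V0 V1 true) = \dim {:V1}.
Proof.
have := limg_ker_dim pfst fullv; rewrite capfv dim_prod.
have -> : limg pfst = fullv.
  apply/eqP; rewrite eqEsubv subvf; apply/subvP => w _.
  by apply/memv_imgP; exists (w, 0); rewrite ?memvf // pfstE.
by rewrite addnC; exact: addnI.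
Qed.

Lemma odd_eltE u v : odd_elt phi psi u v = (adjoint phi psi u v.2, u v.1).
Proof. by rewrite /odd_elt lfunE. Qed.

Lemma odd_elt_expE u k v :
  odd_elt_exp phi psi u k v = iter k (odd_elt phi psi u) v.
Proof.
elim: k v => [|k IH] v; first by rewrite /odd_elt_exp /= id_lfunE.
by rewrite iterS -IH /odd_elt_exp /= comp_lfunE.
Qed.

Context {n : nat}.
Hypotheses (dimV0 : \dim {:V0} = (2 * n + 1)%N)
  (dimV1 : \dim {:V1} = (2 * n)%N).
Hypotheses (phi_nondeg : nondegenerate_bilform phi)
  (phi_sym : symmetric_bilform phi) (psi_nondeg : nondegenerate_bilform psi)
  (psi_alt : alternating_bilform psi).

Local Notation part := (@graded_part K V0 V1).

Fact graded_cap : (part false :&: part true = 0)%VS.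
Proof.
apply/eqP; rewrite -subv0; apply/subvP => -[x y].
by rewrite memv_cap mem_graded0 mem_graded1 memv0 /= => /andP[/eqP -> /eqP ->].
Qed.

Fact graded_sum : (part false + part true = fullv)%VS.
Proof.
apply/eqP; rewrite eqEsubv subvf; apply/subvP => -[x y] _.
have -> : (x, y) = (x, 0) + (0, y) by congr pair; rewrite /= ?addr0 ?add0r.
by rewrite memv_add // ?mem_graded0 ?mem_graded1.
Qed.

Fact dim_graded e : \dim (part e) = (2 * n + ~~ e)%N.
Proof. by case: e; rewrite ?dim_graded0 ?dim_graded1 ?dimV0 ?dimV1 ?addn0. Qed.

Fact sum_form_nondeg : nondegenerate_bilform sum_form.
Proof.
apply/eqP; rewrite -subv0; apply/subvP => v.
rewrite memv_ker memv0 => /eqP vE; case: v vE => x y vE.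
have h w : sum_form (x, y) w = 0 by rewrite vE lfunE.
apply/eqP; congr pair.
  apply: (nondegenerateP phi_nondeg) => z.
  by have := h (z, 0); rewrite sum_formE /= linear0 addr0.
apply: (nondegenerateP psi_nondeg) => z.
by have := h (0, z); rewrite sum_formE /= linear0 add0r.
Qed.

Fact sum_form_cross e v w :
  v \in part e -> w \in part (~~ e) -> sum_form v w = 0.
Proof.
case: e; rewrite /= ?mem_graded0 ?mem_graded1 => /eqP v0 /eqP w0.
  by rewrite sum_formE v0 w0 form0l form0r addr0.
by rewrite sum_formE v0 w0 form0l form0r addr0.
Qed.

Fact sum_form_sign e v w : v \in part e -> w \in part e ->
  sum_form w v = (-1) ^+ e * sum_form v w.
Proof.
case: e; rewrite /= ?mem_graded0 ?mem_graded1 => /eqP v0 /eqP w0;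
  rewrite !sum_formE v0 w0 !form0l ?addr0 ?add0r ?mul1r ?mulN1r.
  exact: (alternating_skew psi_alt).
exact: phi_sym.
Qed.

Fact sum_form_alt v : v \in part true -> sum_form v v = 0.
Proof. by rewrite mem_graded1 sum_formE => /eqP ->; rewrite form0l psi_alt addr0. Qed.

Fact odd_elt_part u e v : v \in part e -> odd_elt phi psi u v \in part (~~ e).
Proof.
by case: e; rewrite odd_eltE /= ?mem_graded0 ?mem_graded1 => /eqP /= ->;
  rewrite linear0.
Qed.

Fact odd_elt_adj u e v w : v \in part e -> w \in part (~~ e) ->
  sum_form (odd_elt phi psi u v) w =
  (-1) ^+ (~~ e) * sum_form v (odd_elt phi psi u w).
Proof.
case: e; rewrite /= ?mem_graded0 ?mem_graded1 => /eqP v0 /eqP w0.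
  by rewrite !sum_formE !odd_eltE /= v0 w0 form0l !form0r addr0 add0r mul1r adjointE.
rewrite !sum_formE !odd_eltE /= v0 w0 form0l !form0r addr0 add0r mulN1r.
by rewrite (alternating_skew psi_alt) -(@adjointE _ _ _ phi psi) // phi_sym.
Qed.

Fact odd_elt_nil u v : odd_nilcone phi psi u ->
  exists k, iter k (odd_elt phi psi u) v = 0.
Proof. by case=> k uk; exists k; rewrite -odd_elt_expE uk lfunE. Qed.

Definition odd_datum u (u_nil : odd_nilcone phi psi u) : odd_nilpotent V n :=
  OddNilpotent graded_cap graded_sum dim_graded sum_form_nondeg
    sum_form_cross sum_form_sign sum_form_alt (@odd_elt_part u)
    (@odd_elt_adj u) (fun v => odd_elt_nil v u_nil).

End OddElement.

(** * Partial spans of a list *)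

Section Steps.
Context {K : numClosedFieldType} {V : vectType K} {n : nat}.
Variable D : odd_nilpotent V n.
Implicit Types (c p r : seq V).

(** The parity of an index is that of the vector it carries, the list starting with an even vector.
    The default 0 of [nth] adds nothing past the end. *)
Definition steps c (j : nat) : bool -> {vspace V} :=
  fun d => (\sum_(k < j | odd k == d) <[nth 0%R c k]>)%VS.

Lemma steps0 c : steps c 0 = fun=> 0%VS.
Proof. by apply: funext => d; rewrite /steps big_ord0. Qed.

Lemma stepsS c j : steps c j.+1 = upd (steps c j) (odd j) (nth 0 c j).
Proof.
apply: funext => d; rewrite /steps /upd big_mkcond big_ord_recr -big_mkcond /=.
by rewrite [d == _]eq_sym; case: eqP => [->|_] //; rewrite addv0.
Qed.

Lemma steps_cat p r j : (j <= size p)%N -> steps (p ++ r) j = steps p j.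
Proof.
move=> jp; apply: funext => d; apply: eq_bigr => k _.
by rewrite nth_cat (leq_trans (ltn_ord k) jp).
Qed.

Lemma ext_steps c j : ext D (fun=> 0%VS) false c -> (j <= size c)%N ->
  ext D (steps c j) (odd j) (drop j c).
Proof.
move=> c0; elim: j => [|j IH] jc; first by rewrite steps0 drop0.
have := IH (ltnW jc); rewrite (drop_nth 0 jc) => -[_].
by rewrite stepsS.
Qed.

Lemma ok_steps c j : ext D (fun=> 0%VS) false c -> (j < size c)%N ->
  ok D (steps c j) (odd j) (nth 0 c j).
Proof.
move=> c0 jc; have := ext_steps c0 (ltnW jc).
by rewrite (drop_nth 0 jc) => -[].
Qed.

Lemma steps_ext c : (forall j, (j < size c)%N ->
    ok D (steps c j) (odd j) (nth 0 c j)) ->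
  ext D (fun=> 0%VS) false c.
Proof.
move=> h; suff main k j : (j + k = size c)%N ->
    ext D (steps c j) (odd j) (drop j c).
  by have := @main (size c) 0%N erefl; rewrite steps0 drop0.
elim: k j => [|k IH] j jk; first by rewrite drop_oversize // -jk addn0.
have jc : (j < size c)%N by rewrite -jk; lia.
rewrite (drop_nth 0 jc); split; first exact: h.
by have := IH j.+1; rewrite stepsS; apply; rewrite -jk; lia.
Qed.

Lemma ext_rcons p v : ext D (fun=> 0%VS) false p ->
    ok D (steps p (size p)) (odd (size p)) v ->
  ext D (fun=> 0%VS) false (rcons p v) /\
  steps (rcons p v) (size (rcons p v)) =
    upd (steps p (size p)) (odd (size p)) v.
Proof.
move=> p0 okv; rewrite size_rcons stepsS -cats1 steps_cat // nth_cat ltnn subnn.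
split=> //; apply: steps_ext => j; rewrite size_cat addn1 ltnS => jp.
rewrite steps_cat // nth_cat; have [jp'|jp'] := ltnP j (size p).
  exact: ok_steps.
have -> : j = size p by apply/eqP; rewrite eqn_leq jp.
by rewrite subnn.
Qed.

Lemma ext_append p r : ext D (fun=> 0%VS) false p ->
    ext D (steps p (size p)) (odd (size p)) r ->
  ext D (fun=> 0%VS) false (p ++ r).
Proof.
elim: r p => [|v r IH] p p0; first by rewrite cats0.
move=> [okv rG]; have [pv0 pvG] := ext_rcons p0 okv.
by rewrite -cat_rcons; apply: IH => //; rewrite pvG size_rcons.
Qed.

Lemma state0 : state D (fun=> 0%VS) false (2 * n).
Proof.
split; rewrite ?dimv0 // => e; rewrite limg0 !sub0v; split=> //.
Qed.

Lemma state_steps c j : ext D (fun=> 0%VS) false c -> size c = (2 * n)%N ->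
  (j <= 2 * n)%N -> state D (steps c j) (odd j) (2 * n - j).
Proof.
move=> c0 sc; elim: j => [|j IH] jn; first by rewrite steps0 subn0; exact: state0.
rewrite stepsS; apply: state_upd; last by apply: ok_steps; rewrite ?sc.
by rewrite -subSn // subSS; apply: IH; exact: ltnW.
Qed.

Lemma dim_steps c i e : ext D (fun=> 0%VS) false c -> size c = (2 * n)%N ->
  (i <= n)%N -> \dim (steps c (2 * i) e) = i.
Proof.
move=> c0 sc i_n; have jn : (2 * i <= 2 * n)%N by rewrite leq_mul2l.
have [_ d1 d2] := state_steps c0 sc jn; rewrite oddM /= addn0 in d2.
by case: e; lia.
Qed.

Lemma steps_mono c j j' d : (j <= j')%N -> (steps c j d <= steps c j' d)%VS.
Proof.
elim: j' => [|j' IH]; first by rewrite leqn0 => /eqP ->.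
rewrite leq_eqVlt => /orP[/eqP -> //|]; rewrite ltnS => /IH h.
by rewrite stepsS (subv_trans h) // upd_sub.
Qed.

End Steps.

Section Flags.
Context {K : numClosedFieldType} {V0 V1 : vectType K} {n : nat}.
Variables (phi : bilform K V0) (psi : bilform K V1).
Local Notation V := (V0 * V1)%type.
Implicit Types (c : seq V) (i : nat).

Definition ebasis c : {ffun 'I_n -> V0} :=
  [ffun i : 'I_n => (nth 0 c (2 * i)).1].
Definition fbasis c : {ffun 'I_n -> V1} :=
  [ffun i : 'I_n => (nth 0 c (2 * i).+1).2].

Lemma steps_doubleS c i : steps c (2 * i.+1) =
  upd (upd (steps c (2 * i)) false (nth 0 c (2 * i))) true
    (nth 0 c (2 * i).+1).
Proof. by rewrite mulnS !addSn !stepsS /= oddM. Qed.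

Lemma pfst_steps c i : (pfst @: steps c (2 * i) false =
  \sum_(j < i) <[(nth 0%R c (2 * j)).1]>)%VS.
Proof.
elim: i => [|i IH]; first by rewrite steps0 limg0 big_ord0.
by rewrite big_ord_recr -IH steps_doubleS /upd /= limgD limg_line pfstE.
Qed.

Lemma psnd_steps c i : (psnd @: steps c (2 * i) true =
  \sum_(j < i) <[(nth 0%R c (2 * j).+1).2]>)%VS.
Proof.
elim: i => [|i IH]; first by rewrite steps0 limg0 big_ord0.
by rewrite big_ord_recr -IH steps_doubleS /upd /= limgD limg_line psndE.
Qed.

Lemma sum_lines_ord (W : vectType K) (f : nat -> W) (i : 'I_n.+1) :
  (\sum_(j < i) <[f j]> = \sum_(j < n | (j < i)%N) <[f j]>)%VS.
Proof.
by rewrite (big_ord_widen n (fun j => <[f j]>%VS)) // -ltnS ltn_ord.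
Qed.

Lemma adapted_ebasis (E : isotropic_flag phi n) c :
  adapted_basis E (ebasis c) <->
  forall i : 'I_n.+1, E i = (pfst @: steps c (2 * i) false)%VS.
Proof.
have h (i : 'I_n.+1) : (\sum_(j < n | (j < i)%N) <[ebasis c j]> =
    pfst @: steps c (2 * i) false)%VS.
  rewrite pfst_steps (sum_lines_ord (fun j => (nth 0 c (2 * j)).1)).
  by apply: eq_bigr => j _; rewrite ffunE.
by split=> EE i; rewrite EE h.
Qed.

Lemma adapted_fbasis (F : isotropic_flag psi n) c :
  adapted_basis F (fbasis c) <->
  forall i : 'I_n.+1, F i = (psnd @: steps c (2 * i) true)%VS.
Proof.
have h (i : 'I_n.+1) : (\sum_(j < n | (j < i)%N) <[fbasis c j]> =
    psnd @: steps c (2 * i) true)%VS.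
  rewrite psnd_steps (sum_lines_ord (fun j => (nth 0 c (2 * j).+1).2)).
  by apply: eq_bigr => j _; rewrite ffunE.
by split=> EE i; rewrite EE h.
Qed.

Lemma flag_eq (W : vectType K) (f : bilform K W) (E E' : isotropic_flag f n) :
  (forall i : 'I_n.+1, E i = E' i) -> E = E'.
Proof.
case: E E' => [s d i o] [s' d' i' o'] /= h.
have ss : s = s' by apply: funext.
by case: _ / ss in d' i' o' *; congr IsotropicFlag; apply: Prop_irrelevance.
Qed.

Hypotheses (dimV0 : \dim {:V0} = (2 * n + 1)%N)
  (dimV1 : \dim {:V1} = (2 * n)%N).
Hypotheses (phi_nondeg : nondegenerate_bilform phi)
  (phi_sym : symmetric_bilform phi) (psi_nondeg : nondegenerate_bilform psi)
  (psi_alt : alternating_bilform psi).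
Context {u : 'Hom(V0, V1)}.
Hypothesis u_nil : odd_nilcone phi psi u.

Local Notation D := (odd_datum dimV0 dimV1 phi_nondeg phi_sym psi_nondeg
  psi_alt u_nil).
Local Notation adapted c := (ext D (fun=> 0%VS) false c /\ size c = (2 * n)%N).


(** In the order e_1, f_1, e_2, f_2, ... the vector e_i is preceded by i - 1 odd vectors and f_i by
    i even ones: this is the shift between the two incidence conditions. *)
Lemma flags_of_list c : adapted c -> exists E F,
  [/\ adapted_basis E (ebasis c), adapted_basis F (fbasis c)
    & springer_fiber phi psi n u (u, E, F)].
Proof.
move=> [c0 sc].
have st (i : 'I_n.+1) : state D (steps c (2 * i)) false (2 * n - 2 * i).
  have := @state_steps _ _ _ D c (2 * i) c0 sc; rewrite oddM; apply.
  by rewrite leq_mul2l /= -ltnS ltn_ord.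
have inv (i : 'I_n.+1) : invariant D (steps c (2 * i)) by case: (st i).
have invP (i : 'I_n.+1) d v : v \in steps c (2 * i) d ->
    [/\ v \in part D d, v \in perp (form D) (steps c (2 * i) d) &
        op D v \in steps c (2 * i) (~~ d)].
  move=> vd; have [GP Gp GX] := inv i d; split; first exact: (subvP GP).
    exact: (subvP Gp).
  by rewrite (subvP GX) // memv_img.
have part0 v : v \in part D false -> v.2 = 0 by rewrite mem_graded0 => /eqP.
have part1 v : v \in part D true -> v.1 = 0 by rewrite mem_graded1 => /eqP.
pose sE (i : 'I_n.+1) := (pfst @: steps c (2 * i) false)%VS.
pose sF (i : 'I_n.+1) := (psnd @: steps c (2 * i) true)%VS.
have dE (i : 'I_n.+1) : \dim (sE i) = i.
  rewrite limg_dim_eq; first by rewrite (dim_steps _ c0) // -ltnS ltn_ord.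
  apply/eqP; rewrite -subv0; apply/subvP => v; rewrite memv_cap => /andP[].
  move=> /invP[/part0 v2 _ _]; rewrite memv_ker pfstE memv0 => /eqP v1.
  by rewrite [v]surjective_pairing v1 v2.
have dF (i : 'I_n.+1) : \dim (sF i) = i.
  rewrite limg_dim_eq; first by rewrite (dim_steps _ c0) // -ltnS ltn_ord.
  apply/eqP; rewrite -subv0; apply/subvP => v; rewrite memv_cap => /andP[].
  move=> /invP[/part1 v1 _ _]; rewrite memv_ker psndE memv0 => /eqP v2.
  by rewrite [v]surjective_pairing v1 v2.
have iE (i j : 'I_n.+1) : (i <= j)%N -> (sE i <= sE j)%VS.
  by move=> ij; rewrite limgS // steps_mono // leq_mul2l.
have iF (i j : 'I_n.+1) : (i <= j)%N -> (sF i <= sF j)%VS.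
  by move=> ij; rewrite limgS // steps_mono // leq_mul2l.
have oE (i : 'I_n.+1) : {in sE i &, forall x y, phi x y = 0}.
  move=> _ _ /memv_imgP[v vi ->] /memv_imgP[w wi ->]; rewrite !pfstE.
  have [/part0 v2 /perpP/(_ w wi) + _] := invP _ _ _ vi.
  by rewrite sum_formE v2 form0l addr0.
have oF (i : 'I_n.+1) : {in sF i &, forall x y, psi x y = 0}.
  move=> _ _ /memv_imgP[v vi ->] /memv_imgP[w wi ->]; rewrite !psndE.
  have [/part1 v1 /perpP/(_ w wi) + _] := invP _ _ _ vi.
  by rewrite sum_formE v1 form0l add0r.
exists (IsotropicFlag dE iE oE), (IsotropicFlag dF iF oF).
split; [exact/adapted_ebasis|exact/adapted_fbasis|split=> //; split].
  move=> i j ij /=; apply/subvP => _ /memv_imgP[_ /memv_imgP[v vi ->] ->].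
  have jn : (2 * j < 2 * n)%N.
    by rewrite ltn_mul2l /=; have := ltn_ord i; rewrite ij ltnS.
  have [invU _ _] := @state_steps _ _ _ D c (2 * j).+1 c0 sc jn.
  have [_ _ GX] := invU false.
  have vj : v \in steps c (2 * j).+1 false.
    move: vi; rewrite ij mulnS !addSn stepsS /= oddM /= /upd /=.
    by rewrite add0n.
  have /(subvP GX) : op D v \in (op D @: steps c (2 * j).+1 false)%VS.
    exact: memv_img.
  rewrite stepsS oddM /= /upd /= => Xv; apply/memv_imgP.
  by exists (op D v); rewrite // psndE /= odd_eltE pfstE.
move=> i /=; apply/subvP => _ /memv_imgP[_ /memv_imgP[v vi ->] ->].
have [_ _ Xv] := invP _ _ _ vi; apply/memv_imgP.
by exists (op D v); rewrite // pfstE /= odd_eltE psndE.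
Qed.


Lemma flag_spaceS (W : vectType K) (f : bilform K W) (E : isotropic_flag f n)
    (i j : 'I_n.+1) x : i = j.+1 :> nat -> x \in E i -> x \notin E j ->
  E i = (E j + <[x]>)%VS.
Proof.
move=> ij xi xj; apply/eqP; rewrite eq_sym eqEdim subv_add -memvE xi andbT.
by rewrite flag_incl ?ij //= dim_add_line // !flag_dim ij.
Qed.

Lemma exists_flag_vectors (W : vectType K) (f : bilform K W)
    (E : isotropic_flag f n) : exists x : nat -> W, forall i, (i < n)%N ->
  x i \in E (inord i.+1) /\ x i \notin E (inord i).
Proof.
have /choice : forall i, exists x, (i < n)%N ->
    x \in E (inord i.+1) /\ x \notin E (inord i).
  move=> i; have [i_n|] := boolP (i < n)%N; last by exists 0.
  have [|x x1 x2] := @exists_notin _ _ (E (inord i.+1)) (E (inord i)).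
    by rewrite !flag_dim !inordK // ltnS ltnW.
  by exists x.
by case=> x xP; exists x.
Qed.

Lemma subZ_pair0 (v : V) (d : K) x :
  v - d *: ((x, 0) : V) = (v.1 - d *: x, v.2).
Proof. by case: v => a c; congr pair; rewrite /= scaler0 subr0. Qed.

Lemma subZ_pair1 (v : V) (d : K) y :
  v - d *: ((0, y) : V) = (v.1, v.2 - d *: y).
Proof. by case: v => a c; congr pair; rewrite /= scaler0 subr0. Qed.

Lemma list_of_flags E F : springer_fiber phi psi n u (u, E, F) ->
  exists c, [/\ adapted c, adapted_basis E (ebasis c)
              & adapted_basis F (fbasis c)].
Proof.
case=> -[uE uF] _; have [x xP] := exists_flag_vectors E.
have [y yP] := exists_flag_vectors F.
(* [x i] generates E_(i+1) over E_i and [y i] generates F_(i+1) over F_i; they are interleaved, the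
   even one first. *)
pose c := mkseq (fun k => if odd k then (0, y k./2) else (x k./2, 0) : V) (2 * n).
have sc : size c = (2 * n)%N by rewrite size_mkseq.
have nth0 i : (i < n)%N -> nth 0 c (2 * i) = (x i, 0).
  move=> i_n; rewrite nth_mkseq ?ltn_mul2l // mul2n odd_double.
  by rewrite half_double.
have nth1 i : (i < n)%N -> nth 0 c (2 * i).+1 = (0, y i).
  move=> i_n; rewrite nth_mkseq; last by lia.
  by rewrite mul2n /= odd_double uphalf_double.
have flag0 (W : vectType K) (f : bilform K W) (H : isotropic_flag f n) :
    H (inord 0) = 0%VS.
  by apply/eqP; rewrite -dimv_eq0 flag_dim inordK.
have step0 i v : (i <= n)%N ->
    (v \in steps c (2 * i) false) = (v.2 == 0) && (v.1 \in E (inord i)).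
  elim: i v => [|i IH] v i_n.
    by rewrite muln0 steps0 flag0 !memv0 andbC; case: v.
  rewrite steps_doubleS /upd /= nth0 //.
  rewrite (@flag_spaceS _ _ E _ (inord i) (x i)); last 3 first.
  - by rewrite !inordK // ltnS ltnW.
  - by case: (xP i i_n).
  - by case: (xP i i_n).
  apply/memv_add_lineP/andP => [[d]|[v2 /memv_add_lineP[d vd]]].
    rewrite subZ_pair0 (IH _ (ltnW i_n)) => /andP[v2 vE]; split=> //.
    by apply/memv_add_lineP; exists d.
  by exists d; rewrite subZ_pair0 (IH _ (ltnW i_n)) vd andbT.
have step1 i v : (i <= n)%N ->
    (v \in steps c (2 * i) true) = (v.1 == 0) && (v.2 \in F (inord i)).
  elim: i v => [|i IH] v i_n.
    by rewrite muln0 steps0 flag0 !memv0; case: v.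
  rewrite steps_doubleS /upd /= nth1 //.
  rewrite (@flag_spaceS _ _ F _ (inord i) (y i)); last 3 first.
  - by rewrite !inordK // ltnS ltnW.
  - by case: (yP i i_n).
  - by case: (yP i i_n).
  apply/memv_add_lineP/andP => [[d]|[v1 /memv_add_lineP[d vd]]].
    rewrite subZ_pair1 (IH _ (ltnW i_n)) => /andP[v1 vF]; split=> //.
    by apply/memv_add_lineP; exists d.
  by exists d; rewrite subZ_pair1 (IH _ (ltnW i_n)) vd andbT.
have leE i : (i < n)%N -> (E (inord i) <= E (inord i.+1))%VS.
  by move=> i_n; apply: flag_incl; rewrite !inordK // ltnS // ltnW.
have leF i : (i < n)%N -> (F (inord i) <= F (inord i.+1))%VS.
  by move=> i_n; apply: flag_incl; rewrite !inordK // ltnS // ltnW.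
exists c; split; first split=> //.
- apply: steps_ext => j; rewrite sc => j_n.
  have [i [j2 jE]] : exists i, (i < n)%N /\ j = (2 * i + odd j)%N.
    by exists j./2; have := odd_double_half j; split; lia.
  have [xi xi'] := xP _ j2; have [yi yi'] := yP _ j2.
  move: jE; case: (odd j); rewrite ?addn1 ?addn0 => jE; last first.
    rewrite jE nth0 //; split.
    + apply/kkP; split; first by rewrite mem_graded0.
        apply/perpP => a; rewrite (step0 _ _ (ltnW j2)) => /andP[_ aE].
        rewrite sum_formE /= form0l addr0; apply: (flag_isotropic xi).
        exact: (subvP (leE _ j2)).
      rewrite /= odd_eltE /= (step1 _ _ (ltnW j2)) /= linear0 eqxx /=.
      apply: (subvP (uE (inord i.+1) (inord i) _)).
        by rewrite !inordK // ltnS ltnW.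
      exact: memv_img.
    + by rewrite (step0 _ _ (ltnW j2)) negb_and xi' orbT.
    + by rewrite /= sum_formE /= form0l addr0 (flag_isotropic xi).
  have stE : steps c (2 * i).+1 true = steps c (2 * i) true.
    by rewrite stepsS oddM.
  have stE' : steps c (2 * i).+1 false = steps c (2 * i.+1) false.
    by rewrite steps_doubleS stepsS oddM.
  rewrite jE nth1 //; split.
  + apply/kkP; split; first by rewrite mem_graded1.
      apply/perpP => a; rewrite stE (step1 _ _ (ltnW j2)) => /andP[_ aE].
      rewrite sum_formE /= form0l add0r; apply: (flag_isotropic yi).
      exact: (subvP (leF _ j2)).
    rewrite /= stE' odd_eltE /= step0 //= linear0 eqxx /=.
    by apply: (subvP (uF _)); exact: memv_img.
  + by rewrite stE (step1 _ _ (ltnW j2)) negb_and yi' orbT.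
  + by rewrite /= sum_formE /= form0l add0r (flag_isotropic yi).
- apply/adapted_ebasis => i; have i_n : (i <= n)%N by rewrite -ltnS ltn_ord.
  apply/vspaceP => v; apply/idP/memv_imgP => [vE|[w]].
    by exists (v, 0); rewrite ?pfstE // step0 //= eqxx inord_val.
  by rewrite step0 // inord_val pfstE => /andP[_ wE] ->.
- apply/adapted_fbasis => i; have i_n : (i <= n)%N by rewrite -ltnS ltn_ord.
  apply/vspaceP => v; apply/idP/memv_imgP => [vE|[w]].
    by exists (0, v); rewrite ?psndE // step1 //= eqxx inord_val.
  by rewrite step1 // inord_val psndE => /andP[_ wE] ->.
Qed.

End Flags.

(** * Topology of the fibre *)

Section PolynomialCurves.
Context {K : numClosedFieldType}.

(** In characteristic zero 0, 1, ..., [size p] - 1 are distinct, more points than [p] can have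
    roots. *)
Lemma poly_nonroot (p : {poly K}) : p != 0 -> exists t, p.[t] != 0.
Proof.
move=> p0; pose s := [seq i%:R : K | i <- iota 0 (size p)].
have us : uniq s.
  rewrite map_inj_uniq ?iota_uniq // => i j /eqP; by rewrite eqr_nat => /eqP.
have [/allP sp|/allPn[t _ pt]] := boolP (all (root p) s); last by exists t.
have /allP/(max_poly_roots p0)/(_ us) := sp.
by rewrite size_map size_iota ltnn.
Qed.

Lemma meval_polyfun (k : nat) (q : mpoly k K) (v : K -> 'I_k -> K) :
  (forall i, exists p : {poly K}, forall t, v t i = p.[t]) ->
  exists h : {poly K}, forall t, meval (v t) q = h.[t].
Proof.
move=> /choice[p pE].
exists (\sum_(m <- msupp q) (mcoeff m q)%:P * \prod_i p i ^+ m i) => t.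
rewrite mevalE horner_sum; apply: eq_bigr => m _.
rewrite hornerM hornerC horner_prod; congr (_ * _).
by apply: eq_bigr => i _; rewrite horner_exp pE.
Qed.

Lemma polyfun_coordinates (W : vectType K) (w : K -> W)
    (q : mpoly (\dim {:W}) K) : polyfun w ->
  exists h : {poly K}, forall t, meval (coordinates (w t)) q = h.[t].
Proof.
move=> hw; apply: meval_polyfun => i.
have [p pE] := hw (linfun (coord (vbasis {:W}) i : W -> K^o)).
by exists p => t; rewrite -pE lfunE.
Qed.

Lemma polyfun_sum (W : vectType K) (I : finType) (f : I -> K -> W) :
  (forall i, polyfun (f i)) -> polyfun (fun t => \sum_i f i t).
Proof.
move=> hf l.
have /choice[p pE] : forall i, exists p : {poly K}, forall t, l (f i t) = p.[t].
  by move=> i; exact: hf.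
exists (\sum_i p i) => t; rewrite linear_sum horner_sum.
by apply: eq_bigr => i _; exact: pE.
Qed.

End PolynomialCurves.

Section BasisPoint.
Context {K : numClosedFieldType} {V0 V1 : vectType K} {n : nat}.
Local Notation V := (V0 * V1)%type.
Local Notation W := ('Hom(V0, V1) * {ffun 'I_n -> V0} * {ffun 'I_n -> V1})%type.

Definition basis_point (u : 'Hom(V0, V1)) (c : seq V) : W :=
  (u, ebasis c, fbasis c).

Definition inj_fst (i : 'I_n) (v : V) : W :=
  (0, [ffun j => if j == i then v.1 else 0], 0).
Definition inj_snd (i : 'I_n) (v : V) : W :=
  (0, 0, [ffun j => if j == i then v.2 else 0]).

Fact inj_fst_is_linear i : linear (inj_fst i).
Proof.
move=> a v w; congr (_, _, _) => /=; last by rewrite scaler0 addr0.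
  by rewrite scaler0 addr0.
by apply/ffunP => j; rewrite !ffunE; case: eqP => // _; rewrite scaler0 addr0.
Qed.

Fact inj_snd_is_linear i : linear (inj_snd i).
Proof.
move=> a v w; congr (_, _, _) => /=; [by rewrite scaler0 addr0|by rewrite scaler0 addr0|].
by apply/ffunP => j; rewrite !ffunE; case: eqP => // _; rewrite scaler0 addr0.
Qed.

HB.instance Definition _ i :=
  GRing.isLinear.Build K V W _ (inj_fst i) (inj_fst_is_linear i).
HB.instance Definition _ i :=
  GRing.isLinear.Build K V W _ (inj_snd i) (inj_snd_is_linear i).

(** A constant plus linear images of the vectors of the list, from which polynomiality along a curve
    follows. *)
Lemma basis_pointE u c : basis_point u c =
  (u, 0, 0) + \sum_(i < n) linfun (inj_fst i) (nth 0 c (2 * i)) +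
  \sum_(i < n) linfun (inj_snd i) (nth 0 c (2 * i).+1).
Proof.
have sumE (F : 'I_n -> W) : \sum_i F i =
    (\sum_i (F i).1.1, \sum_i (F i).1.2, \sum_i (F i).2).
  rewrite [LHS]surjective_pairing [X in (X, _)]surjective_pairing.
  by rewrite !raddf_sum.
rewrite !sumE; congr (_, _, _) => /=.
- rewrite !big1 ?addr0 // => i _; by rewrite lfunE.
- rewrite add0r [X in _ + X]big1 ?addr0; last by move=> i _; rewrite lfunE.
  apply/ffunP => j; rewrite sum_ffunE (bigD1 j) //= big1 ?addr0.
    by rewrite lfunE /= !ffunE eqxx.
  by move=> i ij; rewrite lfunE /= ffunE eq_sym (negPf ij).
- rewrite add0r [X in X + _]big1 ?add0r; last by move=> i _; rewrite lfunE.
  apply/ffunP => j; rewrite sum_ffunE (bigD1 j) //= big1 ?addr0.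
    by rewrite lfunE /= !ffunE eqxx.
  by move=> i ij; rewrite lfunE /= ffunE eq_sym (negPf ij).
Qed.

Lemma polyfun_basis_point u (g : K -> seq V) :
  (forall i, polyfun (fun t => nth 0 (g t) i)) ->
  polyfun (fun t => basis_point u (g t)).
Proof.
move=> hg; apply: eq_polyfun; first by move=> t; rewrite [RHS]basis_pointE.
apply: polyfunD; last by apply: polyfun_sum => i; apply: polyfun_comp.
apply: polyfunD; first exact: polyfun_const.
by apply: polyfun_sum => i; apply: polyfun_comp.
Qed.

End BasisPoint.

Section ClopenSets.
Context {K : numClosedFieldType} {V0 V1 : vectType K} {n : nat}.
Variables (phi : bilform K V0) (psi : bilform K V1).
Local Notation V := (V0 * V1)%type.
Implicit Type c : seq V.
Hypotheses (dimV0 : \dim {:V0} = (2 * n + 1)%N)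
  (dimV1 : \dim {:V1} = (2 * n)%N).
Hypotheses (phi_nondeg : nondegenerate_bilform phi)
  (phi_sym : symmetric_bilform phi) (psi_nondeg : nondegenerate_bilform psi)
  (psi_alt : alternating_bilform psi).
Context {u : 'Hom(V0, V1)}.
Hypothesis u_nil : odd_nilcone phi psi u.

Local Notation D := (odd_datum dimV0 dimV1 phi_nondeg phi_sym psi_nondeg
  psi_alt u_nil).
Local Notation adapted c := (ext D (fun=> 0%VS) false c /\ size c = (2 * n)%N).
Local Notation bpoint c := (@basis_point K V0 V1 n u c).
Local Notation fiber := (springer_fiber phi psi n u).

Lemma springer_open_test (C : set (springer_ambient phi psi n)) : open C ->
  exists S : set (mpoly _ K), forall c E F,
    adapted_basis E (ebasis c) -> adapted_basis F (fbasis c) ->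
    C (u, E, F) <-> exists2 p, S p & meval (coordinates (bpoint c)) p != 0.
Proof.
move=> Cop; have [O [S ->] CO] : springer_open C by exact: Cop.
by exists S => c E F Ec Fc; exact: CO.
Qed.

Variable B : set (springer_ambient phi psi n).

Definition list_in c : Prop := exists E F,
  [/\ adapted_basis E (ebasis c), adapted_basis F (fbasis c) & B (u, E, F)].

Lemma list_inP c E F : adapted_basis E (ebasis c) -> adapted_basis F (fbasis c) ->
  list_in c <-> B (u, E, F).
Proof.
move=> Ec Fc; split=> [[E' [F' [E'c F'c]]]|BEF]; last by exists E, F.
have -> : E' = E by apply: flag_eq => i; rewrite Ec E'c.
by have -> : F' = F by apply: flag_eq => i; rewrite Fc F'c.
Qed.

Lemma list_in_steps c c' : (forall j, steps c j = steps c' j) ->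
  list_in c <-> list_in c'.
Proof.
by move=> cc'; split=> -[E [F [/adapted_ebasis Ec /adapted_fbasis Fc BEF]]];
  exists E, F; split=> //; (try apply/adapted_ebasis); (try apply/adapted_fbasis);
  move=> i; rewrite ?Ec ?Fc cc'.
Qed.

Hypothesis B_open : exists2 C, open C & B = fiber `&` C.
Hypothesis B_closed : exists2 C, closed C & B = fiber `&` C.

(** Belonging to [B] and not belonging to it are each witnessed by a polynomial that does not
    vanish. If the two ends differed, the product of these two polynomials and [d] would have a
    non-root, a parameter both inside and outside [B]. *)
Lemma list_in_curve (g : K -> seq V) (d : {poly K}) :
    d.[0] != 0 -> d.[1] != 0 -> (forall i, polyfun (fun t => nth 0 (g t) i)) ->
    (forall t, d.[t] != 0 -> adapted (g t)) ->
  list_in (g 0) <-> list_in (g 1).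
Proof.
move=> d0 d1 gpoly gad.
have [C Cop BC] := B_open; have [C' C'cl BC'] := B_closed.
have C'op : open (~` C') by exact: closed_openC.
have [S CS] := springer_open_test Cop; have [S' CS'] := springer_open_test C'op.
have bp := polyfun_basis_point (n := n) u gpoly.
have test t (dt : d.[t] != 0) :
    (list_in (g t) <-> exists2 p, S p &
       meval (coordinates (bpoint (g t))) p != 0) /\
    (~ list_in (g t) <-> exists2 p, S' p &
       meval (coordinates (bpoint (g t))) p != 0).
  have [E [F [Ec Fc fEF]]] := flags_of_list (gad t dt).
  split; first rewrite -(CS _ _ _ Ec Fc); last rewrite -(CS' _ _ _ Ec Fc);
    rewrite (list_inP Ec Fc).
    by rewrite BC; split=> [[]|].
  rewrite BC'; split=> [nB CEF|nC [_ CEF]] //; exact: nB.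
have sep a a' : d.[a] != 0 -> d.[a'] != 0 -> list_in (g a) -> ~ list_in (g a') ->
    False.
  move=> da da' /(test a da).1[p Sp pa] /(test a' da').2[q S'q qa'].
  have [h hE] := polyfun_coordinates p bp; have [k kE] := polyfun_coordinates q bp.
  have [t] : exists t, (d * h * k).[t] != 0.
    apply: poly_nonroot; rewrite !mulf_neq0 //.
    - by apply: contraNneq d0 => ->; rewrite horner0.
    - by apply: contraNneq pa => h0; rewrite hE h0 horner0.
    - by apply: contraNneq qa' => k0; rewrite kE k0 horner0.
  rewrite !hornerM !mulf_eq0 !negb_or => /andP[/andP[dt ht] kt].
  have /(test t dt).2 : exists2 p, S' p &
      meval (coordinates (bpoint (g t))) p != 0 by exists q; rewrite ?kE.
  by apply; apply/(test t dt).1; exists p; rewrite ?hE.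
by split=> h; apply: contrapT => nh; [exact: sep d0 d1 h nh|exact: sep d1 d0 h nh].
Qed.

Lemma conn_size (G : bool -> {vspace V}) e r r' :
  conn D G e r r' -> size r = size r'.
Proof.
elim=> {G e r r'} //= [G e r r' r'' _ -> _ -> //|G e v r r' _ _ -> //|].
by move=> G e g d _ _ [sg _] _; rewrite sg.
Qed.

(** The prefix [p] realises the state [G], so that a chain of completions of [G] becomes a chain of
    full lists; [conn_cons] lengthens the prefix. *)
Lemma list_in_conn (G : bool -> {vspace V}) e r r' : conn D G e r r' ->
  forall p, ext D (fun=> 0%VS) false p -> steps p (size p) = G ->
    odd (size p) = e -> size (p ++ r) = (2 * n)%N ->
  list_in (p ++ r) <-> list_in (p ++ r').
Proof.
elim=> {G e r r'} [G e r|G e r r' c IH|G e r r1 r2 c1 IH1 c2 IH2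
    |G e v r r' okv c IH|G e v w r okv okw vw rG|G e g d d0 d1 [sg gpoly] gG]
    p p0 pG pe sp //.
- apply: iff_sym; apply: IH => //.
  by move: sp; rewrite !size_cat (conn_size c).
- apply: iff_trans (IH1 p p0 pG pe sp) _; apply: IH2 => //.
  by move: sp; rewrite !size_cat (conn_size c1).
- rewrite -pG -pe in okv; have [pv0 pvG] := ext_rcons p0 okv.
  rewrite -!cat_rcons; apply: IH => //.
  + by rewrite pvG pG pe.
  + by rewrite size_rcons /= pe.
  + by rewrite cat_rcons.
- apply: list_in_steps; elim=> [|j IH]; first by rewrite !steps0.
  have [jp|jp] := ltnP j (size p); first by rewrite !steps_cat.
  rewrite !stepsS IH !nth_cat ltnNge jp /=.
  have [jp0|jp0] := eqVneq j (size p); last first.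
    by have : (0 < j - size p)%N by [lia]; case: (j - size p)%N.
  rewrite jp0 subnn /=; apply: upd_eq.
  by rewrite steps_cat // pG pe.
apply: (@list_in_curve (fun t => p ++ g t) d) => // [i|t dt].
  have [ip|ip] := ltnP i (size p).
    apply: (@eq_polyfun _ _ (fun=> nth 0 p i)); last exact: polyfun_const.
    by move=> t; rewrite nth_cat ip.
  apply: (@eq_polyfun _ _ (fun t => nth 0 (g t) (i - size p))) => // t.
  by rewrite nth_cat ltnNge ip.
split; last by rewrite size_cat sg -size_cat.
by apply: ext_append => //; rewrite pG pe; apply: gG.
Qed.

End ClopenSets.

Lemma zariski_open_linear (K : fieldType) (W : vectType K) (l : 'Hom(W, K^o)) :
  zariski_open [set w | l w != 0].
Proof.
pose p : mpoly (\dim {:W}) K :=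
  \sum_(i < \dim {:W}) l (vbasis {:W})`_i *: mpolyX K (mnm1 i).
exists [set p]; apply/seteqP.
have pE w : meval (coordinates w) p = l w.
  rewrite {2}[w](coord_vbasis (memvf w)) /p !linear_sum /=.
  apply: eq_bigr => i _; rewrite !linearZ /= mevalXU mulrC.
  by [].
split=> w /=; first by move=> lw; exists p; rewrite ?pE.
by move=> [_ ->]; rewrite pE.
Qed.

(** * Connected and disconnected fibres *)

Section FiberConnectedness.
Context {K : numClosedFieldType} {V0 V1 : vectType K} {n : nat}.
Variables (phi : bilform K V0) (psi : bilform K V1).
Local Notation V := (V0 * V1)%type.
Hypothesis n_ge1 : (1 <= n)%N.
Hypotheses (dimV0 : \dim {:V0} = (2 * n + 1)%N)
  (dimV1 : \dim {:V1} = (2 * n)%N).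
Hypotheses (phi_nondeg : nondegenerate_bilform phi)
  (phi_sym : symmetric_bilform phi) (psi_nondeg : nondegenerate_bilform psi)
  (psi_alt : alternating_bilform psi).
Context {u : 'Hom(V0, V1)}.
Hypothesis u_nil : odd_nilcone phi psi u.

Local Notation D := (odd_datum dimV0 dimV1 phi_nondeg phi_sym psi_nondeg
  psi_alt u_nil).
Local Notation fiber := (springer_fiber phi psi n u).
Local Notation G0 := (fun=> 0%VS).

Lemma fiber_connected : ~ bad D G0 -> connected fiber.
Proof.
move=> nbad B [[[u1 E1] F1] B1] Bo Bc; have [C _ BC] := Bo.
apply/seteqP; split=> [x|[[u2 E2] F2] f2]; first by rewrite BC => -[].
have := B1; rewrite {1}BC => -[f1 _].
have u1u : u1 = u by case: f1.
have u2u : u2 = u by case: f2.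
rewrite u1u in f1 B1; rewrite u2u in f2 *.
have [c1 [[e1 s1] E1c F1c]] :=
  list_of_flags dimV0 dimV1 phi_nondeg phi_sym psi_nondeg psi_alt u_nil f1.
have [c2 [[e2 s2] E2c F2c]] :=
  list_of_flags dimV0 dimV1 phi_nondeg phi_sym psi_nondeg psi_alt u_nil f2.
have cc : conn D G0 false c1 c2.
  by apply: (connected_extensions (state0 D)) => //; rewrite ?s1 ?s2.
have := list_in_conn Bo Bc cc (p := [::]) I (steps0 _) erefl s1.
by rewrite /= (list_inP B E1c F1c) (list_inP B E2c F2c) => <-.
Qed.

Definition first_line_test (w : V0) : set (springer_ambient phi psi n) :=
  [set t | exists2 y, y \in (t.1.2 : isotropic_flag phi n) (inord 1)
                      & phi y w != 0].

Lemma first_line_adapted (E : isotropic_flag phi n) (e : {ffun 'I_n -> V0}) :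
  adapted_basis E e -> E (inord 1) = <[e (Ordinal n_ge1)]>%VS.
Proof.
move=> ->; rewrite inordK ?ltnS // (big_pred1 (Ordinal n_ge1)) // => j.
by rewrite ltnS leqn0.
Qed.

Lemma first_line_test_adapted (w : V0) (t : springer_ambient phi psi n)
    (e : {ffun 'I_n -> V0}) :
  adapted_basis t.1.2 e ->
  first_line_test w t <-> phi (e (Ordinal n_ge1)) w != 0.
Proof.
move=> Ee; rewrite /first_line_test /= (first_line_adapted Ee); split.
  by move=> [_ /vlineP[c ->]]; rewrite formZl; apply: contraNneq => ->; rewrite mulr0.
by move=> ew; exists (e (Ordinal n_ge1)) => //; exact: memv_line.
Qed.

Definition first_pairing (w : V0)
    (x : 'Hom(V0, V1) * {ffun 'I_n -> V0} * {ffun 'I_n -> V1}) : K^o :=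
  phi (x.1.2 (Ordinal n_ge1)) w.

Fact first_pairing_is_linear w : linear (first_pairing w).
Proof. by move=> a x y; rewrite /first_pairing !ffunE !formE. Qed.

HB.instance Definition _ w :=
  GRing.isLinear.Build K _ K^o _ (first_pairing w) (first_pairing_is_linear w).

Lemma open_first_line_test w : open (first_line_test w).
Proof.
suff : springer_open (first_line_test w) by [].
exists [set x | linfun (first_pairing w) x != 0]; first exact: zariski_open_linear.
move=> u' E F e f Ee Ff.
by rewrite (@first_line_test_adapted w (u', E, F) e Ee) /= lfunE.
Qed.

(** On the fibre E_1 is the line of v or of v0. Being non-orthogonal to v0 and being non-orthogonal
    to v are open conditions, and there each is the negation of the other. *)
Lemma fiber_disconnected : bad D G0 -> ~ connected fiber.
Proof.
move=> [v [v0 [okv okv0 vv0 kkE]]] conn_fiber.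
have [vK vG vv] := okv; have [v0K v0G v00] := okv0.
have vP := ok_part okv; have v0P := ok_part okv0.
have pairE x y : x \in part D false -> form D x y = phi x.1 y.1.
  by rewrite mem_graded0 /= sum_formE => /eqP ->; rewrite form0l addr0.
have st : state D G0 false (2 * n).-1.+1.
  by rewrite prednK ?muln_gt0 //; exact: state0.
have first_line c w E : ext D G0 false c -> size c = (2 * n)%N ->
    adapted_basis E (ebasis c) -> forall u' F,
    first_line_test w (u', E, F) <-> phi (nth 0 c 0).1 w != 0.
  move=> c0 sc Ec u' F; rewrite (@first_line_test_adapted w (u', E, F) _ Ec).
  by rewrite ffunE.
have mk x : ok D G0 false x -> exists E F, fiber (u, E, F) /\
    forall w, first_line_test w (u, E, F) <-> phi x.1 w != 0.
  move=> okx; have [r rG sr] := exists_ext (state_upd st okx).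
  have xr : ext D G0 false (x :: r) /\ size (x :: r) = (2 * n)%N.
    by split=> //=; rewrite sr prednK // muln_gt0.
  have [E [F [Ec Fc fEF]]] := flags_of_list xr.
  by exists E, F; split=> // w; rewrite (first_line (x :: r)) //; case: xr.
have dichotomy t : fiber t -> first_line_test v0.1 t <-> ~ first_line_test v.1 t.
  case: t => -[u' E] F fEF; have u'u : u' = u by case: fEF.
  rewrite u'u in fEF *.
  have [c [[c0 sc] Ec Fc]] :=
    list_of_flags dimV0 dimV1 phi_nondeg phi_sym psi_nondeg psi_alt u_nil fEF.
  rewrite !(first_line c) //.
  have c_gt0 : (0 < size c)%N by rewrite sc muln_gt0.
  have := ok_steps c0 c_gt0; rewrite steps0 => -[xK xG xx].
  have xP : nth 0 c 0 \in part D false by case/kkP: xK.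
  rewrite -!(pairE _ _ xP).
  move: xK xx xG; set x := nth 0 c 0 => xK.
  move: (xK); rewrite kkE add0v.
  case/memv_addP => _ /vlineP[a ->] [_ /vlineP[a0 ->] ->].
  rewrite !formE vv v00 (formC0 vP v0P) !(mulr0, add0r, addr0) memv0.
  (* Isotropy of a v + a0 v0 amounts to a a0 = 0, so one of the two coefficients vanishes. *)
  have -> : a * (a0 * form D v v0) + a0 * (a * form D v v0) =
            2 * (a * a0) * form D v v0 by ring.
  move/eqP; rewrite !mulf_eq0 (negPf vv0) pnatr_eq0 /= !orbF => aa0 x0.
  have nz (d : K) w : d *: w != 0 -> d != 0.
    by move=> dw; apply: contraNneq dw => ->; rewrite scale0r.
  by case/orP: aa0 x0 => /eqP ->; rewrite scale0r eqxx ?add0r ?addr0 => /nz h.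
have [E1 [F1 [f1 t1]]] := mk v okv; have [E2 [F2 [f2 t2]]] := mk v0 okv0.
set B := fiber `&` first_line_test v0.1.
have BE : B = fiber `&` ~` first_line_test v.1.
  by apply/seteqP; split=> t [ft /(dichotomy t ft) h]; split.
have : B = fiber.
  apply: conn_fiber.
  - exists (u, E1, F1); split=> //; apply/t1; by rewrite -pairE.
  - by exists (first_line_test v0.1) => //; exact: open_first_line_test.
  - exists (~` first_line_test v.1) => //; apply: open_closedC.
    exact: open_first_line_test.
move=> BF; have : B (u, E2, F2) by rewrite BF.
by case=> _ /t2; rewrite -pairE // v00 eqxx.
Qed.

End FiberConnectedness.

(** * Normal form on the orbit O_1 *)

Section RegularNilpotent.
Context {K : numClosedFieldType} {V : vectType K} {m : nat}.
Variables (psi : bilform K V) (N : 'End(V)).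
Hypotheses (psi_nondeg : nondegenerate_bilform psi)
  (psi_skew : forall x y, psi y x = - psi x y)
  (N_skew : forall x y, psi (N x) y = - psi x (N y)).
Hypothesis N_nil : exists k, forall y, iter k N y = 0.
Hypothesis N_regular : (\dim (lker N) <= 1)%N.
Hypothesis dimV : \dim {:V} = (2 * m.+1)%N.

(** dim V - 1, the last exponent at which the powers of [N] are non-zero. *)
Local Notation top := (2 * m).+1.

Let U k : {vspace V} := iter k (fun A => N @: A)%VS fullv.

Lemma mem_iter_image k v : reflect (exists y, v = iter k N y) (v \in U k).
Proof.
elim: k v => [|k IH] v; first by rewrite memvf; left; exists v.
apply: (iffP memv_imgP) => [[w /IH[y ->] ->]|[y ->]]; first by exists y.
by exists (iter k N y); rewrite //; apply/IH; exists y.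
Qed.

(** Each application of [N] loses exactly one dimension: at most one because the kernel is at most a
    line, at least one because a nilpotent map is not injective on a non-zero stable subspace. *)
Lemma dim_iter_image k : (k <= top.+1)%N -> (\dim (U k) + k = top.+1)%N.
Proof.
elim: k => [|k IH] kt; first by rewrite dimV; lia.
have := limg_ker_dim N (U k); rewrite -[(N @: U k)%VS]/(U k.+1).
have k1 : (\dim (U k :&: lker N) <= 1)%N.
  by rewrite (leq_trans _ N_regular) // dimvS // capvSr.
have k0 : (\dim (U k :&: lker N) != 0)%N.
  apply/negP; rewrite dimv_eq0 => /eqP ker0.
  have [j Nj] := N_nil.
  have UN : (N @: U k <= U k)%VS.
    apply/subvP => _ /memv_imgP[v /mem_iter_image[y ->] ->].
    by apply/mem_iter_image; exists (N y); rewrite -iterS -iterSr.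
  have UE : (N @: U k)%VS = U k.
    by apply/eqP; rewrite eqEdim UN limg_dim_eq // leqnn.
  have Uj i : U (i + k) = U k by elim: i => //= i; rewrite /U /= => ->.
  have : U k = 0%VS.
    apply/eqP; rewrite -subv0 -(Uj j); apply/subvP => v /mem_iter_image[y ->].
    by rewrite iterD Nj mem0v.
  move=> U0; have := IH (ltnW kt); rewrite U0 dimv0; lia.
have := IH (ltnW kt); lia.
Qed.

Lemma iter_top y j : (top < j)%N -> iter j N y = 0.
Proof.
move=> jt; have dU : \dim (U top.+1) = 0%N.
  by have := dim_iter_image (leqnn top.+1); lia.
have /eqP U0 : U top.+1 == 0%VS by rewrite -dimv_eq0 dU.
have /subnK <- := jt; rewrite iterD.
have -> : iter top.+1 N y = 0.
  by apply/eqP; rewrite -memv0 -U0; apply/mem_iter_image; exists y.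
by elim: (j - _)%N => //= i ->; rewrite linear0.
Qed.

Lemma iter_skew i x y : psi (iter i N x) y = (-1) ^+ i * psi x (iter i N y).
Proof.
elim: i x y => [|i IH] x y; first by rewrite mul1r.
by rewrite iterS N_skew IH exprS mulN1r mulNr -iterSr.
Qed.

(** Up to sign this is psi (N^j y, N^j y), and psi is alternating. *)
Lemma even_moment y j : psi y (iter (2 * j) N y) = 0.
Proof.
have alt z : psi z z = 0.
  by have /eqP := psi_skew z z; rewrite -addr_eq0 -mulr2n mulrn_eq0 => /eqP.
rewrite mul2n -addnn iterD; apply/eqP.
have := iter_skew j y (iter j N y); rewrite alt => /esym/eqP.
by rewrite mulf_eq0 signr_eq0.
Qed.

(** As [top] is odd, psi (x, N^top y) is symmetric in x and y, and it is non-zero because N^top is.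
    Polarisation gives a vector on which it does not vanish, and a square root normalises it. *)
Lemma exists_top_moment : exists y, psi y (iter top N y) = 1.
Proof.
pose q x y := psi x (iter top N y).
have qD x x' y y' : q (x + x') (y + y') = q x y + q x' y + (q x y' + q x' y').
  have itD z z' k : iter k N (z + z') = iter k N z + iter k N z'.
    by elim: k => //= k ->; rewrite linearD.
  by rewrite /q itD !formE; ring.
have q_sym x y : q x y = q y x.
  by rewrite /q psi_skew iter_skew exprS exprM sqrrN expr1n expr1n mulr1 mulN1r opprK.
have [y0 qy] : exists y, q y y != 0.
  apply: contrapT => h.
  have q0 z : q z z = 0 by apply: contrapT => /eqP qz; apply: h; exists z.
  have q00 x y : q x y = 0.
    have := q0 (x + y); rewrite qD !q0 add0r addr0 q_sym -mulr2n => /eqP.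
    by rewrite mulrn_eq0 => /eqP.
  have : U top = 0%VS.
    apply/eqP; rewrite -subv0; apply/subvP => v /mem_iter_image[y ->].
    rewrite memv0; apply/eqP; apply: (nondegenerateP psi_nondeg) => x.
    by rewrite psi_skew -/(q x y) q00 oppr0.
  by have := dim_iter_image (leqnSn top) => + U0; rewrite U0 dimv0; lia.
exists ((sqrtC (q y0 y0))^-1 *: y0).
have itZ c z k : iter k N (c *: z) = c *: iter k N z.
  by elim: k => //= k ->; rewrite linearZ.
rewrite itZ !formE -/(q y0 y0) mulrA -invfM -expr2 sqrtCK mulVf //.
Qed.

(* Replacing [y] by [y + a N^(2k) y] changes the moment of order [top - 2k] by
   [2 a] and leaves the higher ones unchanged. *)
Lemma exists_normal_moments k : (k <= m.+1)%N -> exists y,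
  psi y (iter top N y) = 1 /\
  forall i j, (0 < i < k)%N -> (j + 2 * i = top)%N -> psi y (iter j N y) = 0.
Proof.
elim: k => [|k IH] km.
  by have [y yt] := exists_top_moment; exists y; split=> // i j; rewrite andbF.
have [y [yt y0]] := IH (ltnW km).
have [->|k0] := posnP k; first by exists y; split=> // i j; case: i.
pose j0 := (top - 2 * k)%N; pose a := - (psi y (iter j0 N y) / 2).
pose z := y + a *: iter (2 * k) N y.
have itE l : iter l N z = iter l N y + a *: iter (l + 2 * k) N y.
  by elim: l => //= l ->; rewrite linearD linearZ.
have momE l : psi z (iter l N z) = psi y (iter l N y) +
    2 * a * psi y (iter (l + 2 * k) N y) +
    a ^+ 2 * psi y (iter (l + 4 * k) N y).
  rewrite itE /z !formE !iter_skew exprM sqrrN !expr1n !mul1r -!iterD.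
  have -> : (2 * k + l = l + 2 * k)%N by lia.
  have -> : (2 * k + (l + 2 * k) = l + 4 * k)%N by lia.
  ring.
have big l : (top < l)%N -> psi y (iter l N y) = 0.
  by move=> lt; rewrite iter_top // form0r.
exists z; split.
  rewrite momE yt !big ?mulr0 ?addr0 //; lia.
move=> i j /andP[i0]; rewrite ltnS leq_eqVlt => /orP[/eqP ->|ik] ji.
  have jE : j = j0 by rewrite /j0; lia.
  rewrite momE (big (j + 4 * k)%N) ?mulr0 ?addr0; last lia.
  by rewrite ji yt mulr1 jE /a; field.
rewrite momE (y0 i) ?i0 // !big ?mulr0 ?addr0 //; lia.
Qed.

Lemma exists_standard_vector : exists y, forall j,
  psi y (iter j N y) = (j == top)%:R.
Proof.
have [y [yt y0]] := exists_normal_moments (leqnn m.+1).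
exists y => j; have [->|jt] := eqVneq j top; first exact: yt.
have [lt|lt] := ltnP top j; first by rewrite iter_top // form0r.
have [oj|oj] := boolP (odd j); last first.
  have -> : j = (2 * j./2)%N by have := odd_double_half j; lia.
  exact: even_moment.
(* Both [top] and j are odd and j < top, so j + 2 i = top with 0 < i <= m. *)
apply: (y0 (top - j)./2 j); lia.
Qed.

End RegularNilpotent.

Section Isometries.
Context {K : fieldType} {V : vectType K}.
Variable b : bilform K V.

Lemma free_dual (X Z : nat -> V) k :
    (forall i j, (i < k)%N -> (j < k)%N -> i != j -> b (X i) (Z j) = 0) ->
    (forall i, (i < k)%N -> b (X i) (Z i) != 0) ->
  free (mkseq X k).
Proof.
move=> XZ0 XZ; have sk : size (mkseq X k) = k by rewrite size_mkseq.
apply/(@freeP _ _ _ (in_tuple (mkseq X k))) => c c0 i.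
have ik : (i < k)%N by rewrite -[X in (_ < X)%N]sk.
have := congr1 (fun v => b v (Z i)) c0; rewrite form0l.
rewrite linear_sum sum_lfunE (bigD1 i) //= big1 ?addr0 => [|j ji]; last first.
  have jk : (j < k)%N by rewrite -[X in (_ < X)%N]sk.
  by rewrite formZl nth_mkseq // XZ0 ?mulr0.
rewrite formZl nth_mkseq // => /eqP.
by rewrite mulf_eq0 (negPf (XZ i ik)) orbF => /eqP.
Qed.

Lemma eq_lfun_basis (W : vectType K) (X : nat -> V) k (f g : 'Hom(V, W)) :
  free (mkseq X k) -> \dim {:V} = k ->
  (forall i, (i < k)%N -> f (X i) = g (X i)) -> f = g.
Proof.
move=> Xfree dV fg; have Xfull : <<mkseq X k>>%VS = fullv.
  by apply/eqP; rewrite eqEdim subvf dV (eqP Xfree) size_mkseq leqnn.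
apply/lfunP => v; have : v \in <<mkseq X k>>%VS by rewrite Xfull memvf.
move: v; apply/span_lfunP => v vX.
have [i ik <-] := nthP 0 vX; rewrite size_mkseq in ik.
by rewrite nth_mkseq //; exact: fg.
Qed.

Lemma exists_isometry (X Y : nat -> V) k :
    free (mkseq X k) -> \dim {:V} = k ->
    (forall i j, (i < k)%N -> (j < k)%N -> b (X i) (X j) = b (Y i) (Y j)) ->
  exists2 g, isometries b g & forall i, (i < k)%N -> g (X i) = Y i.
Proof.
move=> Xfree dV XY; have [f fXY] := linear_of_free (mkseq X k) (mkseq Y k).
have [g gE] : exists g : 'End(V), g =1 f by exists (linfun f) => x; rewrite lfunE.
have gX i : (i < k)%N -> g (X i) = Y i.
  move=> ik; rewrite gE.
  have := fXY Xfree; rewrite !size_mkseq => /(_ erefl) fE.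
  have := congr1 (fun s => nth 0 s i) fE.
  by rewrite (nth_map 0) ?size_mkseq // !nth_mkseq.
exists g => // x y.
suff -> : b x = (transpose g \o b \o g)%VF x.
  by rewrite !comp_lfunE /transpose lfunE /= /precomp comp_lfunE.
congr (fun_of_lfun _ x); apply: (eq_lfun_basis Xfree dV) => i ik.
apply: (eq_lfun_basis Xfree dV) => j jk.
by rewrite !comp_lfunE /transpose lfunE /= /precomp comp_lfunE !gX // XY.
Qed.

Lemma isometry_lker g : nondegenerate_bilform b -> isometries b g -> lker g = 0%VS.
Proof.
move=> bnd gb; apply/eqP; rewrite -subv0; apply/subvP => v.
rewrite memv_ker memv0 => /eqP gv; rewrite -memv0 -bnd memv_ker.
by apply/eqP/lfunP => y; rewrite -gb gv form0l lfunE.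
Qed.

End Isometries.

Section StandardBases.
Context {K : numClosedFieldType} {V0 V1 : vectType K} {m : nat}.
Variables (phi : bilform K V0) (psi : bilform K V1).
Hypotheses (dimV0 : \dim {:V0} = (2 * m.+1 + 1)%N)
  (dimV1 : \dim {:V1} = (2 * m.+1)%N).
Hypotheses (phi_nondeg : nondegenerate_bilform phi)
  (phi_sym : symmetric_bilform phi) (psi_nondeg : nondegenerate_bilform psi)
  (psi_alt : alternating_bilform psi).
Implicit Type u : 'Hom(V0, V1).
Local Notation top := (2 * m).+1.
Local Notation N u := (u \o adjoint phi psi u)%VF.

(* [x1, x2] is a hyperbolic basis of the kernel of [u] and [y] a cyclic vector
   of [u u^*]; the diagram of such a [u] is that of O_1. *)
Record standard_vectors u (x1 x2 : V0) (y : V1) : Prop := StandardVectors {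
  std_ker1 : u x1 = 0;
  std_ker2 : u x2 = 0;
  std_iso1 : phi x1 x1 = 0;
  std_iso2 : phi x2 x2 = 0;
  std_pair : phi x1 x2 = 1;
  std_moment : forall j, psi y (iter j (N u) y) = (j == top)%:R }.

Lemma op2E u z : (N u) z = u (adjoint phi psi u z).
Proof. exact: comp_lfunE. Qed.

Lemma op2_skew u x y : psi (N u x) y = - psi x (N u y).
Proof.
rewrite !op2E (alternating_skew psi_alt) -(@adjointE _ _ _ phi psi) //.
by rewrite phi_sym adjointE.
Qed.

Definition std_vec0 u x1 x2 y (i : nat) : V0 :=
  match i with
  | 0 => x1 | 1 => x2 | i.+2 => adjoint phi psi u (iter i (N u) y)
  end.

(** The Gram matrix of [std_vec0]. The shift to j + 1 comes from phi (u^* N^i y, u^* N^j y) = psi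
    (N^i y, N^(j+1) y). *)
Definition std_gram0 (i j : nat) : K :=
  match i, j with
  | 0, 1 => 1 | 1, 0 => 1
  | i.+2, j.+2 => (-1) ^+ i * (i + j.+1 == top)%N%:R
  | _, _ => 0
  end.

Lemma std_gram1E u x1 x2 y i j : standard_vectors u x1 x2 y ->
  psi (iter i (N u) y) (iter j (N u) y) = (-1) ^+ i * (i + j == top)%N%:R.
Proof.
by case=> _ _ _ _ _ mom; rewrite (iter_skew (op2_skew u)) -iterD mom.
Qed.

Lemma std_gram0E u x1 x2 y i j : standard_vectors u x1 x2 y ->
  phi (std_vec0 u x1 x2 y i) (std_vec0 u x1 x2 y j) = std_gram0 i j.
Proof.
move=> su; have [k1 k2 i1 i2 p _] := su.
have adj z x : u x = 0 -> phi (adjoint phi psi u z) x = 0.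
  by move=> ux; rewrite adjointE // ux form0r.
have adjC z x : u x = 0 -> phi x (adjoint phi psi u z) = 0.
  by move=> ux; rewrite phi_sym adj.
case: i j => [|[|i]] [|[|j]] //=; try exact: adj; try exact: adjC.
  by rewrite phi_sym.
by rewrite adjointE // -op2E -iterS (std_gram1E _ _ su).
Qed.

Lemma std_free1 u x1 x2 y : standard_vectors u x1 x2 y ->
  free (mkseq (fun i => iter i (N u) y) (2 * m.+1)).
Proof.
move=> su; apply: (@free_dual _ _ psi _ (fun j => iter (top - j) (N u) y)).
  move=> i j ik jk ij; rewrite (std_gram1E _ _ su).
  have -> : (i + (top - j) == top)%N = false by lia.
  by rewrite mulr0.
move=> i ik; rewrite (std_gram1E _ _ su).
have -> : (i + (top - i) == top)%N by lia.
by rewrite mulr1 signr_eq0.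
Qed.

Lemma std_free0 u x1 x2 y : standard_vectors u x1 x2 y ->
  free (mkseq (std_vec0 u x1 x2 y) (2 * m.+1 + 1)).
Proof.
(* The involution that sends each basis vector to the only one it pairs with: x1 and x2 are
   exchanged, and i is sent to 2 m - i among the images under u^*. *)
move=> su; pose s (j : nat) :=
  match j with 0 => 1%N | 1 => 0%N | j.+2 => (2 * m - j).+2 end.
apply: (@free_dual _ _ phi _ (fun j => std_vec0 u x1 x2 y (s j))).
  move=> i j ik jk ij; rewrite (std_gram0E _ _ su).
  case: i j ik jk ij => [|[|i]] [|[|j]] //= ik jk ij.
  have -> : (i + (2 * m - j).+1 == top)%N = false by move/eqP: ij; lia.
  by rewrite mulr0.
move=> i ik; rewrite (std_gram0E _ _ su).
case: i ik => [|[|i]] /= ik; rewrite ?oner_neq0 //.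
have -> : (i + (2 * m - i).+1 == top)%N by lia.
by rewrite mulr1 signr_eq0.
Qed.

(** The two pairs of bases have the same Gram matrices, and u and u' act on them by the same
    formulas; the isometries that match the bases therefore intertwine u and u'. *)
Lemma standard_conj u u' x1 x2 y x1' x2' y' :
  standard_vectors u x1 x2 y -> standard_vectors u' x1' x2' y' ->
  conj_orbit phi psi u u'.
Proof.
move=> su su'.
have [g g_iso gX] := exists_isometry (b := phi) (Y := std_vec0 u' x1' x2' y')
  (std_free0 su) dimV0
  (fun i j _ _ => etrans (std_gram0E i j su) (esym (std_gram0E i j su'))).
have [h h_iso hX] := exists_isometry (b := psi) (Y := fun i => iter i (N u') y')
  (std_free1 su) dimV1
  (fun i j _ _ => etrans (std_gram1E i j su) (esym (std_gram1E i j su'))).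
exists g, h; split=> //.
have hu : (h \o u = u' \o g)%VF.
  apply: (eq_lfun_basis (std_free0 su) dimV0) => i ik.
  rewrite !comp_lfunE gX //; have [k1 k2 _ _ _ _] := su.
  have [k1' k2' _ _ _ _] := su'.
  case: i ik => [|[|i]] ik /=; rewrite ?k1 ?k2 ?k1' ?k2' ?linear0 //.
  rewrite -!op2E -!iterS hX //; lia.
rewrite hu -comp_lfunA lker0_compfV ?comp_lfun1r //.
by rewrite (isometry_lker phi_nondeg g_iso).
Qed.

End StandardBases.

(** * From the diagram to the normal form *)

Section OrbitO1.
Context {K : numClosedFieldType} {V0 V1 : vectType K} {m : nat}.
Variables (phi : bilform K V0) (psi : bilform K V1).
Local Notation V := (V0 * V1)%type.
Hypotheses (dimV0 : \dim {:V0} = (2 * m.+1 + 1)%N)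
  (dimV1 : \dim {:V1} = (2 * m.+1)%N).
Hypotheses (phi_nondeg : nondegenerate_bilform phi)
  (phi_sym : symmetric_bilform phi) (psi_nondeg : nondegenerate_bilform psi)
  (psi_alt : alternating_bilform psi).
Context {u : 'Hom(V0, V1)}.
Hypothesis u_nil : odd_nilcone phi psi u.

Local Notation D := (odd_datum dimV0 dimV1 phi_nondeg phi_sym psi_nondeg
  psi_alt u_nil).
Local Notation G0 := (fun=> 0%VS).
Local Notation b := (form D).
Local Notation X := (op D).

Lemma mem_kk0 v : (v \in kk D G0 false) = (v \in graded_part false) && (X v == 0).
Proof.
apply/kkP/andP => [[vP _ Xv]|[vP /eqP Xv]]; first by rewrite -memv0.
split=> //; last by rewrite Xv mem0v.
by apply/perpP => a; rewrite memv0 => /eqP ->; rewrite form0r.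
Qed.

(** The diagram has exactly two even lines, both of length 1, so ker u is a plane that meets the
    image of X only in zero. The radical of ker u lies in this image, so the plane is
    non-degenerate. *)
Lemma diagram_bad : has_diagram phi psi u (diagram_O1 m.+1) -> bad D G0.
Proof.
move=> diag; have [inv0 _ _] := state0 D.
have dK : \dim (kk D G0 false) = 2%N.
  transitivity (num_lines (diagram_O1 m.+1) false 1) => //; rewrite diag //.
  congr (\dim _); apply/vspaceP => v; rewrite mem_kk0 !memv_cap -memv_ker.
  have -> : v \in limg (odd_elt_exp phi psi u 0).
    by apply/memv_imgP; exists v; rewrite ?memvf // /odd_elt_exp /= id_lfunE.
  by rewrite andbT andbC.
have cap0 v : v \in kk D G0 false -> v \in limg X -> v = 0.
  move=> vK vX; apply/eqP; rewrite -memv0.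
  have := diag 2%N false isT; rewrite /num_lines /diagram_O1 /= => /esym/eqP.
  rewrite dimv_eq0 => /eqP <-; move: vK; rewrite mem_kk0 => /andP[vP Xv].
  by rewrite !memv_cap memv_ker Xv vP /odd_elt_exp /= comp_lfun1r vX.
have nondeg v : v \in kk D G0 false -> {in kk D G0 false, forall w, b v w = 0} ->
    v = 0.
  move=> vK h; apply: cap0 => //.
  have : v \in pp D false (kk D G0 false).
    by rewrite memv_cap (subvP (kk_part _ _ _) _ vK); apply/perpP.
  rewrite (@kk_pp _ _ _ D G0 true) // ppK; last first.
    rewrite addv0; apply/subvP => _ /memv_imgP[w /memv_capP[wP _] ->].
    exact: (op_part wP).
  rewrite addv0 => /memv_imgP[w _ ->]; exact: memv_img (memvf w).
have [|w wK w0] := @exists_notin _ _ (kk D G0 false) 0%VS; first by rewrite dK dimv0.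
have [|v vK vw] := @exists_notin _ _ (kk D G0 false) (0 + <[w]>)%VS.
  by rewrite dim_add_line // dK dimv0.
have vP := subvP (kk_part _ _ _) _ vK; have wP := subvP (kk_part _ _ _) _ wK.
have [x [xK x0 xx]] : exists x, [/\ x \in kk D G0 false, x \notin 0%VS & b x x = 0].
  have [ww|[s ss]] := isotropic_in_plane vP wP; first by exists w.
  exists (v + s *: w); split=> //; first by rewrite memvD ?memvZ.
  apply: contra vw => h; apply/memv_add_lineP; exists (- s).
  by rewrite scaleNr opprK.
have xP := subvP (kk_part _ _ _) _ xK.
have [y yK xy] : exists2 y, y \in kk D G0 false & b x y != 0.
  apply: contrapT => h; case/negP: x0; rewrite memv0; apply/eqP.
  apply: nondeg => // y yK; apply: contrapT => /eqP xy; apply: h.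
  by exists y.
have yP := subvP (kk_part _ _ _) _ yK.
(* Corrects y along the isotropic vector x, which gives the other isotropic line of the plane. *)
pose z := y - (b y y / (2 * b x y)) *: x.
have zK : z \in kk D G0 false by rewrite memvB ?memvZ.
have xz : b x z != 0 by rewrite /z !formE xx mulr0 oppr0 addr0.
have zz : b z z = 0.
  by rewrite /z !formE xx (formC0 xP yP); field.
have zx : z \notin (0 + <[x]>)%VS.
  apply/negP => /memv_add_lineP[c]; rewrite memv0 subr_eq0 => /eqP zE.
  by move: xz; rewrite zE formE xx mulr0 eqxx.
have z0 : z \notin 0%VS.
  by apply: contra xz; rewrite memv0 => /eqP ->; rewrite form0r.
exists x, z; split=> //.
apply/eqP; rewrite eq_sym eqEdim !subv_add sub0v -!memvE xK zK.
by rewrite dK dim_span2 // dimv0.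
Qed.

(** [exists_standard_vector] applies to N = u u^* once ker N is at most a line; the bound comes from
    the odd part of ker X, a line by [dim_kk]. *)
Lemma bad_standard : bad D G0 ->
  exists x1 x2 y, @standard_vectors _ _ _ m phi psi u x1 x2 y.
Proof.
move=> [v [v0 [[vK vG vv] [v0K v0G v00] vv0 kkE]]]; have [inv0 _ _] := state0 D.
have vP := subvP (kk_part _ _ _) _ vK; have v0P := subvP (kk_part _ _ _) _ v0K.
have pairE x y : x \in part D false -> b x y = phi x.1 y.1.
  by rewrite mem_graded0 /= sum_formE => /eqP ->; rewrite form0l addr0.
have kerE x : x \in kk D G0 false -> u x.1 = 0.
  rewrite mem_kk0 => /andP[_ /eqP Xx].
  by have := congr1 snd Xx; rewrite /= odd_eltE.
pose N := (u \o adjoint phi psi u)%VF.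
have XX y : X (X (0, y)) = (0, N y).
  by rewrite /= !odd_eltE /= !linear0 /N comp_lfunE.
have iterX k y : iter (2 * k) X (0, y) = (0, iter k N y).
  by elim: k => // k IH; rewrite mulnS !addSn !iterS add0n IH XX.
have N_nil : exists k, forall y, iter k N y = 0.
  have [k uk] := u_nil; exists k => y.
  suff : iter (2 * k) X ((0, y) : V) = 0 by rewrite iterX => -[].
  rewrite mul2n -addnn iterD /= -odd_elt_expE uk lfunE /=.
  elim: k {uk} => //= k ->; exact: linear0.
have dkk1 : \dim (kk D G0 true) = 1%N.
  have := dim_kk true inv0; rewrite /= !dimv0 kkE dim_span2 //; last first.
    apply/negP => /memv_add_lineP[c]; rewrite memv0 subr_eq0 => /eqP v0E.
    by move: vv0; rewrite v0E formE vv mulr0 eqxx.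
  rewrite dimv0 /= !dim_graded0 !dim_graded1 dimV0 dimV1; lia.
(* If N y = 0, then u^* y lies in ker u and, as an image, is orthogonal to ker u, hence vanishes by
   non-degeneracy. So y lies in ker u^*, the odd part of ker X. *)
have N_ker : (\dim (lker N) <= 1)%N.
  rewrite -dkk1; have : (lker N <= psnd @: kk D G0 true)%VS.
    apply/subvP => y; rewrite memv_ker => /eqP Ny; apply/memv_imgP.
    exists (0, y); last by rewrite psndE.
    have y_pp : ((0, y) : V) \in pp D true (G0 true).
      rewrite memv_cap mem_graded1 eqxx; apply/perpP => a.
      by rewrite memv0 => /eqP ->; rewrite form0r.
    have XK : X (0, y) \in kk D G0 false.
      rewrite mem_kk0 XX Ny eqxx andbT.
      by case/memv_capP: y_pp => yP _; exact: (op_part yP).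
    have Xv : b (X (0, y)) v = 0 by apply: (op_perp_kk (e := false)) vK.
    have Xv0 : b (X (0, y)) v0 = 0 by apply: (op_perp_kk (e := false)) v0K.
    rewrite memv_cap y_pp -memv_preim memv0.
    move: XK Xv Xv0; rewrite kkE add0v.
    case/memv_addP => _ /vlineP[a ->] [_ /vlineP[a0 ->] ->].
    rewrite !formE vv v00 (formC0 vP v0P) !(mulr0, add0r, addr0).
    move/eqP; rewrite mulf_eq0 (negPf vv0) orbF => /eqP ->.
    move/eqP; rewrite mulf_eq0 (negPf vv0) orbF => /eqP ->.
    by rewrite !scale0r addr0 /= eqxx.
  move/dimvS => h; apply: (leq_trans h).
  by rewrite -(limg_ker_dim psnd (kk D G0 true)) leq_addl.
have [y mom] := exists_standard_vector psi_nondeg (alternating_skew psi_alt)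
  (op2_skew phi_nondeg phi_sym psi_alt u) N_nil N_ker dimV1.
exists v.1, ((b v v0)^-1 *: v0.1), y; split.
- exact: kerE.
- by rewrite linearZ /= kerE // scaler0.
- by rewrite -pairE.
- by rewrite !formE -pairE // v00 !mulr0.
- by rewrite formE -pairE // mulVf.
- exact: mom.
Qed.

End OrbitO1.

Theorem theorem0p2 (R : realType) (n : nat) (n_ge1 : (1 <= n)%N)
  (V0 V1 : vectType R[i])
  (dimV0 : \dim {:V0} = (2 * n + 1)%N) (dimV1 : \dim {:V1} = (2 * n)%N)
  (phi : bilform R[i] V0) (psi : bilform R[i] V1)
  (phi_nondeg : nondegenerate_bilform phi) (phi_sym : symmetric_bilform phi)
  (psi_nondeg : nondegenerate_bilform psi) (psi_alt : alternating_bilform psi)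
  (O1 : set 'Hom(V0, V1))
  (O1_orbit : nilpotent_orbit phi psi O1)
  (O1_diagram : forall w, O1 w -> has_diagram phi psi w (diagram_O1 n))
  (u : 'Hom(V0, V1)) (u_nil : odd_nilcone phi psi u) :
  connected (springer_fiber phi psi n u) <-> ~ O1 u.
Proof.
case: n n_ge1 dimV0 dimV1 O1_diagram => // m n_ge1 dimV0 dimV1 O1_diagram.
split=> [conn_fiber O1u|nO1].
  have := diagram_bad dimV0 dimV1 phi_nondeg phi_sym psi_nondeg psi_alt u_nil
    (O1_diagram u O1u).
  by move/(fiber_disconnected n_ge1); apply.
refine (fiber_connected (dimV0 := dimV0) (dimV1 := dimV1)
  (phi_nondeg := phi_nondeg) (phi_sym := phi_sym) (psi_nondeg := psi_nondeg)
  (psi_alt := psi_alt) (u_nil := u_nil) _).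
move=> badu; apply: nO1; have [w w_nil O1E] := O1_orbit.
have O1w : O1 w.
  rewrite O1E; exists \1%VF, \1%VF; split; try by move=> x y; rewrite !id_lfunE.
  rewrite comp_lfun1l; apply/lfunP => x; rewrite comp_lfunE; congr (w _).
  have /limg_lfunVK : x \in limg (\1 : 'End(V0))%VF.
    by apply/memv_imgP; exists x; rewrite ?memvf ?id_lfunE.
  by rewrite id_lfunE.
(* The obstruction gives u the normal form, and the diagram gives it to the representative w of the
   orbit; hence u and w are conjugate. *)
have [x1 [x2 [y su]]] := bad_standard badu.
have [x1' [x2' [y' sw]]] := bad_standard
  (diagram_bad dimV0 dimV1 phi_nondeg phi_sym psi_nondeg psi_alt w_nil
     (O1_diagram w O1w)).
rewrite O1E.
exact: (standard_conj dimV0 dimV1 phi_nondeg phi_sym psi_alt sw su).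
Qed.
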